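(* Let $0<|q|<1$ and $a,b,c,d\in\mathbb C^\ast$ such that $|b^2|<|a|$ and none of the denominator factors vanish. Then $${}_8\Psi_8\left(a;\pm b,c,d,\tfrac{qa^2}{b^2c},\tfrac{qa^2}{b^2d};q,-\tfrac{b^2}{a}\right)$$ $$=\frac{(qa,\frac qa,\frac ba,-\frac qd,\frac{b^2}{a},\frac{b^2}{a},\frac{qa}{b},-\frac{qa}{c},-\frac{bc}{a},-\frac{b^2c}{a},-\frac{qa}{bc},-\frac{b^2d}{a^2};q)_\infty}{(-qa,-\frac qa,\frac qd,-\frac ba,-\frac{qa}{b},\frac{qa}{c},\frac{bc}{a},-\frac{b^2}{a},-\frac{b^2}{a},\frac{qa}{bc},\frac{b^2c}{a},\frac{b^2d}{a^2};q)_\infty}\;{}_8\Psi_8\left(-a;\pm b,c,-d,\tfrac{qa^2}{b^2c},-\tfrac{qa^2}{b^2d};q,\tfrac{b^2}{a}\right)$$ $$+\frac{(qa,-b,c,\frac qa,\frac{b^2}{a},\frac{bd}{a},\frac{qa}{bd},\frac{qa^2}{b^2c};q)_\infty\,(q^2,\frac{q^2a}{cd},\frac{b^4cd}{a^3},\frac{qb^2c}{ad},\frac{qb^2d}{ac};q^2)_\infty\;\vartheta(-1;q)}{(\frac qb,\frac qd,-\frac{b^2}{a},\pm\frac{qa}{b},\frac{qa}{c},\frac{qa}{d},\frac{bc}{a},\frac{b^2c}{a},\frac{b^2d}{a},\frac{b^2d}{a^2},\frac{qa}{bc};q)_\infty\;\vartheta(-\frac ab;q)}.$$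
   Context: $\mathbb C^\ast=\mathbb C\setminus\{0\}$. For a base $p$ ($p=q$ or $q^2$): $(x;p)_\infty=\prod_{n\ge0}(1-xp^n)$, $(x;p)_k=(x;p)_\infty/(xp^k;p)_\infty$ for $k\in\mathbb Z$, $(x_1,\dots,x_m;p)_k=\prod_i(x_i;p)_k$ for $k\in\mathbb Z\cup\{\infty\}$; $\vartheta(z;q)=(z,q/z;q)_\infty$. In lists, $\pm x$ stands for the two entries $x,-x$. Very-well-poised bilateral series: $${}_8\Psi_8(a;a_3,\dots,a_8;q,z)=\sum_{k=-\infty}^\infty\frac{1-aq^{2k}}{1-a}\prod_{j=3}^8\frac{(a_j;q)_k}{(qa/a_j;q)_k}\,z^k .$$ *)

(* Defs.v *)
From HB Require Import structures.
From mathcomp Require Import all_boot all_order all_algebra.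
From mathcomp Require Import all_classical all_reals all_analysis.
From mathcomp Require Import complex.

Set Implicit Arguments.
Unset Strict Implicit.
Unset Printing Implicit Defensive.

Import Order.TTheory GRing.Theory Num.Theory.
Import numFieldNormedType.Exports.
Local Open Scope classical_set_scope.
Local Open Scope ring_scope.

Definition qpoch_partial (K : numFieldType) (x p : K) (N : nat) : K :=
  \prod_(0 <= n < N) (1 - x * p ^+ n).

Definition qpoch_inf (K : numFieldType) (x p : K) : K :=
  limn (qpoch_partial x p).

(* (x;p)_k for k in Z. The quotient (x;p)_oo / (x p^k;p)_oo can be 0/0 when x  *)
(* is an integral power of p; the finite product below is its usual meaning, and  *)
(* agrees with the quotient whenever the latter is defined (qpochE).           *)
Definition qpoch (K : numFieldType) (x p : K) (k : int) : K :=
  match k with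
  | Posz n => \prod_(0 <= i < n) (1 - x * p ^+ i)
  | Negz n => (\prod_(0 <= i < n.+1) (1 - x * p ^- i.+1))^-1
  end.

Lemma qpoch_partialD (K : numFieldType) (x p : K) (n N : nat) :
  qpoch_partial x p (n + N) = qpoch x p n * qpoch_partial (x * p ^+ n) p N.
Proof.
rewrite /qpoch_partial /qpoch (big_cat_nat (n := n)) //= ?leq_addr //.
congr (_ * _); rewrite -{1}[n]add0n big_addn addKn.
by apply: eq_bigr => i _; rewrite addnC exprD mulrA.
Qed.

Lemma qpochE (K : numFieldType) (x p : K) (k : int) :
  p != 0 -> cvgn (qpoch_partial (x * p ^ k) p) ->
  qpoch_inf (x * p ^ k) p != 0 ->
  qpoch x p k = qpoch_inf x p / qpoch_inf (x * p ^ k) p.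
Proof.
move=> p0; case: k => n cv nz.
  suff -> : qpoch_inf x p = qpoch x p n * qpoch_inf (x * p ^ n) p.
    by rewrite mulfK.
  apply/cvg_lim => //; rewrite -(cvg_shiftn n) /=.
  under eq_fun do rewrite addnC qpoch_partialD.
  exact: cvgMl_tmp.
set y := x * p ^ Negz n in cv nz *.
have yE : y * p ^+ n.+1 = x.
  by rewrite /y NegzE -exprnN -mulrA mulVf ?mulr1 // expf_neq0.
set Q := qpoch y p n.+1.
have QE : Q = \prod_(0 <= i < n.+1) (1 - x * p ^- i.+1).
  rewrite /Q /qpoch big_nat_rev /= add0n !big_mkord; apply: eq_bigr => i _.
  congr (1 - _); rewrite -yE -mulrA subSS; congr (_ * _).
  have {2}-> : n.+1 = (n - i + i.+1)%N by rewrite addnS subnK // -ltnS.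
  by rewrite exprD mulfK ?expf_neq0.
have shift N : qpoch_partial y p (n.+1 + N) = Q * qpoch_partial x p N.
  by rewrite qpoch_partialD yE.
have cv' : (fun N => Q * qpoch_partial x p N) @ \oo --> qpoch_inf y p.
  under eq_fun do rewrite -shift addnC.
  by have := cv; rewrite -(cvg_shiftn n.+1).
have Q0 : Q != 0.
  apply: contraNneq nz => Q0; apply/eqP/cvg_lim => //.
  rewrite -(cvg_shiftn n.+1) /=.
  under eq_fun do rewrite addnC shift Q0 mul0r.
  exact: cvg_cst.
suff -> : qpoch_inf x p = Q^-1 * qpoch_inf y p by rewrite mulfK //= QE.
apply/cvg_lim => //.
have -> : qpoch_partial x p = (fun N => Q^-1 * (Q * qpoch_partial x p N)).
  by apply/funext => N; rewrite mulKf.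
exact: cvgMl_tmp.
Qed.

Definition qpochs_inf (K : numFieldType) (xs : seq K) (p : K) : K :=
  \prod_(x <- xs) qpoch_inf x p.

Definition qtheta (K : numFieldType) (z q : K) : K :=
  qpochs_inf [:: z; q / z] q.

Definition bilateral_cvg (K : numFieldType) (f : int -> K) : Prop :=
  cvgn (series (fun n : nat => f (Posz n))) /\
  cvgn (series (fun n : nat => f (Negz n))).

Definition bilateral_sum (K : numFieldType) (f : int -> K) : K :=
  limn (series (fun n : nat => f (Posz n))) +
  limn (series (fun n : nat => f (Negz n))).

Definition Psi88_term (K : numFieldType) (a : K) (s : 6.-tuple K) (q z : K)
    (k : int) : K :=
  (1 - a * q ^ (2 * k)) / (1 - a) *
  (\prod_(x <- s) (qpoch x q k / qpoch (q * a / x) q k)) * z ^ k.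

Definition Psi88_cvg (K : numFieldType) (a : K) (s : 6.-tuple K) (q z : K) :=
  bilateral_cvg (Psi88_term a s q z).

Definition Psi88 (K : numFieldType) (a : K) (s : 6.-tuple K) (q z : K) : K :=
  bilateral_sum (Psi88_term a s q z).

(* The factors occurring in denominators of the terms: those of                *)
(* (qa/x;q)_k for k > 0, and those of 1/(x;q)_k for k < 0. A zero of           *)
(* 1/(qa/x;q)_k for k < 0 is not excluded: the term is then 0, in agreement    *)
(* with the convention 0^-1 = 0.                                               *)
Definition Psi88_defined (K : numFieldType) (a : K) (s : 6.-tuple K) (q : K) :
    Prop :=
  1 - a != 0 /\
  forall x : K, x \in s -> forall n : nat,
    1 - q * a / x * q ^+ n != 0 /\ 1 - x * q ^- n.+1 != 0.

(* Main.v *)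
(* After normalization by the products in the denominators, the terms of an 8Psi8
   with base a = t^2 and parameters t x_1, ..., t x_6 are, up to a factor, the
   values K(t q^k) t^(6k) q^(3k^2) of a Gaussian against the kernel
     K(s) = (1/s - s) prod_i (q s / x_i, q / (s x_i); q)_oo,
   which changes sign under s -> 1/s. Truncating the products makes K an
   antisymmetric Laurent polynomial, for which the sum is an antisymmetric theta
   function of degree 6 in t; by the quintuple product identity these form a plane
   of explicit functions, and this persists in the limit. So the sum is determined
   by its values at t = be and t = - be, where be, - be are two of the x_i; there
   the series terminates on one side and is summed by the q-analogue of Whipple's
   theorem. Hence each 8Psi8 of the theorem is an explicit combination of two theta
   products. Comparing the formulas for (a, d) and (- a, - d), the three-term
   relation becomes a quadratic theta function identity. *)

Require Import Defs.
From HB Require Import structures.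
From mathcomp Require Import all_boot all_order all_algebra.
From mathcomp Require Import all_classical all_reals all_analysis.
From mathcomp Require Import complex.
From mathcomp Require Import ring lra zify.
Import Order.TTheory GRing.Theory Num.Theory.
Import numFieldNormedType.Exports.
Local Open Scope ring_scope.
Local Open Scope complex_scope.

Set Implicit Arguments.
Unset Strict Implicit.
Unset Printing Implicit Defensive.

(** * Unordered sums *)

Section UnorderedSums.
Variable C : numFieldType.

(** No function theory enters: that the antisymmetric functions form a plane is not proved by
    counting zeros but by evaluating what each Laurent monomial contributes to the sum. A monomial
    s^n paired with s^-n gives a difference of two theta series of nome u^6, which up to a constant
    depends on n modulo 6 only; n = 1, 2 are instances of the quintuple product, n = 0, 3 give 0.
    The truncation is there because this argument needs finite combinations of monomials; its
    removal rests on a bound of the terms uniform in the order of truncation. Square roots are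
    parameters: u with u^2 = q for the exponents n^2 / 2, t with t^2 = a, and j with j^2 = - 1,
    since a -> - a is t -> j t. Two obstacles shape the rest. Interpolation at be and - be divides
    by th(be^2) th(- be^2), which may vanish; the closed formula is free of this factor, so such be
    are reached by continuity. Other infinite products may vanish too, so identities stay in product
    form, summands being multiplied by their denominators, until the final elimination. *)

Definition has_sum (I : eqType) (f : I -> C) (S : C) :=
  forall e : C, 0 < e -> exists s0 : seq I, forall s, uniq s ->
    {subset s0 <= s} -> `|S - \sum_(i <- s) f i| < e.

(** The bound is an element of [C]; the empty sum gives [0 <= M], which makes it real for the
    partial order. *)
Definition absum (I : eqType) (f : I -> C) :=
  exists M : C, forall s, uniq s -> \sum_(i <- s) `|f i| <= M.

Definition isum (I : eqType) (f : I -> C) : C :=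
  xget 0 [set S | has_sum f S]%classic.

Lemma ltr_half (e : C) : 0 < e -> 0 < e / 2.
Proof. by move=> e0; rewrite divr_gt0. Qed.

Lemma norm_arbitrarily_small (x : C) : (forall e : C, 0 < e -> `|x| < e) -> x = 0.
Proof.
move=> h; apply/eqP; apply: contraT => x0.
by have := h `|x|; rewrite normr_gt0 x0 ltxx => /(_ isT).
Qed.

Lemma uniq_sum_le (T : numDomainType) (I : eqType) (h : I -> T) (s s' : seq I) :
  (forall i, 0 <= h i) -> uniq s -> uniq s' -> {subset s <= s'} ->
  \sum_(i <- s) h i <= \sum_(i <- s') h i.
Proof.
move=> h0 us us' ss.
have pe : perm_eq (s ++ [seq x <- s' | x \notin s]) s'.
  apply: uniq_perm => //.
    rewrite cat_uniq us filter_uniq // andbT.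
    by apply/hasPn => x; rewrite mem_filter => /andP[].
  by move=> x; rewrite mem_cat mem_filter; case xs: (x \in s); rewrite //= ss.
by rewrite -(perm_big _ pe) big_cat /= lerDl sumr_ge0.
Qed.

Lemma has_sum_unique (I : eqType) (f : I -> C) S S' :
  has_sum f S -> has_sum f S' -> S = S'.
Proof.
move=> h h'; apply/subr0_eq/norm_arbitrarily_small => e e0.
have [s0 hs0] := h _ (ltr_half e0); have [s1 hs1] := h' _ (ltr_half e0).
set s := undup (s0 ++ s1).
have := hs0 s (undup_uniq _); have := hs1 s (undup_uniq _).
have sub0 : {subset s0 <= s} by move=> x xs; rewrite mem_undup mem_cat xs.
have sub1 : {subset s1 <= s} by move=> x xs; rewrite mem_undup mem_cat xs orbT.
move=> /(_ sub1) l1 /(_ sub0) l0.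
have -> : S - S' = (S - \sum_(i <- s) f i) - (S' - \sum_(i <- s) f i) by ring.
apply: le_lt_trans (ler_normB _ _) _.
by rewrite [e]splitr ltrD.
Qed.

Lemma eq_isum (I : eqType) (f g : I -> C) : f =1 g -> isum f = isum g.
Proof. by move=> /funext ->. Qed.

Lemma isumE (I : eqType) (f : I -> C) S : has_sum f S -> isum f = S.
Proof.
move=> h; apply: (has_sum_unique (f := f)) => //.
exact: (@xgetPex _ 0 [set S | has_sum f S]%classic (ex_intro _ S h)).
Qed.

Lemma has_sumD (I : eqType) (f g : I -> C) S T :
  has_sum f S -> has_sum g T -> has_sum (fun i => f i + g i) (S + T).
Proof.
move=> hf hg e e0.
have [s0 hs0] := hf _ (ltr_half e0); have [s1 hs1] := hg _ (ltr_half e0).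
exists (s0 ++ s1) => s us ss.
rewrite big_split /= opprD addrACA [e]splitr.
apply: le_lt_trans (ler_normD _ _) _; apply: ltrD.
  by apply: hs0 => // x xs; apply: ss; rewrite mem_cat xs.
by apply: hs1 => // x xs; apply: ss; rewrite mem_cat xs orbT.
Qed.

Lemma has_sumZ (I : eqType) (f : I -> C) c S :
  has_sum f S -> has_sum (fun i => c * f i) (c * S).
Proof.
move=> hf e e0; have [->|c0] := eqVneq c 0.
  exists [::] => s _ _; rewrite mul0r big1 ?subrr ?normr0 // => i _.
  by rewrite mul0r.
have nc : 0 < `|c| by rewrite normr_gt0.
have [s0 hs0] := hf (e / `|c|) (divr_gt0 e0 nc).
exists s0 => s us ss; rewrite -mulr_sumr -mulrBr normrM mulrC.
by rewrite -ltr_pdivlMr // hs0.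
Qed.

End UnorderedSums.

(* Of the complex numbers, the analysis below uses only that absolutely summable
   families are summable; working over an abstract such field keeps the
   construction of R[i] out of unification and of the reflexive tactics. *)
HB.mixin Record isSumComplete K of Num.NumField K := {
  sum_completeP : forall (I : eqType) (f : I -> K), absum f ->
    exists S : K, has_sum f S
}.
#[short(type="sumCompleteFieldType")]
HB.structure Definition SumCompleteField := {K of Num.NumField K & isSumComplete K}.

(** * Sum-completeness of the complex numbers *)

Section ComplexSums.
Variable R : realType.
Local Notation C := R[i].

(** The sum is the supremum of the finite sums: by monotonicity in the index set, one finite sum
    close to it bounds all larger ones from below. *)
Lemma nneg_sum_exists (I : eqType) (h : I -> R) (M : R) :
  (forall i, 0 <= h i) -> (forall s, uniq s -> \sum_(i <- s) h i <= M) ->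
  exists S : C, has_sum (fun i => (h i)%:C) S.
Proof.
move=> h0 hM.
set E := [set x | exists2 s, uniq s & x = \sum_(i <- s) h i]%classic.
have E0 : (E !=set0)%classic by exists 0; exists [::]; rewrite ?big_nil.
have Eb : has_ubound E by exists M => _ [s us ->]; exact: hM.
have Es : has_sup E by split.
exists (sup E)%:C => e e0.
have [re er] : exists re, e = re%:C.
  by apply/complex_realP; rewrite realE ltW.
have r0 : 0 < re by rewrite -ltcR -er.
have [_ [s0 us0 ->] l0] := sup_adherent r0 Es.
exists s0 => s us ss.
have -> : \sum_(i <- s) (h i)%:C = (\sum_(i <- s) h i)%:C.
  by rewrite [RHS]raddf_sum.
rewrite -rmorphB /= er.
have ls : \sum_(i <- s) h i <= sup E by apply: ub_le_sup => //; exists s.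
rewrite ger0_norm ?ler0c ?subr_ge0 // ltcR ltrBlDl -ltrBlDr.
by apply: lt_le_trans l0 _; exact: uniq_sum_le.
Qed.

(** Adding [|f|] makes real and imaginary parts nonnegative: f = (Re f + |f|) + i (Im f + |f|) - (1
    + i) |f| is a combination of three nonnegative families with bounded finite sums. *)
Lemma complex_sum_complete (I : eqType) (f : I -> C) : absum f ->
  exists S, has_sum f S.
Proof.
move=> [M hM].
pose g i := complex.Re `|f i|.
have gE i : `|f i| = (g i)%:C by rewrite /g RRe_real ?normr_real.
have M0 : 0 <= M by have := hM [::] isT; rewrite big_nil.
have [m Mm] : exists m, M = m%:C by apply/complex_realP; rewrite realE M0.
have hg s : uniq s -> \sum_(i <- s) g i <= m.
  move=> us; rewrite -lecR -Mm [X in X <= _]raddf_sum; apply: le_trans (hM s us).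
  by apply: ler_sum => i _; rewrite gE.
have g0 i : 0 <= g i by rewrite -ler0c -gE.
have hre i : `|complex.Re (f i)| <= g i.
  by rewrite -lecR -gE; exact: normc_ge_Re.
have him i : `|complex.Im (f i)| <= g i.
  have := normc_ge_Re (f i * 'i%C); rewrite ReiNIm normrN normrM.
  have -> : `|'i%C : C| = 1 by rewrite normc_def /= expr0n add0r expr1n sqrtr1.
  by rewrite mulr1 gE lecR.
have half (k : I -> R) : (forall i, `|k i| <= g i) ->
    exists S : C, has_sum (fun i => (k i + g i)%:C) S.
  move=> hk; apply: (@nneg_sum_exists _ _ (m + m)) => [i|s us].
    by have := hk i; rewrite ler_norml => /andP[]; lra.
  rewrite big_split /=; apply: lerD; last exact: hg.
  apply: le_trans (hg s us); apply: ler_sum => i _.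
  by apply: le_trans (hk i); exact: ler_norm.
have [S1 h1] := half _ hre; have [S2 h2] := half _ him.
have [S3 h3] : exists S : C, has_sum (fun i => (0 + g i)%:C) S.
  by apply: (half (fun=> 0)) => i; rewrite normr0.
exists (S1 + 'i%C * S2 + (- 1 - 'i%C) * S3).
have := has_sumD (has_sumD h1 (has_sumZ 'i%C h2)) (has_sumZ (- 1 - 'i%C) h3).
congr has_sum; apply: funext => i.
rewrite [f i in RHS]complexE add0r !rmorphD /=.
ring.
Qed.

HB.instance Definition _ := isSumComplete.Build R[i] complex_sum_complete.
End ComplexSums.

Section UnorderedSumsTheory.
Variable C : sumCompleteFieldType.

Lemma absum_has_sum (I : eqType) (f : I -> C) : absum f -> has_sum f (isum f).
Proof. by move=> /sum_completeP [S hS]; rewrite (isumE hS). Qed.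

Lemma isumD (I : eqType) (f g : I -> C) : absum f -> absum g ->
  isum (fun i => f i + g i) = isum f + isum g.
Proof. by move=> hf hg; apply/isumE/has_sumD; exact: absum_has_sum. Qed.

Lemma isumZ (I : eqType) c (f : I -> C) : absum f ->
  isum (fun i => c * f i) = c * isum f.
Proof. by move=> hf; apply/isumE/has_sumZ; exact: absum_has_sum. Qed.

Lemma absumD (I : eqType) (f g : I -> C) : absum f -> absum g ->
  absum (fun i => f i + g i).
Proof.
move=> [M hM] [N hN]; exists (M + N) => s us.
apply: le_trans (lerD (hM s us) (hN s us)); rewrite -big_split /=.
by apply: ler_sum => i _; exact: ler_normD.
Qed.

Lemma absumZ (I : eqType) c (f : I -> C) : absum f -> absum (fun i => c * f i).
Proof.
move=> [M hM]; exists (`|c| * M) => s us.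
under eq_bigr do rewrite normrM.
by rewrite -mulr_sumr ler_wpM2l // hM.
Qed.

Lemma absum_le (I : eqType) (f g : I -> C) :
  (forall i, `|f i| <= `|g i|) -> absum g -> absum f.
Proof.
move=> fg [M hM]; exists M => s us; apply: le_trans (hM s us).
by apply: ler_sum => i _.
Qed.

Lemma isumB (I : eqType) (f g : I -> C) : absum f -> absum g ->
  isum (fun i => f i - g i) = isum f - isum g.
Proof.
move=> hf hg; rewrite -[- isum g]mulN1r -isumZ // -isumD //; last exact: absumZ.
by apply: eq_isum => i; rewrite mulN1r.
Qed.

Lemma isum_reindex (I J : eqType) (h : J -> I) (f : I -> C) : injective h ->
  (forall i, (forall j, i != h j) -> f i = 0) -> absum (f \o h) ->
  absum f /\ isum f = isum (f \o h).
Proof.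
move=> hinj f0 [M hM].
(* A finite set s is traded for its preimage s'. The equality of sums is stated for every g
   vanishing where f does, because it serves for the norms as well as for f itself. *)
have key s : uniq s -> exists s' : seq J, [/\ uniq s',
    (forall j, (h j \in s) = (j \in s')) &
    (forall (V : nmodType) (g : I -> V), (forall i, f i = 0 -> g i = 0) ->
       \sum_(i <- s) g i = \sum_(j <- s') g (h j))].
  elim: s => [_|i s ih /= /andP[si us]].
    by exists [::]; split=> // V g _; rewrite !big_nil.
  have [s' [us' hs' hsum]] := ih us.
  case: (pselect (exists j, i = h j)) => [[j ij]|ne].
    exists (j :: s'); split.
    - by rewrite /= us' andbT -hs' -ij.
    - by move=> k; rewrite !inE ij (inj_eq hinj) hs'.
    - by move=> V g hg; rewrite !big_cons -ij hsum.
  exists s'; split=> //.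
    move=> k; rewrite inE -hs'; case: eqP => //= hk.
    by case: ne; exists k.
  move=> V g hg; rewrite big_cons (hg i) ?add0r ?hsum // f0 // => j.
  by apply/eqP => ij; case: ne; exists j.
have af : absum f.
  exists M => s us; have [s' [us' _ hsum]] := key s us.
  rewrite hsum; first exact: hM.
  by move=> i ->; rewrite normr0.
split=> //; apply: isumE => e e0.
have [s0 hs0] : exists s0 : seq J, forall s, uniq s -> {subset s0 <= s} ->
    `|isum (f \o h) - \sum_(i <- s) (f \o h) i| < e.
  by apply: absum_has_sum => //; exists M.
exists [seq h j | j <- s0] => s us ss.
have [s' [us' hs' hsum]] := key s us.
rewrite hsum //; apply: hs0 => // j js.
by rewrite -hs' ss // map_f.
Qed.

End UnorderedSumsTheory.

Section UnorderedSums2.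
Variable C : sumCompleteFieldType.

Lemma norm_le_eps (x M : C) : 0 <= M -> (forall e : C, 0 < e -> `|x| <= M + e) ->
  `|x| <= M.
Proof.
move=> M0 h; rewrite real_leNgt ?normr_real ?ger0_real //.
apply/negP => lt; have d0 : 0 < `|x| - M by rewrite subr_gt0.
have := h _ (ltr_half d0); rewrite -lerBlDl real_leNgt ?ger0_real ?ltW ?ltr_half //.
by rewrite ltr_pdivrMr // ltr_pMr // ltr1n.
Qed.

Lemma absum_bound_ge0 (I : eqType) (f : I -> C) (M : C) :
  (forall s, uniq s -> \sum_(i <- s) `|f i| <= M) -> 0 <= M.
Proof. by move=> /(_ [::] isT); rewrite big_nil. Qed.

Lemma isum_norm_le (I : eqType) (f : I -> C) (M : C) :
  (forall s, uniq s -> \sum_(i <- s) `|f i| <= M) -> `|isum f| <= M.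
Proof.
move=> hM; apply: norm_le_eps => [|e e0]; first exact: absum_bound_ge0 hM.
have [|s0 hs0] := absum_has_sum (f := f) _ e0; first by exists M.
have h : `|isum f - \sum_(i <- undup s0) f i| < e.
  by apply: hs0 => [|x]; rewrite ?undup_uniq ?mem_undup.
rewrite -[isum f](subrK (\sum_(i <- undup s0) f i)) addrC.
apply: le_trans (ler_normD _ _) _; apply: lerD; last exact: ltW.
exact: le_trans (ler_norm_sum _ _ _) (hM _ (undup_uniq _)).
Qed.

Lemma absum0 (I : eqType) : absum (fun _ : I => 0 : C).
Proof. by exists 0 => s _; rewrite big1 // => i _; rewrite normr0. Qed.

Lemma isum0 (I : eqType) : isum (fun _ : I => 0 : C) = 0.
Proof.
apply: isumE => e e0; exists [::] => s _ _.
by rewrite big1 ?subrr ?normr0.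
Qed.

Lemma absum_sum (I J : eqType) (s : seq I) (F : I -> J -> C) :
  (forall i, absum (F i)) -> absum (fun j => \sum_(i <- s) F i j).
Proof.
move=> aF; elim: s => [|i s ih].
  by under eq_fun do rewrite big_nil; exact: absum0.
by under eq_fun do rewrite big_cons; exact: absumD.
Qed.

Lemma isum_sum (I J : eqType) (s : seq I) (F : I -> J -> C) :
  (forall i, absum (F i)) ->
  isum (fun j => \sum_(i <- s) F i j) = \sum_(i <- s) isum (F i).
Proof.
move=> aF; elim: s => [|i s ih].
  by under eq_fun do rewrite big_nil; rewrite isum0 big_nil.
under eq_fun do rewrite big_cons.
by rewrite isumD // ?ih ?big_cons //; exact: absum_sum.
Qed.

Section Fubini.
Variables (I J : eqType) (f : I * J -> C).
Hypothesis af : absum f.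

Lemma absum_section i : absum (fun j => f (i, j)).
Proof.
have [M hM] := af; exists M => s us.
have := hM [seq (i, j) | j <- s]; rewrite big_map; apply.
by rewrite map_inj_uniq // => x y [].
Qed.

Lemma absum_isum_section : absum (fun i => isum (fun j => f (i, j))).
Proof.
have [M hM] := af; exists M => s us.
(* A phase: multiplying by [u i] turns the norm of an inner sum into an inner sum. The finite sum
   over i then moves inside, and only finite rectangles of [|f|] remain to be bounded. *)
pose u i : C := let x := isum (fun j => f (i, j)) in
  if x == 0 then 0 else `|x| / x.
have u1 i : `|u i| <= 1.
  rewrite /u; case: eqP => [_|/eqP x0]; first by rewrite normr0.
  by rewrite normrM normr_id normfV divff ?normr_eq0.
have uE i : `|isum (fun j => f (i, j))| = isum (fun j => u i * f (i, j)).
  rewrite isumZ; last exact: absum_section.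
  rewrite /u; case: eqP => [->|/eqP x0]; first by rewrite normr0 mul0r.
  by rewrite divfK.
have a i : absum (fun j => u i * f (i, j)) by apply/absumZ/absum_section.
under eq_bigr do rewrite uE.
have M0 := absum_bound_ge0 hM.
rewrite -isum_sum // -[X in X <= _]ger0_norm; last first.
  by rewrite isum_sum // sumr_ge0 // => i _; rewrite -uE.
apply: isum_norm_le => t ut.
have := hM [seq (i, j) | i <- s, j <- t].
rewrite allpairs_uniq //; last by move=> [? ?] [? ?] _ _ /= [-> ->].
move=> /(_ isT); apply: le_trans; rewrite big_allpairs exchange_big /=.
apply: ler_sum => j _; apply: le_trans (ler_norm_sum _ _ _) _.
apply: ler_sum => i _; rewrite normrM.
by rewrite ler_piMl.
Qed.

Lemma isum_pair : isum (fun i => isum (fun j => f (i, j))) = isum f.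
Proof.
apply: isumE => e e0.
have [s0 hs0] := absum_has_sum af (ltr_half e0).
exists [seq p.1 | p <- s0] => s us ss.
(* With s fixed, a second finite set t, taken to contain the second coordinates of s0, makes the
   rectangle s x t close both to the sum of the inner sums and, since it contains s0, to the total
   sum. *)
have aG : absum (fun j => \sum_(i <- s) f (i, j)).
  by apply: (absum_sum s (F := fun i j => f (i, j))) => i; exact: absum_section.
have [t0 ht0] := absum_has_sum aG (ltr_half e0).
rewrite (isum_sum s (F := fun i j => f (i, j))) in ht0; last exact: absum_section.
set t := undup (t0 ++ [seq p.2 | p <- s0]).
have t0t : {subset t0 <= t} by move=> x xt; rewrite mem_undup mem_cat xt.
have l1 := ht0 t (undup_uniq _) t0t.
have l2 : `|isum f - \sum_(i <- [seq (i, j) | i <- s, j <- t]) f i| < e / 2.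
  apply: hs0.
    by rewrite allpairs_uniq ?undup_uniq // => [[? ?] [? ?]] _ _ /= [-> ->].
  move=> [i j] ij; apply/allpairsP; exists (i, j); split => //=.
    by apply: ss; apply/mapP; exists (i, j).
  rewrite mem_undup mem_cat; apply/orP; right; apply/mapP; by exists (i, j).
rewrite big_allpairs exchange_big /= in l2.
rewrite distrC in l1.
have -> : isum f - \sum_(i <- s) isum (fun j => f (i, j)) =
  (isum f - \sum_(j <- t) \sum_(i <- s) f (i, j)) +
  (\sum_(j <- t) \sum_(i <- s) f (i, j) -
   \sum_(i <- s) isum (fun j => f (i, j))) by ring.
by apply: le_lt_trans (ler_normD _ _) _; rewrite [e]splitr ltrD.
Qed.

End Fubini.

Lemma absum_prod_le (I J : eqType) (f : I * J -> C) (g : I -> C) (h : J -> C) :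
  (forall i j, `|f (i, j)| <= `|g i| * `|h j|) -> absum g -> absum h -> absum f.
Proof.
move=> fgh [M hM] [N hN]; exists (M * N) => s us.
set s1 := undup [seq p.1 | p <- s]; set s2 := undup [seq p.2 | p <- s].
apply: (@le_trans _ _ (\sum_(p <- [seq (i, j) | i <- s1, j <- s2]) `|f p|)).
  apply: uniq_sum_le => //.
    by rewrite allpairs_uniq ?undup_uniq // => [[? ?] [? ?]] _ _ /= [-> ->].
  move=> [i j] ij; apply/allpairsP; exists (i, j); split => //=.
    by rewrite mem_undup; apply/mapP; exists (i, j).
  by rewrite mem_undup; apply/mapP; exists (i, j).
rewrite big_allpairs /=.
apply: (@le_trans _ _ (\sum_(i <- s1) `|g i| * \sum_(j <- s2) `|h j|)).
  by apply: ler_sum => i _; rewrite mulr_sumr; apply: ler_sum => j _; exact: fgh.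
rewrite -mulr_suml; apply: ler_pM.
- by apply: sumr_ge0.
- by apply: sumr_ge0.
- by apply: hM; exact: undup_uniq.
- by apply: hN; exact: undup_uniq.
Qed.

Lemma isumM (I J : eqType) (g : I -> C) (h : J -> C) : absum g -> absum h ->
  isum g * isum h = isum (fun p : I * J => g p.1 * h p.2).
Proof.
move=> ag ah; rewrite -isum_pair /=; last first.
  by apply: (absum_prod_le (g := g) (h := h)) => // i j; rewrite normrM.
under [in RHS]eq_fun => i do rewrite isumZ //.
rewrite mulrC -isumZ //; apply: eq_isum => i; exact: mulrC.
Qed.

End UnorderedSums2.

(** * Dominated convergence *)

(* A Variant, so that unification cannot unfold the limit. *)
Variant tends (K : numFieldType) (u : nat -> K) (l : K) : Prop :=
  Tends of (u @ \oo --> l)%classic.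

Section Tends.
Variable K : numFieldType.
Implicit Types (u v : nat -> K) (l m : K).

Lemma tendsP u l : tends u l <->
  forall e : K, 0 < e -> exists N : nat, forall n, (N <= n)%N -> `|l - u n| < e.
Proof.
split=> [[/cvgrPdist_lt h] e /h [N _ hN]|h]; first by exists N => n /hN.
by split; apply/cvgrPdist_lt => e /h [N hN]; exists N.
Qed.

Lemma tendsD u v l m : tends u l -> tends v m -> tends (fun n => u n + v n) (l + m).
Proof. by move=> [ul] [vm]; split; exact: cvgD. Qed.

Lemma tendsM u v l m : tends u l -> tends v m -> tends (fun n => u n * v n) (l * m).
Proof. by move=> [ul] [vm]; split; exact: cvgM. Qed.

Lemma tends_cst l : tends (fun=> l) l.
Proof. by split; exact: cvg_cst. Qed.

Lemma tendsN u l : tends u l -> tends (fun n => - u n) (- l).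
Proof. by move=> [ul]; split; exact: cvgN. Qed.

Lemma tendsV u l : l != 0 -> tends u l -> tends (fun n => (u n)^-1) l^-1.
Proof. by move=> l0 [ul]; split; exact: cvgV. Qed.

Lemma tends_unique u l m : tends u l -> tends u m -> l = m.
Proof. by move=> [ul] [um]; rewrite -(cvg_lim _ ul) // (cvg_lim _ um). Qed.

Lemma tends_sub u l (s : nat -> nat) : (forall n, (n <= s n)%N) -> tends u l ->
  tends (u \o s) l.
Proof.
move=> hs /tendsP h; apply/tendsP => e /h [N hN]; exists N => n nN.
by apply: hN; exact: leq_trans (hs n).
Qed.

Lemma tends_prod (I : Type) (s : seq I) (f : I -> nat -> K) (F : I -> K) :
  (forall i, tends (f i) (F i)) ->
  tends (fun n => \prod_(i <- s) f i n) (\prod_(i <- s) F i).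
Proof.
move=> h; elim: s => [|i s ih].
  by under eq_fun do rewrite big_nil; rewrite big_nil; exact: tends_cst.
by under eq_fun do rewrite big_cons; rewrite big_cons; exact: tendsM.
Qed.

Lemma tends_sum (I : Type) (s : seq I) (f : nat -> I -> K) (F : I -> K) :
  (forall i, tends (f^~ i) (F i)) ->
  tends (fun n => \sum_(i <- s) f n i) (\sum_(i <- s) F i).
Proof.
move=> h; elim: s => [|i s ih].
  by under eq_fun do rewrite big_nil; rewrite big_nil; exact: tends_cst.
by under eq_fun do rewrite big_cons; rewrite big_cons; exact: tendsD.
Qed.

Lemma bilateral_tends (f : int -> K) (l m : K) :
  tends (fun n => \sum_(0 <= k < n) f (Posz k)) l ->
  tends (fun n => \sum_(0 <= k < n) f (Negz k)) m ->
  bilateral_cvg f /\ bilateral_sum f = l + m.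
Proof.
move=> [hl] [hm]; split; first by split; apply/cvg_ex; eexists; [exact: hl|exact: hm].
by congr (_ + _); apply/cvg_lim.
Qed.

Lemma qpoch_inf_tends (x q l : K) :
  tends (qpoch_partial x q) l -> qpoch_inf x q = l.
Proof. by move=> [h]; apply/cvg_lim. Qed.

End Tends.
Arguments tends_cst {K} l.

Section UnorderedSums3.
Variable C : sumCompleteFieldType.

(** The finite set s0 is chosen from the majorant g alone, so the same s0 serves all members of a
    dominated sequence and their limit. *)
Lemma isum_tail (I : eqType) (f g : I -> C) (s0 : seq I) (e : C) :
  (forall i, `|f i| <= `|g i|) -> absum g -> uniq s0 ->
  (forall s, uniq s -> {subset s0 <= s} ->
     \sum_(i <- s) `|g i| - \sum_(i <- s0) `|g i| <= e) ->
  `|isum f - \sum_(i <- s0) f i| <= e.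
Proof.
move=> fg ag us0 he.
have e0 : 0 <= e by have := he s0 us0 (fun x h => h); rewrite subrr.
apply: norm_le_eps => // d d0.
have [s1 hs1] := absum_has_sum (absum_le fg ag) d0.
set s := undup (s0 ++ s1).
have sub0 : {subset s0 <= s} by move=> x xs; rewrite mem_undup mem_cat xs.
have sub1 : {subset s1 <= s} by move=> x xs; rewrite mem_undup mem_cat xs orbT.
have h1 := hs1 s (undup_uniq _) sub1.
have h0 := he s (undup_uniq _) sub0.
have pe : perm_eq s (s0 ++ [seq x <- s | x \notin s0]).
  rewrite perm_sym; apply: uniq_perm; rewrite ?undup_uniq //.
    rewrite cat_uniq us0 filter_uniq ?undup_uniq // andbT.
    by apply/hasPn => x; rewrite mem_filter => /andP[].
  by move=> x; rewrite mem_cat mem_filter; case xs: (x \in s0); rewrite //= sub0.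
have fE : \sum_(i <- s) f i - \sum_(i <- s0) f i =
    \sum_(i <- [seq x <- s | x \notin s0]) f i.
  by rewrite (perm_big _ pe) big_cat /= [X in X - _]addrC addrK.
have gE : \sum_(i <- s) `|g i| - \sum_(i <- s0) `|g i| =
    \sum_(i <- [seq x <- s | x \notin s0]) `|g i|.
  by rewrite (perm_big _ pe) big_cat /= [X in X - _]addrC addrK.
have -> : isum f - \sum_(i <- s0) f i = (\sum_(i <- s) f i - \sum_(i <- s0) f i) +
  (isum f - \sum_(i <- s) f i) by ring.
apply: le_trans (ler_normD _ _) _; apply: lerD; last exact: ltW.
apply: le_trans h0; rewrite fE gE; apply: le_trans (ler_norm_sum _ _ _) _.
by apply: ler_sum.
Qed.

Lemma tends_norm_le (u : nat -> C) (l M : C) : 0 <= M -> (forall n, `|u n| <= M) ->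
  tends u l -> `|l| <= M.
Proof.
move=> M0 uM /tendsP ul; apply: norm_le_eps => // e e0.
have [N /(_ N (leqnn N)) h] := ul e e0.
rewrite -[l](subrK (u N)) addrC.
by apply: le_trans (ler_normD _ _) _; apply: lerD => //; exact: ltW.
Qed.

Lemma tannery (I : eqType) (f : nat -> I -> C) (F g : I -> C) :
  absum g -> (forall n i, `|f n i| <= `|g i|) -> (forall i, tends (f^~ i) (F i)) ->
  absum F /\ tends (fun n => isum (f n)) (isum F).
Proof.
move=> ag fg fF.
have Fg i : `|F i| <= `|g i| by apply: tends_norm_le (fF i) => // n; exact: fg.
split; first exact: absum_le ag.
apply/tendsP => e e0.
have e4 : 0 < e / 2 / 2 / 2 by rewrite !ltr_half.
have agn : absum (fun i => `|g i|) by apply: absum_le ag => i; rewrite normr_id.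
have [s0' hs0] := absum_has_sum agn e4.
set s0 := undup s0'.
have us0 : uniq s0 := undup_uniq _.
have ss0 : {subset s0' <= s0} by move=> x; rewrite mem_undup.
have tail s : uniq s -> {subset s0 <= s} ->
     \sum_(i <- s) `|g i| - \sum_(i <- s0) `|g i| <= e / 2 / 2.
  move=> us ss; have h1 := hs0 s us (fun x h => ss _ (ss0 _ h)).
  have h2 := hs0 s0 us0 ss0.
  rewrite -[X in X <= _]ger0_norm; last by rewrite subr_ge0; exact: uniq_sum_le.
  have -> : \sum_(i <- s) `|g i| - \sum_(i <- s0) `|g i| =
    (isum (fun i => `|g i|) - \sum_(i <- s0) `|g i|) -
    (isum (fun i => `|g i|) - \sum_(i <- s) `|g i|) by ring.
  apply: le_trans (ler_normB _ _) _; rewrite [e / 2 / 2]splitr.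
  by apply: lerD; exact: ltW.
have tF := isum_tail Fg ag us0 tail.
have tf n := isum_tail (fg n) ag us0 tail.
have /tendsP /(_ _ (ltr_half e0)) [N hN] := tends_sum s0 fF.
exists N => n /hN hn.
have -> : isum F - isum (f n) = (isum F - \sum_(i <- s0) F i) -
  (isum (f n) - \sum_(i <- s0) f n i) +
  (\sum_(i <- s0) F i - \sum_(i <- s0) f n i) by ring.
apply: le_lt_trans (ler_normD _ _) _; rewrite [e]splitr; apply: ler_ltD => //.
apply: le_trans (ler_normB _ _) _; rewrite [e / 2]splitr; exact: lerD.
Qed.

Lemma absum_series (f : nat -> C) : absum f ->
  tends (fun n => \sum_(0 <= k < n) f k) (isum f).
Proof.
move=> af; apply/tendsP => e e0.
have [s0 hs0] := absum_has_sum af e0.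
exists (\max_(i <- s0) i).+1 => // n /= hn.
apply: hs0; first exact: iota_uniq.
move=> x xs; rewrite mem_index_iota /=; apply: leq_trans hn.
by rewrite ltnS; apply: (leq_bigmax_seq (F := id)).
Qed.

Definition pos_part (f : int -> C) k := if k is Posz _ then f k else 0.
Definition neg_part (f : int -> C) k := if k is Negz _ then f k else 0.

Lemma isum_int (f : int -> C) :
  absum (fun n => f (Posz n)) -> absum (fun n => f (Negz n)) ->
  absum f /\ isum f = isum (fun n => f (Posz n)) + isum (fun n => f (Negz n)).
Proof.
move=> ap an.
have pinj : injective Posz by move=> ? ? [].
have ninj : injective Negz by move=> ? ? [].
have p0 i : (forall j, i != Posz j) -> pos_part f i = 0.
  by case: i => // n /(_ n); rewrite eqxx.
have n0 i : (forall j, i != Negz j) -> neg_part f i = 0.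
  by case: i => // n /(_ n); rewrite eqxx.
have [ap' pE] := isum_reindex pinj p0 ap.
have [an' nE] := isum_reindex ninj n0 an.
have fE k : f k = pos_part f k + neg_part f k.
  by case: k => n; rewrite /= ?addr0 ?add0r.
split; first by rewrite (funext fE); exact: absumD.
by rewrite (eq_isum fE) isumD // pE nE.
Qed.

Lemma absum_Posz (f : int -> C) : absum f -> absum (fun n => f (Posz n)).
Proof.
move=> [M hM]; exists M => s us; have := hM [seq Posz n | n <- s].
by rewrite big_map; apply; rewrite map_inj_uniq // => ? ? [].
Qed.

Lemma absum_Negz (f : int -> C) : absum f -> absum (fun n => f (Negz n)).
Proof.
move=> [M hM]; exists M => s us; have := hM [seq Negz n | n <- s].
by rewrite big_map; apply; rewrite map_inj_uniq // => ? ? [].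
Qed.

Lemma absum_bilateral (f : int -> C) : absum f ->
  bilateral_cvg f /\ bilateral_sum f = isum f.
Proof.
move=> af; have [_ ->] := isum_int (absum_Posz af) (absum_Negz af).
by apply: bilateral_tends; apply: absum_series; [exact: absum_Posz|exact: absum_Negz].
Qed.

Lemma absum_geometric (r : C) : 0 <= r < 1 -> absum (fun n : nat => r ^+ n).
Proof.
move=> /andP[r0 r1]; exists (1 - r)^-1 => s us.
have d0 : 0 < 1 - r by rewrite subr_gt0.
pose N := (\max_(i <- s) i).+1.
apply: (@le_trans _ _ (\sum_(i <- index_iota 0 N) `|r ^+ i|)).
  apply: uniq_sum_le => //; first exact: iota_uniq.
  move=> x xs; rewrite mem_index_iota /= ltnS.
  by apply: (leq_bigmax_seq (F := id)).
under eq_bigr do rewrite ger0_norm ?exprn_ge0 //.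
rewrite big_mkord -[X in _ <= X]mul1r ler_pdivlMr // mulrC.
rewrite -[X in X * _ <= _]opprB mulNr -subrX1 opprB.
by rewrite lerBlDl lerDr exprn_ge0.
Qed.

Lemma absum_int_geometric (r : C) : 0 <= r < 1 -> absum (fun k : int => r ^+ `|k|%N).
Proof.
move=> hr; have := absum_geometric hr => ag.
have an : absum (fun n => r ^+ `|Negz n|%N).
  have -> : (fun n => r ^+ `|Negz n|%N) = (fun n => r * r ^+ n).
    by apply: funext => n; rewrite -exprS.
  exact: absumZ.
by have [] := isum_int (f := fun k : int => r ^+ `|k|%N) ag an.
Qed.

(** In the abstract field smallness comes from summability: [|z| ^+ n] is the difference of two
    consecutive partial sums of the geometric series, both close to its sum. *)
Lemma cvg_expr0 (z : C) : `|z| < 1 -> tends (fun n => z ^+ n) 0.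
Proof.
move=> z1; apply/tendsP => e e0.
have hr : 0 <= `|z| < 1 by rewrite normr_ge0.
have [s0 hs0] := absum_has_sum (absum_geometric hr) (ltr_half e0).
exists (\max_(i <- s0) i).+1 => // n /= hn.
have h1 := hs0 (index_iota 0 n) (iota_uniq _ _).
have h2 := hs0 (index_iota 0 n.+1) (iota_uniq _ _).
have sub m : (n <= m)%N -> {subset s0 <= index_iota 0 m}.
  move=> nm x xs; rewrite mem_index_iota /=; apply: leq_trans nm.
  by apply: leq_trans hn; rewrite ltnS; apply: (leq_bigmax_seq (F := id)).
have {}h1 := h1 (sub _ (leqnn _)); have {}h2 := h2 (sub _ (leqnSn _)).
rewrite big_nat_recr //= in h2.
rewrite sub0r normrN normrX -[X in X < _]ger0_norm ?exprn_ge0 //.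
set S := isum _ in h1 h2; set T := \sum_(_ <= _ < _) _ in h1 h2.
have -> : `|z| ^+ n = (S - T) - (S - (T + `|z| ^+ n)) by ring.
by apply: le_lt_trans (ler_normB _ _) _; rewrite [e]splitr ltrD.
Qed.

End UnorderedSums3.

(** * Infinite q-products and theta functions *)

Section QPoch.
Variable C : sumCompleteFieldType.

(** Plays the part of the exponential bound for products: as soon as the x_i sum to at most 1/2, the
    product of the 1 + x_i is at most 2. *)
Lemma prod_1D_le (x : nat -> C) (N : nat) : (forall i, 0 <= x i) ->
  (\prod_(0 <= i < N) (1 + x i)) * (1 - \sum_(0 <= i < N) x i) <= 1.
Proof.
move=> x0; elim: N => [|N ih]; first by rewrite !big_geq // subr0 mulr1.
rewrite !big_nat_recr //=; set P := \prod_(_ <= _ < _) _ in ih *.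
set S := \sum_(_ <= _ < _) _ in ih *.
have -> : P * (1 + x N) * (1 - (S + x N)) =
  P * (1 - S) - P * (x N * S + x N * x N) by ring.
apply: le_trans ih; rewrite lerBlDr lerDl.
have S0 : 0 <= S by apply: sumr_ge0.
by rewrite mulr_ge0 ?addr_ge0 ?mulr_ge0 // prodr_ge0 // => i _; rewrite addr_ge0.
Qed.

Lemma prod_1D_bounded (p r : C) : 0 <= p < 1 -> 0 <= r ->
  exists M : C, forall N, \prod_(0 <= i < N) (1 + r * p ^+ i) <= M.
Proof.
move=> hp r0; have p0 : 0 <= p by case/andP: hp.
pose x i := r * p ^+ i; have x0 i : 0 <= x i by rewrite mulr_ge0 ?exprn_ge0.
have a : absum x by exact/absumZ/absum_geometric.
have h4 : 0 < 2^-1 / 2 :> C by rewrite divr_gt0.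
have [N0 hN0] := (tendsP _ _).1 (absum_series a) _ h4.
have hx m : \sum_(0 <= i < m) x (i + N0)%N <= 2^-1.
  have h1 := hN0 N0 (leqnn _); have h2 := hN0 (m + N0)%N (leq_addl _ _).
  rewrite -[X in X <= _]ger0_norm ?sumr_ge0 //.
  have -> : \sum_(0 <= i < m) x (i + N0)%N =
     (isum x - \sum_(0 <= k < N0) x k) - (isum x - \sum_(0 <= k < m + N0) x k).
    rewrite (big_cat_nat (n := N0) (p := m + N0)) ?leq_addl //=.
    have -> : \sum_(N0 <= i < m + N0) x i = \sum_(0 <= i < m) x (i + N0)%N.
      by rewrite -{1}[N0]add0n big_addn addnK.
    ring.
  apply: le_trans (ler_normB _ _) _.
  by rewrite [2^-1]splitr; apply: lerD; exact: ltW.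
exists ((\prod_(0 <= i < N0) (1 + x i)) * 2) => N.
have P0 m : 0 <= \prod_(0 <= i < m) (1 + x i).
  by rewrite prodr_ge0 // => i _; rewrite addr_ge0.
apply: (@le_trans _ _ (\prod_(0 <= i < N + N0) (1 + x i))).
  rewrite [X in _ <= X](big_cat_nat (n := N)) ?leq_addr //= ler_peMr //.
  apply: (big_ind (fun y => 1 <= y)) => // [y z|i _]; first exact: mulr_ege1.
  by rewrite lerDl x0.
rewrite (big_cat_nat (n := N0)) ?leq_addl //= ler_wpM2l //.
have -> : \prod_(N0 <= i < N + N0) (1 + x i) = \prod_(0 <= i < N) (1 + x (i + N0)%N).
  by rewrite -{1}[N0]add0n big_addn addnK.
have := prod_1D_le N (x := fun i => x (i + N0)%N) (fun i => x0 _).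
set P := \prod_(_ <= _ < _) _ => h.
have {}h : P / 2 <= 1.
  apply: le_trans h; apply: ler_wpM2l.
    by rewrite prodr_ge0 // => i _; rewrite addr_ge0.
  rewrite lerBrDl -lerBrDr; apply: le_trans (hx N) _.
  by rewrite [X in X - _](splitr 1) mul1r addrK.
by rewrite -[X in _ <= X]mul1r -ler_pdivrMr.
Qed.

Lemma tends_bounded (u : nat -> C) (l : C) : tends u l ->
  exists N : nat, forall n, `|u (n + N)%N| <= `|l| + 1.
Proof.
move=> /tendsP /(_ 1 ltr01) [N hN]; exists N => n.
have := hN (n + N)%N (leq_addl _ _) => /ltW h.
rewrite -[u _](subrK l) addrC; apply: le_trans (ler_normD _ _) _.
by rewrite lerD2l distrC.
Qed.

Lemma tends_shift (u : nat -> C) (l : C) N :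
  tends (fun n => u (n + N)%N) l <-> tends u l.
Proof.
split=> /tendsP h; apply/tendsP => e /h [M hM].
  exists (M + N)%N => n hn; have nN : (N <= n)%N := leq_trans (leq_addl _ _) hn.
  by have := hM (n - N)%N; rewrite subnK // leq_subRL // addnC; apply.
by exists M => n hn; apply: hM; exact: leq_trans (leq_addr _ _).
Qed.

Variable q : C.
Hypothesis q1 : `|q| < 1.

Lemma qpoch_partial_norm (x r : C) N : `|x| <= r ->
  `|qpoch_partial x q N| <= \prod_(0 <= i < N) (1 + r * `|q| ^+ i).
Proof.
move=> xr; rewrite /qpoch_partial normr_prod; apply: ler_prod => i _.
rewrite normr_ge0 /=; apply: le_trans (ler_normB _ _) _.
by rewrite normr1 lerD2l normrM normrX ler_wpM2r // exprn_ge0.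
Qed.

Lemma qpoch_partial_bounded (r : C) : 0 <= r ->
  exists2 M : C, 0 < M & forall x N, `|x| <= r -> `|qpoch_partial x q N| <= M.
Proof.
move=> r0; have q01 : 0 <= `|q| < 1 by rewrite normr_ge0.
have [M hM] := prod_1D_bounded q01 r0.
exists M => [|x N xr]; last exact: le_trans (qpoch_partial_norm N xr) (hM N).
by apply: lt_le_trans (hM 0%N); rewrite big_geq.
Qed.

Lemma qpoch_partialS (x : C) N :
  qpoch_partial x q N.+1 = qpoch_partial x q N * (1 - x * q ^+ N).
Proof. by rewrite /qpoch_partial big_nat_recr. Qed.

(** Turns the product into a series dominated by a geometric one. Convergence of the infinite
    product and its continuity in x then follow from the theory of sums. *)
Lemma qpoch_partial_telescope (x : C) N : qpoch_partial x q N =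
  1 - \sum_(0 <= k < N) x * q ^+ k * qpoch_partial x q k.
Proof.
elim: N => [|N ih]; first by rewrite /qpoch_partial !big_geq // subr0.
rewrite qpoch_partialS big_nat_recr //= opprD addrA -ih; ring.
Qed.

Lemma absum_qnorm (c : C) : absum (fun k => c * `|q| ^+ k).
Proof. by apply/absumZ/absum_geometric; rewrite normr_ge0. Qed.

Lemma qpoch_term_dom (r M : C) (x : C) k : 0 <= r ->
  (forall x N, `|x| <= r -> `|qpoch_partial x q N| <= M) -> `|x| <= r ->
  `|x * q ^+ k * qpoch_partial x q k| <= `|r * M * `|q| ^+ k|.
Proof.
move=> r0 hM xr; have M0 : 0 <= M by apply: le_trans (hM x 0%N xr).
rewrite [X in _ <= X]ger0_norm; last by rewrite !mulr_ge0 // exprn_ge0.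
rewrite !normrM normrX mulrAC; apply: ler_wpM2r; first exact: exprn_ge0.
by apply: ler_pM => //; exact: hM.
Qed.

Lemma qpoch_inf_cvg (x : C) : tends (qpoch_partial x q) (qpoch_inf x q).
Proof.
have [M M0 hM] := qpoch_partial_bounded (normr_ge0 x).
have a : absum (fun k => x * q ^+ k * qpoch_partial x q k).
  apply: absum_le (absum_qnorm (`|x| * M)) => k.
  by apply: qpoch_term_dom (lexx _).
suff h : tends (qpoch_partial x q)
    (1 - isum (fun k => x * q ^+ k * qpoch_partial x q k)).
  by rewrite (qpoch_inf_tends h).
have := tendsD (tends_cst 1) (tendsN (absum_series a)).
by congr (tends _ _); apply: funext => N; rewrite qpoch_partial_telescope.
Qed.

Lemma qpoch_inf_isum (x : C) : absum (fun k => x * q ^+ k * qpoch_partial x q k) ->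
  qpoch_inf x q = 1 - isum (fun k => x * q ^+ k * qpoch_partial x q k).
Proof.
move=> a; apply: tends_unique (qpoch_inf_cvg x) _.
have := tendsD (tends_cst 1) (tendsN (absum_series a)).
by congr (tends _ _); apply: funext => N; rewrite qpoch_partial_telescope.
Qed.

Lemma tends_qpoch_partial (u : nat -> C) (x : C) N : tends u x ->
  tends (fun n => qpoch_partial (u n) q N) (qpoch_partial x q N).
Proof.
move=> ux; apply: tends_prod => i; apply: tendsD; first exact: tends_cst.
by apply/tendsN/tendsM => //; exact: tends_cst.
Qed.

Lemma tends_qpoch_inf (u : nat -> C) (x : C) : tends u x ->
  tends (fun n => qpoch_inf (u n) q) (qpoch_inf x q).
Proof.
move=> ux; have [N0 hN0] := tends_bounded ux.
apply/(tends_shift _ _ N0).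
have {}ux : tends (fun n => u (n + N0)%N) x by apply/tends_shift.
have r0 : 0 <= `|x| + 1 by rewrite addr_ge0.
have xr : `|x| <= `|x| + 1 by rewrite lerDl.
have [M M0 hM] := qpoch_partial_bounded r0.
have ag := absum_qnorm ((`|x| + 1) * M).
have dom y : `|y| <= `|x| + 1 -> absum (fun k => y * q ^+ k * qpoch_partial y q k).
  by move=> hy; apply: absum_le ag => k; exact: qpoch_term_dom.
rewrite (qpoch_inf_isum (dom _ xr)).
under eq_fun do rewrite (qpoch_inf_isum (dom _ (hN0 _))).
apply: tendsD; first exact: tends_cst.
apply: tendsN.
have [] // := tannery (f := fun n k => u (n + N0)%N * q ^+ k * qpoch_partial (u (n + N0)%N) q k)
  (F := fun k => x * q ^+ k * qpoch_partial x q k) ag.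
  by move=> n i; exact: qpoch_term_dom.
move=> i; apply: tendsM; last exact: tends_qpoch_partial.
by apply: tendsM => //; exact: tends_cst.
Qed.

Lemma qpoch_inf_norm_le (r M : C) : 0 <= M ->
  (forall x N, `|x| <= r -> `|qpoch_partial x q N| <= M) ->
  forall x, `|x| <= r -> `|qpoch_inf x q| <= M.
Proof.
by move=> M0 hM x xr; apply: tends_norm_le (qpoch_inf_cvg x) => // N; exact: hM.
Qed.

Lemma qpoch_inf_shift (x : C) n :
  qpoch_inf x q = qpoch_partial x q n * qpoch_inf (x * q ^+ n) q.
Proof.
apply: tends_unique (qpoch_inf_cvg x) _; apply/(tends_shift _ _ n).
have := tendsM (tends_cst (qpoch_partial x q n)) (qpoch_inf_cvg (x * q ^+ n)).
by congr (tends _ _); apply: funext => N; rewrite addnC qpoch_partialD.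
Qed.

Lemma qpoch_inf_rec (x : C) : qpoch_inf x q = (1 - x) * qpoch_inf (x * q) q.
Proof.
rewrite (qpoch_inf_shift x 1) expr1; congr (_ * _).
by rewrite /qpoch_partial big_nat1 expr0 mulr1.
Qed.

Lemma qpoch_inf0 : qpoch_inf 0 q = 1.
Proof.
apply: qpoch_inf_tends.
have -> : qpoch_partial 0 q = fun=> 1; last exact: tends_cst.
by apply: funext => N; rewrite /qpoch_partial big1 // => i _; rewrite mul0r subr0.
Qed.

(** By continuity at 0, (x q^N; q)_oo is within 1 of (0; q)_oo = 1 for some N, hence nonzero; only
    finitely many factors remain. *)
Lemma qpoch_inf_neq0 (x : C) : (forall n, 1 - x * q ^+ n != 0) -> qpoch_inf x q != 0.
Proof.
move=> hx.
have t0 : tends (fun n => x * q ^+ n) 0.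
  by rewrite -[X in tends _ X](mulr0 x); apply: tendsM; [exact: tends_cst|exact: cvg_expr0].
have := tends_qpoch_inf t0; rewrite qpoch_inf0 => /tendsP /(_ 1 ltr01) [N /(_ N (leqnn N))].
apply: contraTneq => x0; move: x0; rewrite (qpoch_inf_shift x N) => /eqP.
rewrite mulf_eq0 => /orP[|/eqP ->]; last by rewrite subr0 normr1 ltxx.
rewrite /qpoch_partial prodf_seq_eq0 => /hasP[i _ /= /eqP h].
by have := hx i; rewrite h eqxx.
Qed.

Lemma qpoch_inf_eq0 (x : C) n : 1 - x * q ^+ n = 0 -> qpoch_inf x q = 0.
Proof.
by move=> h; rewrite (qpoch_inf_shift x n.+1) qpoch_partialS h mulr0 mul0r.
Qed.

End QPoch.

Section QPochMore.
Variable C : sumCompleteFieldType.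
Variable q : C.
Hypothesis q1 : `|q| < 1.

Lemma norm_sq_lt1 : `|q ^+ 2| < 1.
Proof. by rewrite normrX exprn_ilt1. Qed.

Lemma qpoch_inf_sqr (x : C) :
  qpoch_inf x q * qpoch_inf (- x) q = qpoch_inf (x ^+ 2) (q ^+ 2).
Proof.
have := tendsM (qpoch_inf_cvg q1 x) (qpoch_inf_cvg q1 (- x)).
move=> h; apply: tends_unique h _.
have := qpoch_inf_cvg norm_sq_lt1 (x ^+ 2).
congr (tends _ _); apply: funext => N; rewrite /qpoch_partial -big_split /=.
by apply: eq_bigr => i _; rewrite -exprM mulnC exprM; ring.
Qed.

Lemma qthetaE (x : C) : qtheta x q = qpoch_inf x q * qpoch_inf (q / x) q.
Proof. by rewrite /qtheta /qpochs_inf !big_cons big_nil mulr1. Qed.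

Hypothesis q0 : q != 0.

Lemma qtheta_shift (x : C) : x != 0 -> qtheta (q * x) q = - x^-1 * qtheta x q.
Proof.
move=> x0; rewrite !qthetaE (qpoch_inf_rec q1 x).
have -> : q / (q * x) = x^-1 by field; rewrite q0 x0.
rewrite (qpoch_inf_rec q1 x^-1) [x^-1 * q]mulrC [x * q]mulrC.
set u := qpoch_inf _ _; set v := qpoch_inf _ _.
by field.
Qed.

Lemma qtheta_inv (x : C) : x != 0 -> qtheta x^-1 q = - x^-1 * qtheta x q.
Proof.
move=> x0; rewrite -qtheta_shift // !qthetaE invrK mulrC.
by have -> : q / (q * x) = x^-1 by field; rewrite q0 x0.
Qed.

End QPochMore.

(** * The q-analogue of Whipple's sum *)

Section Bounded.
Variable C : sumCompleteFieldType.

Definition bdd (T : Type) (u : T -> C) := exists M : C, forall t, `|u t| <= M.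

Lemma bdd_ge0 (T : Type) (u : T -> C) : bdd u ->
  exists2 M : C, 0 <= M & forall t, `|u t| <= M.
Proof.
move=> [M hM]; case: (pselect (exists t : T, True)) => [[t _]|nt].
  by exists M => //; exact: le_trans (hM t).
by exists 0 => // t; case: nt; exists t.
Qed.

Lemma bddM (T : Type) (u v : T -> C) : bdd u -> bdd v -> bdd (fun t => u t * v t).
Proof.
move=> [M hM] [N hN]; exists (M * N) => t; rewrite normrM.
exact: ler_pM.
Qed.

Lemma bddD (T : Type) (u v : T -> C) : bdd u -> bdd v -> bdd (fun t => u t + v t).
Proof.
move=> [M hM] [N hN]; exists (M + N) => t.
by apply: le_trans (ler_normD _ _) _; exact: lerD.
Qed.

Lemma bddN (T : Type) (u : T -> C) : bdd u -> bdd (fun t => - u t).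
Proof. by move=> [M hM]; exists M => t; rewrite normrN. Qed.

Lemma bdd_cst (T : Type) (c : C) : bdd (fun _ : T => c).
Proof. by exists `|c|. Qed.

Lemma bdd_exp (T : Type) (c : C) (N : T -> nat) : `|c| <= 1 -> bdd (fun t => c ^+ N t).
Proof. by move=> c1; exists 1 => t; rewrite normrX exprn_ile1. Qed.

Variable q : C.
Hypothesis q1 : `|q| < 1.

Lemma bdd_qpoch_partial (T : Type) (x : T -> C) (N : T -> nat) : bdd x ->
  bdd (fun t => qpoch_partial (x t) q (N t)).
Proof.
move=> /bdd_ge0 [r r0 hr].
have [M _ hM] := qpoch_partial_bounded q1 r0; exists M => t; exact: hM.
Qed.

Lemma bdd_qpoch_inf (T : Type) (x : T -> C) : bdd x ->
  bdd (fun t => qpoch_inf (x t) q).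
Proof.
move=> /bdd_ge0 [r r0 hr].
have [M M0 hM] := qpoch_partial_bounded q1 r0; exists M => t.
by apply: (qpoch_inf_norm_le q1 (r := r)) => //; exact: ltW.
Qed.

(** The reciprocal is a quotient of infinite products, 1 / (x; q)_N = (x q^N; q)_oo / (x; q)_oo,
    with bounded numerator and constant denominator. *)
Lemma bdd_qpoch_partialV (T : Type) (x : C) (N : T -> nat) : qpoch_inf x q != 0 ->
  bdd (fun t => (qpoch_partial x q (N t))^-1).
Proof.
move=> x0.
have -> : (fun t => (qpoch_partial x q (N t))^-1) =
    (fun t => (qpoch_inf x q)^-1 * qpoch_inf (x * q ^+ N t) q).
  apply: funext => t.
  have h := qpoch_inf_shift q1 x (N t); move: x0; rewrite h mulf_eq0 negb_or => /andP[p0 i0].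
  by rewrite invfM -mulrA mulVf // mulr1.
apply: bddM; first exact: bdd_cst.
apply: bdd_qpoch_inf; apply: bddM; first exact: bdd_cst.
by apply: bdd_exp; exact: ltW.
Qed.

Lemma qpoch_inf_neq0_small (x : C) : `|x| < 1 -> qpoch_inf x q != 0.
Proof.
move=> x1; apply: qpoch_inf_neq0 => // n; rewrite subr_eq0.
have : `|x * q ^+ n| < 1.
  apply: le_lt_trans x1; rewrite normrM normrX ler_piMr // exprn_ile1 //.
  exact: ltW.
by apply: contraTneq => <-; rewrite normr1 ltxx.
Qed.

Lemma absum_bdd_geometric (u : nat -> C) (c : C) : bdd u -> `|c| < 1 ->
  absum (fun k => u k * c ^+ k).
Proof.
move=> [M hM] c1.
apply: (absum_le (g := fun k => M * `|c| ^+ k)); last first.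
  by apply/absumZ/absum_geometric; rewrite normr_ge0.
move=> k; have M0 : 0 <= M by exact: le_trans (hM k).
rewrite normrM normrX [X in _ <= X]ger0_norm ?mulr_ge0 ?exprn_ge0 //.
by rewrite ler_wpM2r ?exprn_ge0.
Qed.

End Bounded.

Section WhippleAlgebra.
Variable F : fieldType.

(** The start k = 0 of the telescoping, after the common infinite products have been divided out. *)
Lemma whipple_certificate_base (a c d q : F) : a != 0 -> d != 0 ->
  (1 + c) * (1 + a * c) * (1 + a * c * q) * (1 - c * q / d) * (1 - c * d) -
  (1 + c) ^+ 2 * (1 - a * c * d) * (1 - a * c * q / d) * (1 + c * q) =
  - (1 - a * c ^+ 2 * q) * (1 - a) * (1 + c) * (1 + d) * (1 + q / d) * c.
Proof. by move=> a0 d0; field. Qed.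

(** The rational identity behind [whipple_step]. Here x is q^k; P, Q belong to a and q/a, U, V to -
    c q and c q, D, D' to - d and - q/d; E is 1 / (q^2; q^2)_k and T the tail at q^(k+1). As atoms
    they leave an identity within reach of [field]. *)
Lemma whipple_step_atoms (a c d q x P Q U V D D' E T ck : F) : a != 0 -> d != 0 ->
  1 - q ^+ 2 * x ^+ 2 != 0 ->
  (1 + c * (q * x) ^+ 2) * ((1 + c) * U * ((1 - c) * V)) *
    (E / (1 - q ^+ 2 * x ^+ 2)) * (P * (Q * (1 - q / a * x)) * D * D') *
    ((1 + a * c * (q * x)) * (1 + a * c * q * (q * x)) * (1 - c * q * (q * x) / d) *
      (1 - c * d * (q * x)) * T) * (c * ck) -
  (1 + c) ^+ 2 * (1 - a * c * d) * (1 - a * c * q / d) *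
   ((1 + c * q * (q * x) ^+ 2) * (U * (1 + c * q * x) * (V * (1 - c * q * x))) *
    (E / (1 - q ^+ 2 * x ^+ 2)) *
    (- a^-1 * (P * (1 - a * q * x)) * Q * D * D') * T * (c * ck * (q * x))) =
  - ((1 - a * c ^+ 2 * q * (q * x)) * (P * (1 - a * q * x)) * (Q * (1 - q / a * x)) *
    ((1 + c) * (U * (1 + c * q * x)) * (V * (1 - c * q * x))) *
    (E / (1 - q ^+ 2 * x ^+ 2)) * (D * (1 + d * q * x)) * (D' * (1 + q / d * (q * x))) *
    T * (c ^+ 2 * ck)) +
  (1 - a * c ^+ 2 * q * x) * P * Q * ((1 + c) * U * V) * E * D * D' *
    ((1 + c * q * x / a) * (1 + a * c * q ^+ 2 * x) * (1 - c * q ^+ 2 * x / d) *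
      (1 - c * d * q * x) * T) * (c * ck).
Proof. by move=> a0 d0 h; field; rewrite a0 d0 exprMn. Qed.

Lemma qpoch_partialSl (K : numFieldType) (x q : K) n :
  qpoch_partial x q n.+1 = (1 - x) * qpoch_partial (x * q) q n.
Proof.
rewrite /qpoch_partial big_nat_recl // expr0 mulr1; congr (_ * _).
by apply: eq_bigr => i _; rewrite exprS mulrA.
Qed.
End WhippleAlgebra.

Section Whipple.
Variable C : sumCompleteFieldType.
Variable q : C.
Hypotheses (q0 : q != 0) (q1 : `|q| < 1).
Local Notation pp := (fun x n => qpoch_partial x q n).
Local Notation p2 := (qpoch_partial (q ^+ 2) (q ^+ 2)).

(** At x = q^k these are the quotients (y; q)_oo / (y; q)_k = (y q^k; q)_oo for the four denominator
    parameters y that depend on c, written without division. The other two denominators combine to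
    (q; q)_k (- q; q)_k = (q^2; q^2)_k. *)
Definition whipple_tail (c a d x : C) :=
  qpoch_inf (- (c * q * x / a)) q * qpoch_inf (- (a * c * x)) q *
  qpoch_inf (c * q * x / d) q * qpoch_inf (c * d * x) q.

Definition whipple_coef (c a d : C) (k : nat) : C :=
  (1 + c * (q ^+ k) ^+ 2) * (pp (- c) k * pp c k) * (p2 k)^-1 *
  (pp a k * pp (q / a) k * pp (- d) k * pp (- (q / d)) k) *
  whipple_tail c a d (q ^+ k).

Definition whipple_sum (c a d : C) := isum (fun k => whipple_coef c a d k * c ^+ k).

(* Telescoping certificate for the relation (c, a) -> (c q, a q) between the summands. *)
Definition whipple_cert (c a d : C) (k : nat) : C :=
  (1 - a * c ^+ 2 * q * q ^+ k) * pp a k.+1 * pp (q / a) k *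
  ((1 + c) * pp (- (c * q)) k * pp (c * q) k) * (p2 k)^-1 *
  pp (- d) k.+1 * pp (- (q / d)) k.+1 *
  whipple_tail (c * q) (a * q) d (q ^+ k) * c ^+ k.+1.

Lemma whipple_tail_rec (c a d x : C) : whipple_tail c a d x =
  (1 + c * q * x / a) * (1 + a * c * x) * (1 - c * q * x / d) * (1 - c * d * x) *
  whipple_tail c a d (q * x).
Proof.
rewrite /whipple_tail.
rewrite [qpoch_inf (- (c * q * x / a)) q]qpoch_inf_rec //.
rewrite [qpoch_inf (- (a * c * x)) q]qpoch_inf_rec //.
rewrite [qpoch_inf (c * q * x / d) q]qpoch_inf_rec //.
rewrite [qpoch_inf (c * d * x) q]qpoch_inf_rec // !opprK.
have -> : - (c * q * x / a) * q = - (c * q * (q * x) / a) by ring.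
have -> : - (a * c * x) * q = - (a * c * (q * x)) by ring.
have -> : c * q * x / d * q = c * q * (q * x) / d by ring.
have -> : c * d * x * q = c * d * (q * x) by ring.
ring.
Qed.

Lemma whipple_tail_up (c a d x : C) : a != 0 -> whipple_tail c a d x =
  (1 + a * c * x) * (1 + a * c * q * x) * (1 - c * q * x / d) * (1 - c * d * x) *
  whipple_tail (c * q) (a * q) d x.
Proof.
move=> a0; rewrite /whipple_tail.
rewrite [qpoch_inf (- (a * c * x)) q]qpoch_inf_rec //.
rewrite [qpoch_inf (- (a * c * x) * q) q]qpoch_inf_rec //.
rewrite [qpoch_inf (c * q * x / d) q]qpoch_inf_rec //.
rewrite [qpoch_inf (c * d * x) q]qpoch_inf_rec // !mulNr !opprK.
have -> : c * q * q * x / (a * q) = c * q * x / a by field; rewrite q0 a0.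
have -> : a * q * (c * q) * x = a * c * x * q * q by ring.
have -> : c * q * q * x / d = c * q * x / d * q by ring.
have -> : c * q * d * x = c * d * x * q by ring.
ring.
Qed.

Lemma p2_neq0 k : 1 - q ^+ 2 * (q ^+ k) ^+ 2 != 0.
Proof.
rewrite subr_eq0; have : `|q ^+ 2 * (q ^+ k) ^+ 2| < 1.
  by rewrite -exprM -exprD normrX exprn_ilt1 // addn_eq0.
by apply: contraTneq => <-; rewrite normr1 ltxx.
Qed.

Lemma p2S k : (p2 k.+1)^-1 = (p2 k)^-1 / (1 - q ^+ 2 * (q ^+ k) ^+ 2).
Proof. by rewrite qpoch_partialS invfM -!exprM mulnC. Qed.

Section Recurrence.
Variables (c a d : C).
Hypotheses (a0 : a != 0) (d0 : d != 0).
Let r := (1 + c) ^+ 2 * (1 - a * c * d) * (1 - a * c * q / d).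
Let w k := whipple_coef c a d k * c ^+ k.
Let v k := whipple_coef (c * q) (a * q) d k * (c * q) ^+ k.
Let g := whipple_cert c a d.


Lemma whipple_v_coef k : whipple_coef (c * q) (a * q) d k.+1 =
  (1 + c * q * (q * q ^+ k) ^+ 2) *
  (pp (- (c * q)) k * (1 + c * q * q ^+ k) * (pp (c * q) k * (1 - c * q * q ^+ k))) *
  ((p2 k)^-1 / (1 - q ^+ 2 * (q ^+ k) ^+ 2)) *
  (- a^-1 * (pp a k.+1 * (1 - a * q * q ^+ k)) * pp (q / a) k *
   pp (- d) k.+1 * pp (- (q / d)) k.+1) * whipple_tail (c * q) (a * q) d (q * q ^+ k).
Proof.
rewrite /whipple_coef p2S [q ^+ k.+1]exprS.
rewrite [pp (- (c * q)) k.+1]qpoch_partialS [pp (c * q) k.+1]qpoch_partialS.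
have -> : q / (a * q) = a^-1 by field; rewrite q0 a0.
rewrite [pp (a * q) k.+1]qpoch_partialS [pp a^-1 k.+1]qpoch_partialSl [a^-1 * q]mulrC.
rewrite [pp a k.+1]qpoch_partialSl.
set A := pp (a * q) k; set B := pp (q / a) k; set D := pp (- d) _; set D' := pp _ _.
set T := whipple_tail _ _ _ _; set x := q ^+ k; set U := pp _ _; set V := pp _ _.
set W := (1 - q ^+ 2 * x ^+ 2)^-1; set E := (p2 k)^-1.
by field; rewrite a0.
Qed.

Lemma whipple_step k : w k.+1 - r * v k.+1 = - g k.+1 + g k.
Proof.
have h := whipple_step_atoms c (pp a k.+1) (pp (q / a) k) (pp (- (c * q)) k) (pp (c * q) k)
  (pp (- d) k.+1) (pp (- (q / d)) k.+1) (p2 k)^-1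
  (whipple_tail (c * q) (a * q) d (q * q ^+ k)) (c ^+ k) a0 d0 (p2_neq0 k).
have wE : w k.+1 = (1 + c * (q * q ^+ k) ^+ 2) * ((1 + c) * pp (- (c * q)) k * ((1 - c) * pp (c * q) k)) *
    ((p2 k)^-1 / (1 - q ^+ 2 * (q ^+ k) ^+ 2)) * (pp a k.+1 * (pp (q / a) k * (1 - q / a * q ^+ k)) *
      pp (- d) k.+1 * pp (- (q / d)) k.+1) *
    ((1 + a * c * (q * q ^+ k)) * (1 + a * c * q * (q * q ^+ k)) * (1 - c * q * (q * q ^+ k) / d) *
      (1 - c * d * (q * q ^+ k)) * whipple_tail (c * q) (a * q) d (q * q ^+ k)) * (c * c ^+ k).
  rewrite /w /whipple_coef p2S [q ^+ k.+1]exprS [c ^+ k.+1]exprS -whipple_tail_up //.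
  rewrite [pp (- c) k.+1]qpoch_partialSl [pp c k.+1]qpoch_partialSl mulNr opprK.
  by rewrite [pp (q / a) k.+1]qpoch_partialS.
have gSE : g k.+1 = ((1 - a * c ^+ 2 * q * (q * q ^+ k)) * (pp a k.+1 * (1 - a * q * q ^+ k)) * (pp (q / a) k * (1 - q / a * q ^+ k)) *
    ((1 + c) * (pp (- (c * q)) k * (1 + c * q * q ^+ k)) * (pp (c * q) k * (1 - c * q * q ^+ k))) *
    ((p2 k)^-1 / (1 - q ^+ 2 * (q ^+ k) ^+ 2)) * (pp (- d) k.+1 * (1 + d * q * q ^+ k)) *
    (pp (- (q / d)) k.+1 * (1 + q / d * (q * q ^+ k))) *
    whipple_tail (c * q) (a * q) d (q * q ^+ k) * (c ^+ 2 * c ^+ k)).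
  rewrite /g /whipple_cert p2S [pp a k.+2]qpoch_partialS.
  rewrite [pp (- d) k.+2]qpoch_partialS [pp (- (q / d)) k.+2]qpoch_partialS.
  rewrite [pp (- (c * q)) k.+1]qpoch_partialS [pp (c * q) k.+1]qpoch_partialS.
  rewrite [pp (q / a) k.+1]qpoch_partialS !mulNr !opprK [q ^+ k.+1]exprS [c ^+ k.+2]exprS [c ^+ k.+1]exprS.
  by rewrite expr2 -!mulrA.
have gE : g k = (1 - a * c ^+ 2 * q * q ^+ k) * pp a k.+1 * pp (q / a) k *
    ((1 + c) * pp (- (c * q)) k * pp (c * q) k) * (p2 k)^-1 * pp (- d) k.+1 * pp (- (q / d)) k.+1 *
    ((1 + c * q * q ^+ k / a) * (1 + a * c * q ^+ 2 * q ^+ k) * (1 - c * q ^+ 2 * q ^+ k / d) *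
      (1 - c * d * q * q ^+ k) * whipple_tail (c * q) (a * q) d (q * q ^+ k)) * (c * c ^+ k).
  rewrite /g /whipple_cert [whipple_tail _ _ _ (q ^+ k)]whipple_tail_rec [c ^+ k.+1]exprS.
  have -> : c * q * q * q ^+ k / (a * q) = c * q * q ^+ k / a by field; rewrite q0 a0.
  have -> : a * q * (c * q) * q ^+ k = a * c * q ^+ 2 * q ^+ k by ring.
  have -> : c * q * q * q ^+ k / d = c * q ^+ 2 * q ^+ k / d by ring.
  by have -> : c * q * d * q ^+ k = c * d * q * q ^+ k by ring.
rewrite gSE gE -h wE; congr (_ - _).
rewrite /r /v whipple_v_coef [(c * q) ^+ k.+1]exprMn [q ^+ k.+1]exprS [c ^+ k.+1]exprS.
ring.
Qed.

Lemma whipple_partial n : \sum_(0 <= k < n.+1) (w k - r * v k) = - g n.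
Proof.
elim: n => [|n ih]; last by rewrite big_nat_recr //= ih whipple_step; ring.
rewrite big_nat1 /w /v /g /whipple_coef /whipple_cert whipple_tail_up //.
have E (x : C) : pp x 1 = 1 - x by rewrite /qpoch_partial big_nat1 expr0 mulr1.
have E0 (x : C) : pp x 0 = 1 by rewrite /qpoch_partial big_geq.
have -> : p2 0%N = 1 by rewrite /qpoch_partial big_geq.
rewrite !E !E0 !expr0 !expr1 ?expr1n ?invr1 ?mulr1 ?mul1r ?opprK.
have h := whipple_certificate_base c q a0 d0.
set T := whipple_tail _ _ _ _.
transitivity (((1 + c) * (1 + a * c) * (1 + a * c * q) * (1 - c * q / d) * (1 - c * d) -
  (1 + c) ^+ 2 * (1 - a * c * d) * (1 - a * c * q / d) * (1 + c * q)) * T).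
  by rewrite /r; ring.
rewrite h; ring.
Qed.

Hypothesis c1 : `|c| < 1.

Lemma bdd_whipple_tail (T : Type) (c' x : T -> C) a' : bdd c' -> bdd x ->
  bdd (fun t => whipple_tail (c' t) a' d (x t)).
Proof.
move=> bc bx; rewrite /whipple_tail.
have bcx : bdd (fun t => c' t * x t) by exact: bddM.
have b (y : C) : bdd (fun t => y * (c' t * x t)) by apply: bddM => //; exact: bdd_cst.
have e1 t : - (c' t * q * x t / a') = - (q / a') * (c' t * x t) by ring.
have e2 t : - (a' * c' t * x t) = - a' * (c' t * x t) by ring.
have e3 t : c' t * q * x t / d = q / d * (c' t * x t) by ring.
have e4 t : c' t * d * x t = d * (c' t * x t) by ring.
under eq_fun do rewrite e1 e2 e3 e4.
by do 3?[apply: bddM]; apply: bdd_qpoch_inf.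
Qed.

Lemma bdd_p2V (T : Type) (k : T -> nat) : bdd (fun t => (p2 (k t))^-1).
Proof.
by apply: bdd_qpoch_partialV; [|apply: qpoch_inf_neq0_small]; exact: norm_sq_lt1.
Qed.

(** The argument c' may vary with the index: the limit along c q^(2n) needs a bound uniform in n and
    k. *)
Lemma bdd_whipple_coef (T : Type) (c' : T -> C) a' (k : T -> nat) : bdd c' ->
  bdd (fun t => whipple_coef (c' t) a' d (k t)).
Proof.
move=> bc; rewrite /whipple_coef.
have bq : bdd (fun t => q ^+ k t) by apply: bdd_exp; exact: ltW.
apply: bddM; last exact: bdd_whipple_tail.
apply: bddM; last by do 3?[apply: bddM]; apply: bdd_qpoch_partial => //; exact: bdd_cst.
apply: bddM; last exact: bdd_p2V.
apply: bddM; last by apply: bddM; apply: bdd_qpoch_partial => //; exact: bddN.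
by apply: bddD; [exact: bdd_cst|do 2?[apply: bddM]].
Qed.

Lemma absum_whipple c' a' : `|c'| < 1 -> absum (fun k => whipple_coef c' a' d k * c' ^+ k).
Proof.
move=> c'1; apply: absum_bdd_geometric => //.
by apply: (bdd_whipple_coef (c' := fun=> c')); exact: bdd_cst.
Qed.

Lemma tends_bdd0 (u z : nat -> C) : bdd u -> tends z 0 -> tends (fun n => u n * z n) 0.
Proof.
move=> /bdd_ge0 [M M0 hM] /tendsP hz; apply/tendsP => e e0.
have M1 : 0 < M + 1 by rewrite ltr_wpDl.
have [N hN] := hz _ (divr_gt0 e0 M1); exists N => n /hN.
rewrite !sub0r !normrN normrM ltr_pdivlMr // => h; apply: le_lt_trans h.
by rewrite mulrC ler_wpM2l // (le_trans (hM n)) // lerDl.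
Qed.

Lemma norm_cq : `|c * q| < 1.
Proof. rewrite normrM; exact: mulr_ilt1. Qed.

Lemma whipple_sum_rec : whipple_sum c a d = r * whipple_sum (c * q) (a * q) d.
Proof.
have aw : absum w by exact: absum_whipple.
have av : absum v by apply: absum_whipple; exact: norm_cq.
apply/subr0_eq; rewrite /whipple_sum -isumZ // -isumB //; last exact: absumZ.
have arv : absum (fun k => w k - r * v k).
  by apply: absumD => //; under eq_fun do rewrite -mulNr; exact: absumZ.
apply: tends_unique ((tends_shift _ _ 1).2 (absum_series arv)) _.
under eq_fun do rewrite addn1 whipple_partial.
rewrite -oppr0; apply: tendsN.
(* Isolates the factor c^k of the certificate. All the others are bounded, so the boundary term of
   the telescoping tends to 0. *)
have gE k : g k = (1 - a * c ^+ 2 * q * q ^+ k) * pp a k.+1 * pp (q / a) k *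
  ((1 + c) * pp (- (c * q)) k * pp (c * q) k) * (p2 k)^-1 *
  pp (- d) k.+1 * pp (- (q / d)) k.+1 *
  whipple_tail (c * q) (a * q) d (q ^+ k) * c * c ^+ k.
  by rewrite /g /whipple_cert [c ^+ k.+1]exprS mulrA.
rewrite (funext gE : g = _).
apply: tends_bdd0; last exact: cvg_expr0.
have bq : bdd (fun t => q ^+ t) by apply: bdd_exp; exact: ltW.
have bp (x : C) (N : nat -> nat) : bdd (fun t => pp x (N t)).
  by apply: bdd_qpoch_partial => //; exact: bdd_cst.
apply: bddM; last exact: bdd_cst.
apply: bddM; last by apply: (bdd_whipple_tail (c' := fun=> c * q)) => //; exact: bdd_cst.
apply: bddM; last exact: bp.
apply: bddM; last exact: bp.
apply: bddM; last exact: bdd_p2V.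
apply: bddM; last by apply: bddM => //; apply: bddM => //; exact: bdd_cst.
apply: bddM; last exact: bp.
apply: bddM; last exact: bp.
by apply: bddD; [exact: bdd_cst|apply: bddN; apply: bddM => //; exact: bdd_cst].
Qed.

End Recurrence.

Lemma whipple_sum_sym (c a d : C) : a != 0 -> whipple_sum c (q / a) d = whipple_sum c a d.
Proof.
move=> a0; apply: eq_isum => k; congr (_ * _); rewrite /whipple_coef /whipple_tail.
have -> : q / (q / a) = a by field; rewrite q0 a0.
have -> : c * q * q ^+ k / (q / a) = a * c * q ^+ k by field; rewrite q0 a0.
have -> : q / a * c * q ^+ k = c * q * q ^+ k / a by field; rewrite a0.
ring.
Qed.

Definition whipple_prod (c a d : C) : C := qpoch_inf (- c) q ^+ 2 *
  (qpoch_inf (a * c * d) (q ^+ 2) * qpoch_inf (a * c * q / d) (q ^+ 2) *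
   qpoch_inf (c * d * q / a) (q ^+ 2) * qpoch_inf (c * q ^+ 2 / (a * d)) (q ^+ 2)).

Definition whipple_ratio (c a d : C) : C :=
  (1 + c) ^+ 2 * (1 - a * c * d) * (1 - a * c * q / d) *
  ((1 + c * q) ^+ 2 * (1 - c * d * q / a) * (1 - c * q ^+ 2 / (a * d))).

(** The path is (c, a) -> (c q, a q) ~ (c q, 1/a) -> (c q^2, q/a) ~ (c q^2, a), where ~ is the
    symmetry a -> q/a. *)
Lemma whipple_sum_rec2 (c a d : C) : a != 0 -> d != 0 -> `|c| < 1 ->
  whipple_sum c a d = whipple_ratio c a d * whipple_sum (c * q ^+ 2) a d.
Proof.
move=> a0 d0 c1; rewrite whipple_sum_rec //.
rewrite -whipple_sum_sym ?mulf_neq0 //.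
have -> : q / (a * q) = a^-1 by field; rewrite q0 a0.
rewrite whipple_sum_rec ?invr_eq0 //; last exact: norm_cq.
have -> : a^-1 * q = q / a by rewrite mulrC.
have -> : c * q * q = c * q ^+ 2 by ring.
rewrite whipple_sum_sym // mulrA; congr (_ * _).
by rewrite /whipple_ratio; field; rewrite a0 d0.
Qed.

Lemma whipple_prod_rec (c a d : C) : a != 0 -> d != 0 ->
  whipple_prod c a d = whipple_ratio c a d * whipple_prod (c * q ^+ 2) a d.
Proof.
move=> a0 d0; have q2 := norm_sq_lt1 q1; rewrite /whipple_prod.
rewrite [qpoch_inf (- c) q]qpoch_inf_rec // [qpoch_inf (- c * q) q]qpoch_inf_rec //.
rewrite [qpoch_inf (a * c * d) (q ^+ 2)]qpoch_inf_rec //.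
rewrite [qpoch_inf (a * c * q / d) (q ^+ 2)]qpoch_inf_rec //.
rewrite [qpoch_inf (c * d * q / a) (q ^+ 2)]qpoch_inf_rec //.
rewrite [qpoch_inf (c * q ^+ 2 / (a * d)) (q ^+ 2)]qpoch_inf_rec //.
have -> : - c * q * q = - (c * q ^+ 2) by ring.
have -> : a * c * d * q ^+ 2 = a * (c * q ^+ 2) * d by ring.
have -> : a * c * q / d * q ^+ 2 = a * (c * q ^+ 2) * q / d by ring.
have -> : c * d * q / a * q ^+ 2 = c * q ^+ 2 * d * q / a by ring.
have -> : c * q ^+ 2 / (a * d) * q ^+ 2 = c * q ^+ 2 * q ^+ 2 / (a * d) by ring.
rewrite /whipple_ratio; ring.
Qed.

Lemma isum_nat1 (f : nat -> C) : (forall k, f k.+1 = 0) -> isum f = f 0%N.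
Proof.
move=> f0; apply: isumE => e e0; exists [:: 0%N] => s us /(_ 0%N) s0.
rewrite (bigD1_seq 0%N) ?s0 ?inE //= big1 ?addr0 ?subrr ?normr0 //.
by case=> // k _; rewrite f0.
Qed.

(* Gasper-Rahman (II.18), multiplied by the denominator products. Combined with the
   symmetry a -> q / a, the relation (c, a) -> (c q, a q) gives c -> c q^2, and the
   value of sum / product is 1 in the limit c = 0. *)
Lemma whipple_summation (c a d : C) : a != 0 -> d != 0 -> `|c| < 1 ->
  whipple_sum c a d = whipple_prod c a d.
Proof.
move=> a0 d0 c1.
pose cn n := c * (q ^+ 2) ^+ n.
have cn1 n : `|cn n| <= `|c|.
  by rewrite normrM ler_piMr // normrX exprn_ile1 // ltW // norm_sq_lt1.
have cn0 : tends cn 0.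
  rewrite -[X in tends _ X](mulr0 c); apply: tendsM; first exact: tends_cst.
  by apply: cvg_expr0; exact: norm_sq_lt1.
have tP : tends (fun n => whipple_prod (cn n) a d) 1.
  have -> : 1 = whipple_prod 0 a d :> C.
    by rewrite /whipple_prod !(mul0r, mulr0, oppr0) !qpoch_inf0 // ?norm_sq_lt1 //; ring.
  have q2 := norm_sq_lt1 q1.
  have tc (f : C -> C) y : (forall z, f z = y * z) -> tends (fun n => f (cn n)) (f 0).
    move=> hf; rewrite hf; under eq_fun do rewrite hf.
    by apply: tendsM => //; exact: tends_cst.
  rewrite /whipple_prod; apply: tendsM.
    under eq_fun do rewrite expr2; rewrite expr2.
    by apply: tendsM; apply: tends_qpoch_inf => //; exact: tendsN.
  apply: tendsM; last apply: tends_qpoch_inf => //.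
    apply: tendsM; last apply: tends_qpoch_inf => //.
      apply: tendsM; apply: tends_qpoch_inf => //.
        by apply: (tc (fun z => a * z * d) (a * d)) => z; ring.
      by apply: (tc (fun z => a * z * q / d) (a * q / d)) => z; ring.
    by apply: (tc (fun z => z * d * q / a) (d * q / a)) => z; ring.
  by apply: (tc (fun z => z * q ^+ 2 / (a * d)) (q ^+ 2 / (a * d))) => z; ring.
have tS : tends (fun n => whipple_sum (cn n) a d) 1.
  (* At c = 0 only the term k = 0 of the series survives. *)
  pose F k : C := if k == 0%N then 1 else 0.
  have -> : 1 = isum F by rewrite isum_nat1.
  have bcn : bdd (fun t : nat * nat => cn t.1) by exists `|c| => t.
  have [M M0 hM] := bdd_ge0 (bdd_whipple_coef d a (fun t : nat * nat => t.2) bcn).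
  have ag : absum (fun k => M * `|c| ^+ k).
    by apply/absumZ/absum_geometric; rewrite normr_ge0.
  have [] // := tannery (f := fun n k => whipple_coef (cn n) a d k * cn n ^+ k) (F := F) ag.
    move=> n k; rewrite [X in _ <= X]ger0_norm ?mulr_ge0 ?exprn_ge0 //.
    rewrite normrM normrX; apply: ler_pM; rewrite ?exprn_ge0 //.
      exact: (hM (n, k)).
    by apply: lerXn2r; rewrite ?nnegrE.
  case=> [|k]; rewrite /F /=.
    have tt : tends (fun n => whipple_tail (cn n) a d 1) 1.
      have E1 : 1 = whipple_tail 0 a d 1 :> C.
        by rewrite /whipple_tail !(mul0r, mulr0, oppr0) !qpoch_inf0 //; ring.
      rewrite [X in tends _ X]E1.
      have tc (f : C -> C) y : (forall z, f z = y * z) -> tends (fun n => f (cn n)) (f 0).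
        move=> hf; rewrite hf; under eq_fun do rewrite hf.
        by apply: tendsM => //; exact: tends_cst.
      rewrite /whipple_tail; apply: tendsM; last apply: tends_qpoch_inf => //.
        apply: tendsM; last apply: tends_qpoch_inf => //.
          apply: tendsM; apply: tends_qpoch_inf => //.
            by apply: (tc (fun z => - (z * q * 1 / a)) (- (q / a))) => z; ring.
          by apply: (tc (fun z => - (a * z * 1)) (- a)) => z; ring.
        by apply: (tc (fun z => z * q * 1 / d) (q / d)) => z; ring.
      by apply: (tc (fun z => z * d * 1) d) => z; ring.
    have := tendsM (tendsD (tends_cst 1) cn0) tt; rewrite addr0 mulr1.
    congr (tends _ _); apply: funext => n.
    rewrite /whipple_coef /qpoch_partial !(big_geq (leqnn _)) !expr0.
    by rewrite invr1 expr1n !mulr1.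
  apply: tends_bdd0.
    have bcn' : bdd cn by exists `|c|.
    exact: (bdd_whipple_coef d a (fun=> k.+1) bcn').
  have -> : 0 = 0 * 0 ^+ k :> C by rewrite mul0r.
  under eq_fun do rewrite exprS.
  apply: tendsM => //.
  elim: k => [|k ih]; first by under eq_fun do rewrite expr0; rewrite expr0; exact: tends_cst.
  by under eq_fun do rewrite exprS; rewrite exprS; exact: tendsM.
(* Cross-multiplied, since the recurrence factors may vanish; the two factors depending on n both
   tend to 1. *)
have key n : whipple_sum c a d * whipple_prod (cn n) a d =
    whipple_prod c a d * whipple_sum (cn n) a d.
  elim: n => [|n ih]; first by rewrite /cn expr0 mulr1 mulrC.
  have E : cn n.+1 = cn n * q ^+ 2 by rewrite /cn exprSr mulrA.
  have [r [rS rP]] : exists r, whipple_sum c a d = r * whipple_sum (cn n) a d /\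
    whipple_prod c a d = r * whipple_prod (cn n) a d.
    elim: {ih E} n => [|n [r [rS rP]]].
      by exists 1; rewrite /cn expr0 mulr1 !mul1r.
    exists (r * whipple_ratio (cn n) a d).
    have E : cn n.+1 = cn n * q ^+ 2 by rewrite /cn exprSr mulrA.
    rewrite rS rP E (whipple_prod_rec (cn n) a0 d0).
    by rewrite (whipple_sum_rec2 a0 d0 (le_lt_trans (cn1 n) c1)) !mulrA.
  rewrite rS rP (whipple_sum_rec2 a0 d0 (le_lt_trans (cn1 n) c1)).
  rewrite (whipple_prod_rec (cn n) a0 d0) -E; ring.
have := tendsM (tends_cst (whipple_sum c a d)) tP.
under eq_fun do rewrite key.
move=> h; have := tends_unique h (tendsM (tends_cst (whipple_prod c a d)) tS).
by rewrite !mulr1.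
Qed.
End Whipple.

(** * Gauss series and theta function identities *)

Section IntSums.
Variable C : sumCompleteFieldType.

Lemma absum_comp (I J : eqType) (f : I -> C) (h : J -> I) : injective h ->
  absum f -> absum (f \o h).
Proof.
move=> hi [M hM]; exists M => s us; have := hM [seq h n | n <- s].
by rewrite big_map; apply; rewrite map_inj_uniq.
Qed.

Lemma isum_bij (I J : eqType) (f : I -> C) (h : J -> I) : injective h ->
  (forall i, exists j, i = h j) -> absum f -> isum (f \o h) = isum f.
Proof.
move=> hi hs af; have f0 i : (forall j, i != h j) -> f i = 0.
  by have [j ->] := hs i => /(_ j); rewrite eqxx.
by have [_ ->] := isum_reindex hi f0 (absum_comp hi af).
Qed.

Lemma isum_shift (f : int -> C) (m : int) : absum f ->
  isum (fun n => f (n + m)) = isum f.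
Proof.
move=> af; rewrite -[RHS](isum_bij (h := fun n => n + m)) //; first exact: addIr.
by move=> i; exists (i - m); rewrite subrK.
Qed.

Lemma isum_opp (f : int -> C) : absum f -> isum (fun n => f (- n)) = isum f.
Proof.
move=> af; rewrite -[RHS](isum_bij (h := fun n => - n)) //.
by move=> i; exists (- i); rewrite opprK.
Qed.

Lemma isum_split (I : eqType) (J : Type) (s : seq J) (f : I -> C) (P : J -> pred I) :
  (forall i, \sum_(j <- s) (P j i)%:R = 1 :> C) -> absum f ->
  isum f = \sum_(j <- s) isum (fun i => if P j i then f i else 0).
Proof.
move=> hP af.
have aj j : absum (fun i => if P j i then f i else 0).
  by apply: absum_le af => i; case: ifP; rewrite ?normr0.
have -> : isum f = isum (fun i => \sum_(j <- s) if P j i then f i else 0).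
  apply: eq_isum => i; rewrite -[LHS]mul1r -(hP i) mulr_suml.
  by apply: eq_bigr => j _; case: ifP; rewrite ?mul1r ?mul0r.
elim: s {hP} => [|j s ih].
  by under eq_fun do rewrite big_nil; rewrite big_nil isum0.
under eq_fun do rewrite big_cons; rewrite big_cons isumD // ?ih //.
elim: s {ih} => [|k s ih].
  by under eq_fun do rewrite big_nil; exact: absum0.
by under eq_fun do rewrite big_cons; exact: absumD.
Qed.

Lemma isum_residues (f : int -> C) (m : nat) : (0 < m)%N -> absum f ->
  isum f = \sum_(r <- iota 0 m) isum (fun j : int => f (j * m%:Z + r%:Z)).
Proof.
move=> m0 af; have mz : m%:Z != 0 by rewrite eqz_nat -lt0n.
rewrite (isum_split (s := iota 0 m) (P := fun r i => (i %% m%:Z)%Z == r%:Z)) //.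
  rewrite big_seq [RHS]big_seq; apply: eq_bigr => r; rewrite mem_iota /= add0n => rm.
  have rE (j : int) : ((j * m%:Z + r%:Z) %% m%:Z)%Z = r%:Z.
    by rewrite modzMDl modz_small // ltz_nat rm.
  pose h (j : int) := j * m%:Z + r%:Z.
  have hi : injective h by move=> a b /addIr /(mulIf mz).
  have h0 i : (forall j, i != h j) -> (if (i %% m%:Z)%Z == r%:Z then f i else 0) = 0.
    case: eqP => // ir /(_ (i %/ m%:Z)%Z).
    by rewrite /h -ir -divz_eq eqxx.
  have [|_ ->] := isum_reindex hi h0.
    by apply: absum_comp hi _; apply: absum_le af => i; case: ifP; rewrite ?normr0.
  by apply: eq_isum => j; rewrite /= rE eqxx.
move=> i; have r0 : 0 <= (i %% m%:Z)%Z by exact: modz_ge0.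
have rm : (`|(i %% m%:Z)%Z| < m)%N.
  by rewrite -ltz_nat gez0_abs // ltz_pmod // ltz_nat.
rewrite (bigD1_seq `|(i %% m%:Z)%Z|%N) ?iota_uniq ?mem_iota //=.
rewrite gez0_abs // eqxx big1 ?addr0 // => j jn; case: eqP => // ij.
by move: jn; rewrite ij absz_nat eqxx.
Qed.

End IntSums.

Section Gauss.
Variable C : sumCompleteFieldType.
Implicit Types v z x y : C.

(** Jacobi's theta series with nome v. The exponent n^2 stays an integer, at the price of working
    with u, where u^2 = q. *)
Definition gauss v z : C := isum (fun n : int => v ^ (n ^+ 2) * z ^ n).

Lemma absum_gauss_nat v z : `|v| < 1 -> absum (fun n : nat => v ^+ (n ^ 2) * z ^+ n).
Proof.
move=> v1.
(* From n^2 = n (n - 1) + n: the product over i < n is dominated by that of the 1 + |z| |v|^(2i),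
   which is bounded, and v^n provides geometric decay. *)
have E n : v ^+ (n ^ 2) * z ^+ n = (\prod_(0 <= i < n) ((v ^+ 2) ^+ i * z)) * v ^+ n.
  elim: n => [|n ih]; first by rewrite big_geq // !expr0 !mulr1.
  rewrite big_nat_recr //= exprSr.
  have -> : v ^+ (n.+1 ^ 2) = v ^+ (n ^ 2) * (v ^+ 2) ^+ n * v.
    by rewrite -exprM -exprD -exprSr; congr (_ ^+ _); rewrite -!mulnn; lia.
  rewrite [v ^+ n.+1]exprSr.
  transitivity (v ^+ (n ^ 2) * z ^+ n * ((v ^+ 2) ^+ n * z) * v); first by ring.
  rewrite ih; ring.
under eq_fun do rewrite E.
apply: absum_bdd_geometric => //.
have v2 : 0 <= `|v ^+ 2| < 1 by rewrite normr_ge0 norm_sq_lt1.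
have [M hM] := prod_1D_bounded v2 (normr_ge0 z).
exists M => n; apply: le_trans (hM n); rewrite normr_prod; apply: ler_prod => i _.
by rewrite normr_ge0 /= normrM normrX mulrC lerDr.
Qed.

Lemma absum_gauss v z : `|v| < 1 -> absum (fun n : int => v ^ (n ^+ 2) * z ^ n).
Proof.
move=> v1.
have ap : absum (fun n : nat => v ^ (n%:Z ^+ 2) * z ^ n%:Z).
  exact: absum_gauss_nat.
have an : absum (fun n : nat => v ^ (Negz n ^+ 2) * z ^ (Negz n)).
  have := absum_comp succn_inj (absum_gauss_nat z^-1 v1).
  congr (absum _); apply: funext => n /=.
  have -> : Negz n ^+ 2 = (n.+1 ^ 2)%N by rewrite NegzE sqrrN expr2 -PoszM mulnn.
  by rewrite NegzE -exprz_inv.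
by have [] := isum_int (f := fun n : int => v ^ (n ^+ 2) * z ^ n) ap an.
Qed.

Lemma gauss_inv v z : `|v| < 1 -> gauss v z^-1 = gauss v z.
Proof.
move=> v1; rewrite /gauss -[RHS]isum_opp; last exact: absum_gauss.
by apply: eq_isum => n; rewrite sqrrN exprz_inv.
Qed.

Lemma gauss_shift v z (k : int) : `|v| < 1 -> v != 0 -> z != 0 ->
  gauss v (v ^ (2 * k) * z) = v ^ (- (k ^+ 2)) * z ^ (- k) * gauss v z.
Proof.
move=> v1 v0 z0; rewrite /gauss -[X in _ = _ * X](isum_shift k (absum_gauss z v1)).
rewrite -isumZ; last first.
  by apply: (absum_comp (h := fun n => n + k) (f := fun n => v ^ (n ^+ 2) * z ^ n)) (absum_gauss z v1); exact: addIr.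
apply: eq_isum => n; rewrite expfzMl.
have -> : (n + k) ^+ 2 = n ^+ 2 + 2 * k * n + k ^+ 2 by ring.
rewrite !expfzDr // exprz_exp.
have e1 : v ^ (- (k ^+ 2)) * v ^ (k ^+ 2) = 1 by rewrite -expfzDr // addNr.
have e2 : z ^ (- k) * z ^ k = 1 by rewrite -expfzDr // addNr.
transitivity ((v ^ (- (k ^+ 2)) * v ^ (k ^+ 2)) * (z ^ (- k) * z ^ k) *
  (v ^ (n ^+ 2) * v ^ (2 * k * n) * z ^ n)); last by ring.
by rewrite e1 e2; ring.
Qed.

(** The outer index N is the difference of the two summation indices; for fixed N the inner sum is
    again a Gauss series, of nome u v. Residues of N modulo 2 then give the product formula for v =
    u, and residues modulo 3 the quintuple product, where the nomes are u^2 and u. *)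
Lemma gauss_conv u v x y : `|u| < 1 -> `|v| < 1 -> u != 0 -> x != 0 ->
  let F := fun N : int => u ^ (N ^+ 2) * x ^ N * gauss (u * v) (u ^ (2 * N) * (x * y)) in
  absum F /\ gauss u x * gauss v y = isum F.
Proof.
move=> u1 v1 u0 x0; have au := absum_gauss x u1; have av := absum_gauss y v1.
rewrite /gauss isumM //=.
set f := fun p : int * int => _.
have af : absum f.
  by apply: (absum_prod_le _ au av) => i j; rewrite /f normrM.
pose h (p : int * int) := (p.1 + p.2, p.2).
have hi : injective h by move=> [a b] [c d] [] /[swap] -> /addIr ->.
rewrite -(isum_bij hi _ af); last first.
  by move=> [a b]; exists (a - b, b); rewrite /h /= subrK.
have afh := absum_comp hi af.
rewrite -isum_pair //.
have E N : u ^ (N ^+ 2) * x ^ N *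
      isum (fun n : int => (u * v) ^ (n ^+ 2) * (u ^ (2 * N) * (x * y)) ^ n) =
    isum (fun j => (f \o h) (N, j)).
  rewrite -isumZ; last by apply: absum_gauss; rewrite normrM mulr_ilt1.
  apply: eq_isum => n; rewrite /f /=.
  have -> : (N + n) ^+ 2 = N ^+ 2 + 2 * N * n + n ^+ 2 by ring.
  rewrite !expfzDr // !expfzMl exprz_exp; ring.
rewrite (eq_isum E); split=> //.
by rewrite (funext E); exact: absum_isum_section.
Qed.

End Gauss.

Section GaussIdentities.
Variable C : sumCompleteFieldType.
Implicit Types u v x y z t : C.

(** The inner nome is u^2, for which the factor u^(2N) in the argument is a whole number of periods
    exactly when N is even; even and odd N give the two terms. *)
Lemma gauss_prod u x y : `|u| < 1 -> u != 0 -> x != 0 -> y != 0 ->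
  gauss u x * gauss u y =
    gauss (u ^+ 2) (x * y) * gauss (u ^+ 2) (x / y) +
    u * x * (gauss (u ^+ 2) (u ^+ 2 * (x * y)) * gauss (u ^+ 2) (u ^+ 2 * (x / y))).
Proof.
move=> u1 u0 x0 y0; have [aF ->] := gauss_conv y u1 u1 u0 x0.
rewrite (isum_residues (m := 2)) // !big_cons big_nil addr0 -expr2.
set q := u ^+ 2; have q0 : q != 0 by rewrite expf_neq0.
have q1 : `|q| < 1 by exact: norm_sq_lt1.
have qE n : u ^ (2 * n) = q ^ n by rewrite -exprz_exp.
have xy0 : x * y != 0 by rewrite mulf_neq0.
have nz (w : C) (k : int) : w != 0 -> w ^ k != 0 by exact: expfz_neq0.
congr (_ + _).
  rewrite [gauss q (x / y)]/gauss -isumZ; last exact: absum_gauss.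
  apply: eq_isum => j; rewrite !addr0 qE.
  have -> : q ^ (j * 2) = q ^ (2 * j) by rewrite mulrC.
  rewrite gauss_shift //.
  have -> : u ^ ((j * 2) ^+ 2) = q ^ (j ^+ 2) * q ^ (j ^+ 2).
    by rewrite -expfzDr // -qE; congr (_ ^ _); ring.
  have -> : x ^ (j * 2) = x ^ j * x ^ j by rewrite -expfzDr //; congr (_ ^ _); ring.
  rewrite !expfzMl -!invr_expz exprz_inv -invr_expz.
  field; by rewrite !nz.
set G := gauss q (q * (x * y)).
have -> : u * x * (G * gauss q (q * (x / y))) = (u * x * G) * gauss q (q * (x / y)) by ring.
rewrite [gauss q (q * (x / y))]/gauss -isumZ; last exact: absum_gauss.
apply: eq_isum => j.
have -> : u ^ (2 * (j * 2 + 1)) * (x * y) = q ^ (2 * j) * (q * (x * y)).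
  by rewrite qE expfzDr // expr1z mulrC -mulrA [j * 2]mulrC; ring.
rewrite gauss_shift ?mulf_neq0 // -/G.
have -> : u ^ ((j * 2 + 1) ^+ 2) = q ^ (j ^+ 2) * q ^ (j ^+ 2) * (q ^ j * q ^ j) * u.
  by rewrite -!expfzDr // -qE -[X in _ = _ * X]expr1z -expfzDr //; congr (_ ^ _); ring.
have -> : x ^ (j * 2 + 1) = x ^ j * x ^ j * x.
  by rewrite -expfzDr // -[X in _ = _ * X]expr1z -expfzDr //; congr (_ ^ _); ring.
rewrite !expfzMl -!invr_expz exprz_inv -invr_expz.
by field; rewrite !nz.
Qed.

Lemma gauss_shift1 v z : `|v| < 1 -> v != 0 -> z != 0 ->
  gauss v (v ^+ 2 * z) = v^-1 * z^-1 * gauss v z.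
Proof. by move=> v1 v0 z0; have := gauss_shift 1 v1 v0 z0; rewrite mulr1 expr1n. Qed.

(** A zero of the theta series: a shift by one period takes - 1/v to its inverse - v with factor -
    1, while inversion leaves the value unchanged. *)
Lemma gauss_opp v : `|v| < 1 -> v != 0 -> gauss v (- v) = 0.
Proof.
move=> v1 v0; have vi0 : - v^-1 != 0 by rewrite oppr_eq0 invr_eq0.
have := gauss_shift1 v1 v0 vi0.
have -> : v ^+ 2 * - v^-1 = - v by field.
have -> : - v^-1 = (- v)^-1 by rewrite invrN.
rewrite gauss_inv // invrK mulrN mulVf // mulN1r => /eqP.
by rewrite -addr_eq0 -mulr2n mulrn_eq0 /= => /eqP.
Qed.

(** The quintuple product identity. The inner series have nome u^3; residues 0 and 1 of N modulo 3
    give the two series on the right, while for residue 2 the inner series is a period shift of its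
    zero - u^3 and drops out. *)
Lemma gauss_quintuple u t : `|u| < 1 -> u != 0 -> t != 0 ->
  gauss u (- (t ^+ 2 / u)) * gauss (u ^+ 2) (t ^+ 2) =
  gauss (u ^+ 3) (- u) *
    (gauss (u ^+ 6) (t ^+ 6 / u ^+ 2) - t ^+ 2 * gauss (u ^+ 6) (t ^+ 6 * u ^+ 2)).
Proof.
move=> u1 u0 t0; set q := u ^+ 2; have q0 : q != 0 by rewrite expf_neq0.
have q1 : `|q| < 1 by exact: norm_sq_lt1.
have q3 : `|u ^+ 6| < 1 by rewrite normrX exprn_ilt1.
have u3 : `|u ^+ 3| < 1 by rewrite normrX exprn_ilt1.
have u30 : u ^+ 3 != 0 by rewrite expf_neq0.
have t20 : t ^+ 2 != 0 by rewrite expf_neq0.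
have nu0 : - u != 0 by rewrite oppr_eq0.
have -> : - (t ^+ 2 / u) = (- (u / t ^+ 2))^-1 by rewrite invrN invf_div.
rewrite gauss_inv // mulrC.
have [aF ->] := gauss_conv (- (u / t ^+ 2)) q1 u1 q0 t20.
rewrite (isum_residues (m := 3)) // !big_cons big_nil addr0.
have -> : q * u = u ^+ 3 by rewrite /q; ring.
have -> : t ^+ 2 * - (u / t ^+ 2) = - u by field.
set P := gauss (u ^+ 3) (- u).
have nz (w : C) (k : int) : w != 0 -> w ^ k != 0 by exact: expfz_neq0.
have uE (m : nat) n : (u ^+ m) ^ n = u ^ (m%:Z * n) by rewrite -exprz_exp.
have tE (m : nat) n : (t ^+ m) ^ n = t ^ (m%:Z * n) by rewrite -exprz_exp.
have jj (w : C) (j : int) : w != 0 -> w ^ (2 * j) = w ^ j * w ^ j.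
  by move=> w0; rewrite -expfzDr // -mulr2n mulrC mulr_natr.
have P1 : gauss (u ^+ 3) (- u ^+ 5) = - (u ^+ 2)^-1 * P.
  have -> : - u ^+ 5 = (u ^+ 3) ^+ 2 * (- u)^-1 by rewrite invrN; field.
  by rewrite gauss_shift1 ?invr_eq0 // gauss_inv // -/P invrK; field.
have P2 : gauss (u ^+ 3) (- u ^+ 9) = 0.
  have -> : - u ^+ 9 = (u ^+ 3) ^+ 2 * - (u ^+ 3) by ring.
  by rewrite gauss_shift1 ?oppr_eq0 // gauss_opp // mulr0.
have shift (z : C) (j : int) : z != 0 ->
    gauss (u ^+ 3) (u ^ (12 * j) * z) =
    (u ^ (6 * j ^+ 2))^-1 * (u ^ (6 * j ^+ 2))^-1 * (z ^ j * z ^ j)^-1 * gauss (u ^+ 3) z.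
  move=> z0; have -> : u ^ (12 * j) = (u ^+ 3) ^ (2 * (2 * j)).
    by rewrite uE; congr (_ ^ _); ring.
  rewrite gauss_shift //.
  have -> : (u ^+ 3) ^ (- ((2 * j) ^+ 2)) = (u ^ (6 * j ^+ 2))^-1 * (u ^ (6 * j ^+ 2))^-1.
    by rewrite uE !invr_expz -expfzDr //; congr (_ ^ _); ring.
  rewrite -expfzDr // [(z ^ (j + j))^-1]invr_expz.
  by have -> : j + j = 2 * j by ring.
have -> : isum (fun j : int => q ^ ((j * 3 + 0) ^+ 2) * (t ^+ 2) ^ (j * 3 + 0) *
    gauss (u ^+ 3) (q ^ (2 * (j * 3 + 0)) * - u)) = P * gauss (u ^+ 6) (t ^+ 6 / u ^+ 2).
  rewrite [gauss (u ^+ 6) _]/gauss -isumZ; last exact: absum_gauss.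
  apply: eq_isum => j; rewrite !addr0 !uE !tE.
  have -> : u ^ (2%:Z * (2 * (j * 3))) = u ^ (12 * j) by congr (_ ^ _); ring.
  rewrite shift // -/P.
  have -> : u ^ (2%:Z * (j * 3) ^+ 2) =
     u ^ (6 * j ^+ 2) * u ^ (6 * j ^+ 2) * u ^ (6 * j ^+ 2).
    by rewrite -!expfzDr //; congr (_ ^ _); ring.
  have -> : t ^ (2%:Z * (j * 3)) = t ^ (6%:Z * j) by congr (_ ^ _); ring.
  rewrite expfzMl tE.
  have -> : (- u) ^ j * (- u) ^ j = (u * u) ^ j by rewrite -expfzMl mulrNN.
  have -> : 6%:Z * j ^+ 2 = 6 * j ^+ 2 by ring.
  have -> : (u ^+ 2)^-1 ^ j = ((u * u) ^ j)^-1 by rewrite exprz_inv -invr_expz expr2.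
  by field; rewrite !nz ?mulf_neq0.
have -> : isum (fun j : int => q ^ ((j * 3 + 1%:Z) ^+ 2) * (t ^+ 2) ^ (j * 3 + 1%:Z) *
    gauss (u ^+ 3) (q ^ (2 * (j * 3 + 1%:Z)) * - u)) =
    - (P * t ^+ 2) * gauss (u ^+ 6) (t ^+ 6 * u ^+ 2).
  rewrite [gauss (u ^+ 6) _]/gauss -isumZ; last exact: absum_gauss.
  apply: eq_isum => j; rewrite !uE !tE.
  have -> : u ^ (2%:Z * (2 * (j * 3 + 1))) * - u = u ^ (12 * j) * - u ^+ 5.
    have -> : 2%:Z * (2 * (j * 3 + 1)) = 12 * j + 4%:Z by ring.
    by rewrite expfzDr // -exprnP; ring.
  rewrite shift ?oppr_eq0 ?expf_neq0 // P1.
  have -> : u ^ (2%:Z * (j * 3 + 1) ^+ 2) =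
     u ^ (6 * j ^+ 2) * u ^ (6 * j ^+ 2) * u ^ (6 * j ^+ 2) * (u ^ (12 * j) * u ^+ 2).
    by rewrite ?[u ^+ 2]exprnP ?[t ^+ 2]exprnP -!expfzDr //; congr (_ ^ _); ring.
  have -> : t ^ (2%:Z * (j * 3 + 1)) = t ^ (6%:Z * j) * t ^+ 2.
    by rewrite ?[u ^+ 2]exprnP ?[t ^+ 2]exprnP -!expfzDr //; congr (_ ^ _); ring.
  have -> : (- u ^+ 5) ^ j * (- u ^+ 5) ^ j = u ^ (10%:Z * j).
    by rewrite -expfzMl mulrNN -exprD uE.
  have -> : u ^ (12 * j) = u ^ (10%:Z * j) * u ^ (2%:Z * j).
    by rewrite -!expfzDr //; congr (_ ^ _); ring.
  rewrite expfzMl tE uE.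
  have -> : 6%:Z * j ^+ 2 = 6 * j ^+ 2 by ring.
  by field; rewrite u0 !nz.
rewrite [X in _ + (_ + X)](_ : _ = 0); first by rewrite /q; ring.
rewrite -[RHS](isum0 C int); apply: eq_isum => j; rewrite !uE.
have -> : u ^ (2%:Z * (2 * (j * 3 + 2%:Z))) * - u = u ^ (12 * j) * - u ^+ 9.
  have -> : 2%:Z * (2 * (j * 3 + 2%:Z)) = 12 * j + 8%:Z by ring.
  by rewrite expfzDr // -exprnP; ring.
by rewrite shift ?oppr_eq0 ?expf_neq0 // P2 !mulr0.
Qed.

End GaussIdentities.

(** * Jacobi's triple product *)

Section TripleProduct.
Variable C : sumCompleteFieldType.
Variable u : C.
Hypotheses (u0 : u != 0) (u1 : `|u| < 1).
Let q := u ^+ 2.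
Local Notation pp := (fun x n => qpoch_partial x q n).

Let q0 : q != 0. Proof. by rewrite expf_neq0. Qed.
Let q1 : `|q| < 1. Proof. exact: norm_sq_lt1. Qed.

Lemma isum_single (I : eqType) (f : I -> C) (i0 : I) :
  (forall i, i != i0 -> f i = 0) -> isum f = f i0.
Proof.
move=> f0; apply: isumE => e e0; exists [:: i0] => s us /(_ i0) s0.
by rewrite (bigD1_seq i0) ?s0 ?inE //= big1 ?addr0 ?subrr ?normr0.
Qed.

Lemma one_sub_expS_neq0 n : 1 - q ^+ n.+1 != 0.
Proof.
rewrite subr_eq0; have : `|q ^+ n.+1| < 1 by rewrite normrX exprn_ilt1.
by apply: contraTneq => <-; rewrite normr1 ltxx.
Qed.

(* 1/(q;q)_k, which vanishes at negative k *)
Definition qfact_inv (k : int) : C := if k is Posz m then (pp q m)^-1 else 0.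

Lemma qfact_invS k : qfact_inv k = (1 - q ^ (k + 1)) * qfact_inv (k + 1).
Proof.
case: k => [m|[|m]].
- have -> : m%:Z + 1 = m.+1%:Z by lia.
  rewrite /= qpoch_partialS -exprS -exprnP.
  have [p0|p0] := eqVneq (pp q m) 0; first by rewrite p0 mul0r invr0 mulr0.
  by field; rewrite p0 one_sub_expS_neq0.
- by rewrite subrr mul0r.
- have -> : Negz m.+1 + 1 = Negz m by lia.
  by rewrite mulr0.
Qed.

Lemma bdd_qfact_inv (T : Type) (k : T -> int) : bdd (fun t => qfact_inv (k t)).
Proof.
have [M M0 hM] := bdd_ge0 (bdd_qpoch_partialV q1 (fun n : nat => n) (qpoch_inf_neq0_small q1 q1)).
exists M => t; rewrite /qfact_inv; case: (k t) => m; first exact: hM.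
by rewrite normr0.
Qed.

(** The q-binomial coefficient 2N over N + n times u^(n^2). It vanishes for |n| > N by the
    convention in [qfact_inv], so the finite identity is also a sum over all integers. *)
Definition jtp_coef (N : nat) (n : int) : C :=
  pp q (N * 2)%N * (qfact_inv (N%:Z + n) * qfact_inv (N%:Z - n)) * u ^ (n ^+ 2).

(** Coefficient of z^n after multiplication by the new factors (1 + u^(2N+1) z) (1 + u^(2N+1) / z)
    of the product. *)
Lemma jtp_coef_rec N n : jtp_coef N.+1 n =
  (1 + q ^+ (N * 2)%N.+1) * jtp_coef N n +
  u ^+ (N * 2)%N.+1 * (jtp_coef N (n - 1) + jtp_coef N (n + 1)).
Proof.
rewrite /jtp_coef mulSn addSn add1n !qpoch_partialS.
set D := pp q _.
have e1 : N.+1%:Z + n = N%:Z + n + 1 by lia.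
have e2 : N.+1%:Z - n = N%:Z - n + 1 by lia.
have e3 : N%:Z + (n - 1) = N%:Z + n - 1 by lia.
have e4 : N%:Z - (n - 1) = N%:Z - n + 1 by lia.
have e5 : N%:Z + (n + 1) = N%:Z + n + 1 by lia.
have e6 : N%:Z - (n + 1) = N%:Z - n - 1 by lia.
rewrite e1 e2 e3 e4 e5 e6.
rewrite [qfact_inv (N%:Z + n - 1)]qfact_invS [qfact_inv (N%:Z - n - 1)]qfact_invS !subrK.
rewrite [qfact_inv (N%:Z + n)]qfact_invS [qfact_inv (N%:Z - n)]qfact_invS.
set a := qfact_inv _; set b := qfact_inv _.
set X := q ^ (N%:Z + n); set Y := q ^ (N%:Z - n).
have X1 : q ^ (N%:Z + n + 1) = q * X by rewrite expfzDr // expr1z mulrC.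
have Y1 : q ^ (N%:Z - n + 1) = q * Y by rewrite expfzDr // expr1z mulrC.
rewrite X1 Y1.
set U := u ^ (n ^+ 2).
have XY : q ^+ (N * 2)%N = X * Y.
  by rewrite /X /Y -expfzDr // exprnP; congr (_ ^ _); lia.
have Un : u ^+ (N * 2)%N.+1 * u ^ ((n - 1) ^+ 2) = q * Y * U.
  have -> : q * Y = u ^ (2 * (N%:Z - n + 1)) by rewrite -Y1 -exprz_exp.
  by rewrite /U exprnP -!expfzDr //; congr (_ ^ _); lia.
have Up : u ^+ (N * 2)%N.+1 * u ^ ((n + 1) ^+ 2) = q * X * U.
  have -> : q * X = u ^ (2 * (N%:Z + n + 1)) by rewrite -X1 -exprz_exp.
  by rewrite /U exprnP -!expfzDr //; congr (_ ^ _); lia.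
have -> : q ^+ (N * 2)%N.+1 = q * (X * Y) by rewrite exprS XY.
have -> : q * q ^+ (N * 2)%N = q * (X * Y) by rewrite XY.
rewrite mulrDr; set W := u ^+ _ in Un Up *.
transitivity ((1 + q * (X * Y)) * (D * ((1 - q * X) * a * ((1 - q * Y) * b)) * U) +
  (D * ((1 - X) * ((1 - q * X) * a) * b) * (W * u ^ ((n - 1) ^+ 2)) +
   D * (a * ((1 - Y) * ((1 - q * Y) * b))) * (W * u ^ ((n + 1) ^+ 2)))); last by ring.
rewrite Un Up; ring.
Qed.

Lemma jtp_coefE N n z : jtp_coef N n * z ^ n =
  pp q (N * 2)%N * (qfact_inv (N%:Z + n) * qfact_inv (N%:Z - n)) * (u ^ (n ^+ 2) * z ^ n).
Proof. by rewrite /jtp_coef !mulrA. Qed.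

Lemma bdd_jtp : bdd (fun p : nat * int =>
  pp q (p.1 * 2)%N * (qfact_inv (p.1%:Z + p.2) * qfact_inv (p.1%:Z - p.2))).
Proof.
apply: bddM; last by apply: bddM; exact: bdd_qfact_inv.
by apply: bdd_qpoch_partial => //; exact: bdd_cst.
Qed.

Lemma absum_jtp N z : absum (fun n => jtp_coef N n * z ^ n).
Proof.
have [M M0 hM] := bdd_ge0 bdd_jtp.
apply: (absum_le (g := fun n => M * (u ^ (n ^+ 2) * z ^ n))); last first.
  by apply: absumZ; exact: absum_gauss.
move=> n; rewrite jtp_coefE normrM [X in _ <= X]normrM ler_wpM2r // (ger0_norm M0).
exact: (hM (N, n)).
Qed.

Lemma finite_triple_product N z : z != 0 ->
  isum (fun n => jtp_coef N n * z ^ n) = pp (- (u * z)) N * pp (- (u / z)) N.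
Proof.
move=> z0; elim: N => [|N ih].
  rewrite (isum_single (i0 := 0)).
    rewrite /jtp_coef /= /qpoch_partial !big_geq // invr1 expr0n !expr0z; ring.
  move=> [[|n]|n] // _; rewrite /jtp_coef.
    have -> : 0%:Z - n.+1%:Z = Negz n by lia.
    by rewrite !mulr0 !mul0r.
  have -> : 0%:Z + Negz n = Negz n by lia.
  by rewrite mul0r mulr0 !mul0r.
have a := absum_jtp N z.
have E n : jtp_coef N.+1 n * z ^ n =
   (1 + q ^+ (N * 2)%N.+1) * (jtp_coef N n * z ^ n) +
   (u ^+ (N * 2)%N.+1 * z * (jtp_coef N (n - 1) * z ^ (n - 1)) +
    u ^+ (N * 2)%N.+1 / z * (jtp_coef N (n + 1) * z ^ (n + 1))).
  rewrite jtp_coef_rec !expfzDr // expr1z exprN1; field.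
  by rewrite z0.
rewrite (eq_isum E).
have sh (m : int) : absum (fun n : int => jtp_coef N (n + m) * z ^ (n + m)).
  by apply: (absum_comp (h := fun n => n + m) (f := fun n => jtp_coef N n * z ^ n)) a; exact: addIr.
rewrite isumD; [|exact: absumZ|by apply: absumD; apply: absumZ; exact: sh].
rewrite isumD; [|by apply: absumZ; exact: sh|by apply: absumZ; exact: sh].
rewrite (isumZ _ a) (isumZ _ (sh (- 1))) (isumZ _ (sh 1)).
rewrite (isum_shift (- 1) a) (isum_shift 1 a) ih !qpoch_partialS.
have -> : q ^+ N = u ^+ (N * 2)%N by rewrite -exprM mulnC.
have -> : q ^+ (N * 2).+1 = u ^+ (N * 2).+1 * u ^+ (N * 2).+1.
  by rewrite -exprM -exprD; congr (_ ^+ _); lia.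
rewrite !exprS; field.
by rewrite z0.
Qed.

Lemma tends_qfact_inv (n : int) : tends (fun N : nat => qfact_inv (N%:Z + n)) (qpoch_inf q q)^-1.
Proof.
apply/(tends_shift _ _ `|n|%N).
have h := tendsV (qpoch_inf_neq0_small q1 q1) (qpoch_inf_cvg q1 q).
have [m hm] : exists m : nat, (`|n|%N)%:Z + n = m%:Z.
  by case: (intP n) => [|k|k]; [exists 0%N|exists (k.+1 + k.+1)%N|exists 0%N]; lia.
have -> : (fun N => qfact_inv ((N + `|n|)%N%:Z + n)) = (fun N => (pp q (N + m)%N)^-1).
  by apply: funext => N; have -> : (N + `|n|)%N%:Z + n = (N + m)%N%:Z by lia.
by apply/(tends_shift (fun N => (pp q N)^-1)).
Qed.

(** The limit of the finite identity: the q-factorial quotients are bounded uniformly in N and n, so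
    the Gauss series itself is a majorant. *)
Lemma triple_product z : z != 0 ->
  gauss u z = qpoch_inf q q * qpoch_inf (- (u * z)) q * qpoch_inf (- (u / z)) q.
Proof.
move=> z0; have Q0 := qpoch_inf_neq0_small q1 q1.
have [M M0 hM] := bdd_ge0 bdd_jtp.
have ag : absum (fun n : int => M * (u ^ (n ^+ 2) * z ^ n)) by apply: absumZ; exact: absum_gauss.
have [] := tannery (f := fun N n => jtp_coef N n * z ^ n)
  (F := fun n => (qpoch_inf q q)^-1 * (u ^ (n ^+ 2) * z ^ n)) ag.
- move=> N n; rewrite jtp_coefE normrM [X in _ <= X]normrM ler_wpM2r // (ger0_norm M0).
  exact: (hM (N, n)).
- move=> n; under eq_fun do rewrite jtp_coefE.
  apply: tendsM; last exact: tends_cst.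
  have -> : (qpoch_inf q q)^-1 = qpoch_inf q q * ((qpoch_inf q q)^-1 * (qpoch_inf q q)^-1) by field.
  apply: tendsM; last by apply: tendsM; exact: tends_qfact_inv.
  apply: (tends_sub (u := pp q) (s := fun N => (N * 2)%N)); last exact: qpoch_inf_cvg.
  by move=> N; rewrite leq_pmulr.
move=> _; rewrite (isumZ _ (absum_gauss z u1)) -/(gauss u z).
under eq_fun do rewrite finite_triple_product //.
move=> h; have := tends_unique h (tendsM (qpoch_inf_cvg q1 (- (u * z))) (qpoch_inf_cvg q1 (- (u / z)))).
by move=> E; rewrite -mulrA -E mulVKf.
Qed.

End TripleProduct.

(** * Theta functions as Gauss series, and the plane of antisymmetric functions *)

Section ThetaIdentities.
Variable C : sumCompleteFieldType.
Variable u : C.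
Hypotheses (u0 : u != 0) (u1 : `|u| < 1).
Local Notation q := (u ^+ 2).
Local Notation th := (fun x => qtheta x q).
Local Notation G := (gauss q).
Local Notation Q := (qpoch_inf q q).

Let q0 : q != 0. Proof. by rewrite expf_neq0. Qed.
Let q1 : `|q| < 1. Proof. exact: norm_sq_lt1. Qed.

Lemma Q_neq0 : Q != 0. Proof. exact: qpoch_inf_neq0_small. Qed.

Lemma gauss_theta x : x != 0 -> gauss u (- (x / u)) = Q * th x.
Proof.
move=> x0; rewrite triple_product ?oppr_eq0 ?mulf_neq0 ?invr_eq0 // qthetaE mulrA.
have -> : - (u * - (x / u)) = x by field.
by have -> : - (u / - (x / u)) = q / x by rewrite invrN; field; rewrite x0.
Qed.

Lemma theta_prod x y : x != 0 -> y != 0 ->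
  Q ^+ 2 * (th x * th y) = G (x * y / q) * G (x / y) - x * (G (x * y) * G (q * (x / y))).
Proof.
move=> x0 y0.
have -> : Q ^+ 2 * (th x * th y) = (Q * th x) * (Q * th y) by ring.
have nz z : z != 0 -> - (z / u) != 0 by move=> z0; rewrite oppr_eq0 mulf_neq0 ?invr_eq0.
rewrite -!gauss_theta // (gauss_prod u1 u0 (nz _ x0) (nz _ y0)).
have -> : - (x / u) * - (y / u) = x * y / q by field.
have -> : - (x / u) / - (y / u) = x / y by rewrite invrN mulrNN; field; rewrite u0 y0.
have -> : q * (x * y / q) = x * y by field.
have -> : u * - (x / u) = - x by field.
by rewrite mulNr.
Qed.

Lemma gauss_down z : z != 0 -> G (q * z) = z^-1 * G (z / q).
Proof.
move=> z0; have -> : q * z = q ^+ 2 * (z / q) by field.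
rewrite gauss_shift1 ?mulf_neq0 ?invr_eq0 //; congr (_ * _).
by field; rewrite z0.
Qed.

(** Through [theta_prod] both sides become polynomials in the six values of [G] at 1, q, x^2, x^2 /
    q, y^2, y^2 / q; in particular th(- 1)^2 is 2 G(1) G(q) up to the factor [Q ^+ 2]. This is the
    quadratic identity on which the three-term relation rests. *)
Lemma theta_square_identity x y : x != 0 -> y != 0 ->
  th x ^+ 2 * th (- y) ^+ 2 - th (- x) ^+ 2 * th y ^+ 2 =
  y * th (- 1) ^+ 2 * (th (x * y) * th (x / y)).
Proof.
move=> x0 y0.
have sq z : z != 0 -> Q ^+ 2 * th z ^+ 2 = G (z ^+ 2 / q) * G 1 - z * (G (z ^+ 2) * G q).
  by move=> z0; rewrite expr2 theta_prod // divff // mulr1 -expr2.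
have N1 : Q ^+ 2 * th (- 1) ^+ 2 = 2 * (G 1 * G q).
  rewrite sq ?oppr_eq0 ?oner_eq0 // sqrrN expr1n mul1r gauss_inv // mulN1r opprK.
  by rewrite mulrC -mulr2n mulr_natl.
have XY : Q ^+ 2 * (th (x * y) * th (x / y)) =
    G (x ^+ 2 / q) * G (y ^+ 2) - x * y * G (x ^+ 2) * (y ^- 2 * G (y ^+ 2 / q)).
  rewrite theta_prod ?mulf_neq0 ?invr_eq0 //.
  have -> : x * y * (x / y) = x ^+ 2 by field.
  have -> : x * y / (x / y) = y ^+ 2 by field; rewrite x0 y0.
  by rewrite gauss_down ?expf_neq0 // !mulrA.
have Q4 : Q ^+ 4 != 0 by rewrite expf_neq0 ?Q_neq0.
apply: (mulfI Q4).
have -> : Q ^+ 4 * (th x ^+ 2 * th (- y) ^+ 2 - th (- x) ^+ 2 * th y ^+ 2) =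
  (Q ^+ 2 * th x ^+ 2) * (Q ^+ 2 * th (- y) ^+ 2) -
  (Q ^+ 2 * th (- x) ^+ 2) * (Q ^+ 2 * th y ^+ 2) by ring.
have -> : Q ^+ 4 * (y * th (- 1) ^+ 2 * (th (x * y) * th (x / y))) =
  y * (Q ^+ 2 * th (- 1) ^+ 2) * (Q ^+ 2 * (th (x * y) * th (x / y))) by ring.
rewrite N1 XY !sq ?oppr_eq0 // !sqrrN.
set a := G _; set b := G _; set c := G _; set d := G _; set e := G _; set f := G _.
by field.
Qed.

(** [thE] is even and [thO] odd in t, so values at be and - be separate the two coefficients of a
    combination. *)
Definition thE t := G (t ^+ 2).
Definition thO t := t * G (q * t ^+ 2).

(** The right-hand side is a determinant of the pair ([thO], [thE]) at al and t. These theta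
    products thus act as Lagrange polynomials for the span of [thE] and [thO]. *)
Lemma theta_EO al t : al != 0 -> t != 0 ->
  Q ^+ 2 * (th (al * t) * th (al / t)) = al * (thO al * thE t - thE al * thO t).
Proof.
move=> a0 t0; rewrite theta_prod ?mulf_neq0 ?invr_eq0 //.
have -> : al * t * (al / t) = al ^+ 2 by field.
have -> : al * t / (al / t) = t ^+ 2 by field; rewrite a0 t0.
have E : G (al ^+ 2 / q) = al ^+ 2 * G (q * al ^+ 2).
  by rewrite gauss_down ?expf_neq0 // mulrA divff ?mul1r // expf_neq0.
by rewrite E /thE /thO; ring.
Qed.

Lemma thEN t : thE (- t) = thE t. Proof. by rewrite /thE sqrrN. Qed.
Lemma thON t : thO (- t) = - thO t. Proof. by rewrite /thO sqrrN mulNr. Qed.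

(* [t] times an antisymmetric theta function of degree 6: these form a plane, and
   [th (t ^+ 2)] divides them all. *)
Definition antisym6 (a : C -> C) := exists c1 c2 : C, forall t, t != 0 ->
  a t = th (t ^+ 2) * (c1 * thE t + c2 * thO t).

(** Cramer's rule for the two coefficients. The determinant of the nodes be and - be is th(- be^2)
    th(- 1) up to a factor, and th(be^2) is the value of the common divisor th(t^2) at both
    nodes. *)
Lemma antisym6_interpolation a be t : antisym6 a -> be != 0 -> t != 0 ->
  th (be ^+ 2) * th (- be ^+ 2) * th (- 1) * a t =
  th (t ^+ 2) * (th (- (be * t)) * th (- (be / t)) * a be +
                 th (be * t) * th (be / t) * a (- be)).
Proof.
move=> [c1 [c2 ha]] b0 t0; have nb0 : - be != 0 by rewrite oppr_eq0.
have h1 := theta_EO b0 nb0; have h2 := theta_EO nb0 t0; have h3 := theta_EO b0 t0.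
have -> : - (be * t) = - be * t by ring.
have -> : - (be / t) = - be / t by ring.
have e1 : be * - be = - be ^+ 2 by ring.
have e2 : be / - be = - 1 by rewrite invrN mulrN divff.
rewrite e1 e2 in h1; rewrite !thEN !thON in h1 h2.
apply: (mulfI (expf_neq0 2 Q_neq0)).
rewrite !ha // sqrrN thEN thON.
transitivity (th (be ^+ 2) * (Q ^+ 2 * (th (- be ^+ 2) * th (- 1))) *
  (th (t ^+ 2) * (c1 * thE t + c2 * thO t))); first by ring.
rewrite h1.
transitivity (th (t ^+ 2) * ((Q ^+ 2 * (th (- be * t) * th (- be / t))) *
  (th (be ^+ 2) * (c1 * thE be + c2 * thO be)) +
  (Q ^+ 2 * (th (be * t) * th (be / t))) *
  (th (be ^+ 2) * (c1 * thE be + c2 * - thO be)))); last by ring.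
rewrite h2 h3; ring.
Qed.

(** The contribution of one monomial s^n of the kernel: the sum over k of s^n t^(6k) u^(6 k^2) at s
    = t q^k. *)
Definition gsum6 (n : int) t := t ^ n * gauss (u ^+ 6) (t ^+ 6 * q ^ n).

Let u61 : `|u ^+ 6| < 1. Proof. by rewrite normrX exprn_ilt1. Qed.
Let u60 : u ^+ 6 != 0. Proof. by rewrite expf_neq0. Qed.

Lemma gsum6_shift (m r : int) t : t != 0 ->
  gsum6 (6 * m + r) t = (u ^+ 6) ^ (- (m ^+ 2)) * q ^ (- (r * m)) * gsum6 r t.
Proof.
move=> t0; rewrite /gsum6.
have -> : t ^+ 6 * q ^ (6 * m + r) = (u ^+ 6) ^ (2 * m) * (t ^+ 6 * q ^ r).
  rewrite expfzDr // mulrCA; congr (_ * (_ * _)).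
  by rewrite !exprnP !exprz_exp; congr (_ ^ _); ring.
rewrite gauss_shift ?mulf_neq0 ?expf_neq0 ?expfz_neq0 // [(t ^+ 6 * _) ^ _]expfzMl.
rewrite expfzDr // exprz_exp mulrN.
have -> : t ^ (6 * m) = (t ^+ 6) ^ m by rewrite exprnP exprz_exp.
have e : (t ^+ 6) ^ m * (t ^+ 6) ^ (- m) = 1 by rewrite -expfzDr ?expf_neq0 // subrr.
set g := gauss _ _; set A := _ ^ (- m ^+ 2); set B := q ^ _; set T := t ^ r.
transitivity ((t ^+ 6) ^ m * (t ^+ 6) ^ (- m) * (A * B * (T * g))); first by ring.
by rewrite e mul1r.
Qed.

Let p0 := gauss (u ^+ 3) (- u).

Lemma p0_neq0 : p0 != 0.
Proof.
have u3 : `|u ^+ 3| < 1 by rewrite normrX exprn_ilt1.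
have small m : `|u ^+ m.+1| < 1 by rewrite normrX exprn_ilt1.
rewrite /p0 triple_product ?expf_neq0 ?oppr_eq0 //.
have -> : - (u ^+ 3 * - u) = u ^+ 4 by ring.
have -> : - (u ^+ 3 / - u) = u ^+ 2 by rewrite invrN; field.
have -> : u ^+ 3 ^+ 2 = u ^+ 6 by rewrite -exprM.
by rewrite !mulf_neq0 // qpoch_inf_neq0_small.
Qed.

(** The quintuple product at t, divided by its nonzero constant [p0]. *)
Lemma gsum6_diff1 t : t != 0 ->
  t * (gsum6 1 t - gsum6 (- 1) t) = th (t ^+ 2) * (- (Q / p0) * thE t).
Proof.
move=> t0; have := gauss_quintuple u1 u0 t0.
rewrite gauss_theta ?expf_neq0 // -/p0 -/(thE t) => h.
rewrite /gsum6 expr1z exprN1 !expr1z exprN1.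
have -> : t * (t * gauss (u ^+ 6) (t ^+ 6 * q) - t^-1 * gauss (u ^+ 6) (t ^+ 6 / q)) =
  - (p0^-1 * (p0 * (gauss (u ^+ 6) (t ^+ 6 / q) - t ^+ 2 * gauss (u ^+ 6) (t ^+ 6 * q)))).
  by rewrite mulKf ?p0_neq0 //; field.
rewrite -h; ring.
Qed.

(** The quintuple product at t u: the argument q t^2 of [th] is shifted back to t^2, and the other
    factor becomes [thO] instead of [thE]. *)
Lemma gsum6_diff2 t : t != 0 ->
  t * (gsum6 2 t - gsum6 (- 2) t) = th (t ^+ 2) * (- (Q / p0) * thO t).
Proof.
move=> t0; have tu0 : t * u != 0 by rewrite mulf_neq0.
have := gauss_quintuple u1 u0 tu0.
have e1 : (t * u) ^+ 2 = q * t ^+ 2 by ring.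
rewrite gauss_theta ?expf_neq0 // -/p0 e1 qtheta_shift ?expf_neq0 //.
have -> : (t * u) ^+ 6 / q = t ^+ 6 * q ^+ 2 by field.
have -> : (t * u) ^+ 6 * q = (u ^+ 6) ^+ 2 * (t ^+ 6 / q ^+ 2) by field.
rewrite gauss_shift1 ?mulf_neq0 ?invr_eq0 ?expf_neq0 // => h.
have e2 : q ^ (- 2) = (q ^+ 2)^-1 by rewrite -invr_expz.
have e3 : t ^ (- 2) = (t ^+ 2)^-1 by rewrite -invr_expz.
rewrite /gsum6 e2 e3 -!exprnP /thO.
set g1 := gauss (u ^+ 6) (t ^+ 6 * q ^+ 2) in h *.
set g2 := gauss (u ^+ 6) (t ^+ 6 / q ^+ 2) in h *.
transitivity (t ^+ 3 * p0^-1 * (p0 *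
  (g1 - q * t ^+ 2 * ((u ^+ 6)^-1 * (t ^+ 6 / q ^+ 2)^-1 * g2)))).
  by rewrite -mulrA mulKf ?p0_neq0 //; field; rewrite u0 t0.
rewrite -h; field; by rewrite p0_neq0 t0.
Qed.

Lemma antisym6D a b : antisym6 a -> antisym6 b -> antisym6 (fun t => a t + b t).
Proof.
move=> [c1 [c2 ha]] [d1 [d2 hb]]; exists (c1 + d1), (c2 + d2) => t t0.
by rewrite ha // hb //; ring.
Qed.

Lemma antisym6Z c a : antisym6 a -> antisym6 (fun t => c * a t).
Proof.
move=> [c1 [c2 ha]]; exists (c * c1), (c * c2) => t t0; rewrite ha //; ring.
Qed.

Lemma eq_antisym6 a b : (forall t, t != 0 -> a t = b t) -> antisym6 b -> antisym6 a.
Proof. by move=> ab [c1 [c2 hb]]; exists c1, c2 => t t0; rewrite ab // hb. Qed.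

Lemma antisym6_0 : antisym6 (fun=> 0).
Proof. by exists 0, 0 => t _; rewrite !mul0r addr0 mulr0. Qed.

(** The shifts by 6 m of n and by - 6 m of - n have the same constant, so n may be reduced modulo 6;
    residues 4 and 5 are - 2 and - 1, which only change the sign. *)
Lemma antisym6_gsum6 n : antisym6 (fun t => t * (gsum6 n t - gsum6 (- n) t)).
Proof.
have red (m r : int) : antisym6 (fun t => t * (gsum6 r t - gsum6 (- r) t)) ->
    antisym6 (fun t => t * (gsum6 (6 * m + r) t - gsum6 (- (6 * m + r)) t)).
  move=> h; apply: eq_antisym6 (antisym6Z ((u ^+ 6) ^ (- (m ^+ 2)) * q ^ (- (r * m))) h).
  move=> t t0; rewrite gsum6_shift //.
  have -> : - (6 * m + r) = 6 * - m + - r by ring.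
  by rewrite gsum6_shift // sqrrN mulrNN; ring.
have neg r : antisym6 (fun t => t * (gsum6 r t - gsum6 (- r) t)) ->
    antisym6 (fun t => t * (gsum6 (- r) t - gsum6 (- (- r)) t)).
  move=> h; apply: eq_antisym6 (antisym6Z (- 1) h) => t t0; rewrite opprK; ring.
have a1 : antisym6 (fun t => t * (gsum6 1 t - gsum6 (- 1) t)).
  by exists (- (Q / p0)), 0 => t t0; rewrite gsum6_diff1 // mul0r addr0.
have a2 : antisym6 (fun t => t * (gsum6 2 t - gsum6 (- 2) t)).
  by exists 0, (- (Q / p0)) => t t0; rewrite gsum6_diff2 // mul0r add0r.
have a0 : antisym6 (fun t => t * (gsum6 0 t - gsum6 (- 0) t)).
  by apply: eq_antisym6 antisym6_0 => t t0; rewrite oppr0 subrr mulr0.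
(* Here 3 = 6 - 3, and the constant of the shift is u^-6 q^3 = 1. *)
have a3 : antisym6 (fun t => t * (gsum6 3 t - gsum6 (- 3) t)).
  apply: eq_antisym6 antisym6_0 => t t0.
  rewrite [gsum6 3 t](_ : _ = gsum6 (6 * 1 + - 3) t) // gsum6_shift // mulr1 opprK expr1n.
  have -> : (u ^+ 6) ^ (- 1) * q ^ 3%:Z = 1.
    by rewrite exprN1 -exprnP -exprM mulVf.
  by rewrite mul1r subrr mulr0.
rewrite (divz_eq n 6) [(_ %/ _)%Z * _]mulrC.
have : 0 <= (n %% 6)%Z < 6 by rewrite modz_ge0 //= ltz_pmod.
have mP : (n %% 6)%Z = `|(n %% 6)%Z|%N by rewrite gez0_abs // modz_ge0.
rewrite mP ltz_nat /=; move: (n %/ 6)%Z `|_|%N => m r r6.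
have : r \in iota 0 6 by rewrite mem_iota.
rewrite !inE => /or4P[|||/or3P[]] /eqP ->.
- exact: (red m 0).
- exact: (red m 1).
- exact: (red m 2).
- exact: (red m 3).
- have -> : 6 * m + 4%:Z = 6 * (m + 1) + - 2 by ring.
  exact: (red (m + 1) (- 2) (neg _ a2)).
- have -> : 6 * m + 5%:Z = 6 * (m + 1) + - 1 by ring.
  exact: (red (m + 1) (- 1) (neg _ a1)).
Qed.

End ThetaIdentities.

(** * Antisymmetric kernels *)

Section Laurent.
Variable K : fieldType.
Implicit Types (H : K -> K) (s : K).

Definition laurent H := exists l : seq (K * int),
  forall s, s != 0 -> H s = \sum_(p <- l) p.1 * s ^ p.2.

Lemma laurent_mono (c : K) (n : int) : laurent (fun s => c * s ^ n).
Proof. by exists [:: (c, n)] => s s0; rewrite big_seq1. Qed.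

Lemma eq_laurent H H' : (forall s, s != 0 -> H s = H' s) -> laurent H' -> laurent H.
Proof. by move=> e [l hl]; exists l => s s0; rewrite e // hl. Qed.

Lemma laurentD H H' : laurent H -> laurent H' -> laurent (fun s => H s + H' s).
Proof.
by move=> [l hl] [m hm]; exists (l ++ m) => s s0; rewrite big_cat /= hl // hm.
Qed.

Lemma laurentM H H' : laurent H -> laurent H' -> laurent (fun s => H s * H' s).
Proof.
move=> [l hl] [m hm]; exists [seq (p.1 * r.1, p.2 + r.2) | p <- l, r <- m] => s s0.
rewrite big_allpairs_dep hl // hm // mulr_suml; apply: eq_bigr => p _.
rewrite mulr_sumr; apply: eq_bigr => r _ /=; rewrite expfzDr //; ring.
Qed.

Lemma laurent_prod (I : Type) (r : seq I) (F : I -> K -> K) :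
  (forall i, laurent (F i)) -> laurent (fun s => \prod_(i <- r) F i s).
Proof.
move=> h; elim: r => [|i r ih].
  apply: eq_laurent (laurent_mono 1 0) => s _; by rewrite big_nil expr0z mulr1.
apply: (eq_laurent (H' := fun s => F i s * \prod_(j <- r) F j s)); last exact: laurentM.
by move=> s _; rewrite big_cons.
Qed.
End Laurent.

Section Kernel.
Variable C : sumCompleteFieldType.
Variable u : C.
Hypotheses (u0 : u != 0) (u1 : `|u| < 1).
Local Notation q := (u ^+ 2).

Let q0 : q != 0. Proof. by rewrite expf_neq0. Qed.
Let q1 : `|q| < 1. Proof. exact: norm_sq_lt1. Qed.

(* Truncation of the general term of an 8Psi8, up to normalization, at s = t q^k *)
Definition wp_kernel_partial (xs : seq C) (N : nat) (s : C) : C :=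
  (s^-1 - s) * \prod_(x <- xs) (qpoch_partial (q * s / x) q N * qpoch_partial (q / (s * x)) q N).

Definition gaussian_term (H : C -> C) (t : C) (k : int) : C :=
  H (t * q ^ k) * t ^ (6 * k) * (u ^+ 6) ^ (k ^+ 2).

Lemma laurent_kernel xs N : laurent (wp_kernel_partial xs N).
Proof.
have lin (c : C) : laurent (fun s => 1 - c * s).
  apply: eq_laurent (laurentD (laurent_mono 1 0) (laurent_mono (- c) 1)) => s _.
  by rewrite expr0z expr1z mulr1 mulNr.
have inv (c : C) : laurent (fun s => 1 - c / s).
  apply: eq_laurent (laurentD (laurent_mono 1 0) (laurent_mono (- c) (- 1))) => s _.
  by rewrite expr0z exprN1 mulr1 mulNr.
apply: laurentM.
  apply: eq_laurent (laurentD (laurent_mono 1 (- 1)) (laurent_mono (- 1) 1)) => s _.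
  by rewrite expr1z exprN1 mul1r mulN1r.
apply: laurent_prod => x; apply: laurentM; apply: laurent_prod => i.
  apply: eq_laurent (lin (q / x * q ^+ i)) => s _; ring.
apply: eq_laurent (inv (q / x * q ^+ i)) => s _; rewrite invfM; ring.
Qed.

Lemma wp_kernel_antisym xs N s : wp_kernel_partial xs N s^-1 = - wp_kernel_partial xs N s.
Proof.
rewrite /wp_kernel_partial invrK -mulNr opprB; congr (_ * _); apply: eq_bigr => x _.
have -> : q * s^-1 / x = q / (s * x) by rewrite invfM mulrA.
have -> : q / (s^-1 * x) = q * s / x by rewrite invfM invrK mulrA.
by rewrite mulrC.
Qed.

Let u61 : `|u ^+ 6| < 1. Proof. by rewrite normrX exprn_ilt1. Qed.

(** Writing H(s) = (H(s) - H(1/s)) / 2 pairs each monomial s^n with s^-n directly, without comparing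
    coefficients of the polynomial. *)
Lemma antisym6_laurent H : laurent H -> (forall s, s != 0 -> H s^-1 = - H s) ->
  antisym6 u (fun t => t * isum (gaussian_term H t)).
Proof.
move=> [l hl] ha.
have c2 : (2 : C) != 0 by rewrite pnatr_eq0.
have E t k : t != 0 -> gaussian_term H t k = \sum_(p <- l)
    ((p.1 / 2) * (t ^ p.2 * ((u ^+ 6) ^ (k ^+ 2) * (t ^+ 6 * q ^ p.2) ^ k)) -
     (p.1 / 2) * (t ^ (- p.2) * ((u ^+ 6) ^ (k ^+ 2) * (t ^+ 6 * q ^ (- p.2)) ^ k))).
  move=> t0; set s := t * q ^ k.
  have s0 : s != 0 by rewrite mulf_neq0 ?expfz_neq0.
  have -> : gaussian_term H t k = (H s - H s^-1) / 2 * t ^ (6 * k) * (u ^+ 6) ^ (k ^+ 2).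
    by rewrite /gaussian_term -/s ha //; field.
  rewrite !hl ?invr_eq0 // -sumrB !mulr_suml; apply: eq_bigr => p _.
  rewrite exprz_inv /s !(expfzMl t (q ^ k)) !(expfzMl (t ^+ 6)) !exprz_exp.
  have -> : (t ^+ 6) ^ k = t ^ (6 * k) by rewrite exprnP exprz_exp.
  have -> : k * p.2 = p.2 * k by rewrite mulrC.
  have -> : k * - p.2 = - p.2 * k by rewrite mulrC.
  ring.
have abs t n : absum (fun k => (u ^+ 6) ^ (k ^+ 2) * (t ^+ 6 * q ^ n) ^ k) by exact: absum_gauss.
have abs2 t n (c : C) : absum (fun k => c * (t ^ n * ((u ^+ 6) ^ (k ^+ 2) * (t ^+ 6 * q ^ n) ^ k))).
  by do 2 apply: absumZ.
pose T (p : C * int) t := (p.1 / 2) * (t * (gsum6 u p.2 t - gsum6 u (- p.2) t)).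
apply: (eq_antisym6 (b := fun t => \sum_(p <- l) T p t)).
  move=> t t0; rewrite (eq_isum (fun k => E t k t0)).
  rewrite (isum_sum _ (F := fun p k => p.1 / 2 *
      (t ^ p.2 * ((u ^+ 6) ^ (k ^+ 2) * (t ^+ 6 * q ^ p.2) ^ k)) -
     p.1 / 2 * (t ^ (- p.2) * ((u ^+ 6) ^ (k ^+ 2) * (t ^+ 6 * q ^ (- p.2)) ^ k)))); last first.
    move=> p; apply: absumD; first exact: abs2.
    by under eq_fun do rewrite -mulNr; exact: abs2.
  rewrite mulr_sumr; apply: eq_bigr => p _; rewrite isumB; [|exact: abs2|exact: abs2].
  rewrite !isumZ; try by [exact: abs|exact: absumZ]; rewrite /T /gsum6 /gauss; ring.
elim: l {hl E} => [|p l ih].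
  by apply: eq_antisym6 (antisym6_0 u) => t _; rewrite big_nil.
apply: eq_antisym6 (antisym6D (antisym6Z (p.1 / 2) (antisym6_gsum6 u0 u1 p.2)) ih) => t _.
by rewrite big_cons.
Qed.

End Kernel.

(** * Uniform bounds for the general term *)

Section Domination.
Variable C : sumCompleteFieldType.
Variable u : C.
Hypotheses (u0 : u != 0) (u1 : `|u| < 1).
Local Notation q := (u ^+ 2).
Local Notation p := `|q|.

Let q0 : q != 0. Proof. by rewrite expf_neq0. Qed.
Let q1 : `|q| < 1. Proof. exact: norm_sq_lt1. Qed.
Let p0 : p != 0. Proof. by rewrite normr_eq0. Qed.

Definition in_annulus (R z : C) := [&& z != 0, `|z| <= R & `|z^-1| <= R].

Lemma in_annulus_inv R z : in_annulus R z -> in_annulus R z^-1.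
Proof. by case/and3P => z0 h1 h2; apply/and3P; rewrite invr_eq0 invrK. Qed.

Lemma in_annulus_le R R' z : R <= R' -> in_annulus R z -> in_annulus R' z.
Proof.
by move=> RR /and3P[z0 h1 h2]; apply/and3P; split=> //; exact: le_trans RR.
Qed.

Lemma in_annulus_exists (s : seq C) : (forall z, z \in s -> z != 0) ->
  exists2 R : C, 0 <= R & forall z, z \in s -> in_annulus R z.
Proof.
elim: s => [|z s ih] h; first by exists 0.
have [R R0 hR] : exists2 R : C, 0 <= R & forall z, z \in s -> in_annulus R z.
  by apply: ih => y ys; apply: h; rewrite inE ys orbT.
exists (R + `|z| + `|z^-1|); first by rewrite !addr_ge0.
move=> y; rewrite inE => /orP[/eqP ->|ys].
  apply/and3P; split; first by apply: h; rewrite inE eqxx.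
    by rewrite addrAC lerDr addr_ge0.
  by rewrite lerDr addr_ge0.
by apply: in_annulus_le (hR y ys); rewrite -addrA lerDl addr_ge0.
Qed.

(** |q|^(k(k-1)/2), as a product so that no exponent is halved. *)
Definition tri_prod (k : nat) : C := \prod_(0 <= i < k) p ^+ i.

Lemma tri_prod_ge0 k : 0 <= tri_prod k.
Proof. by apply: prodr_ge0 => i _; rewrite exprn_ge0. Qed.

Lemma tri_prod_sqr k : tri_prod k ^+ 2 * p ^+ k = p ^+ (k ^ 2).
Proof.
elim: k => [|k ih]; first by rewrite /tri_prod big_geq // expr1n mulr1.
rewrite /tri_prod big_nat_recr //= -/(tri_prod k) exprMn.
have -> : (k.+1 ^ 2 = k ^ 2 + (k + k.+1))%N by rewrite -!mulnn; lia.
by rewrite !exprD -ih !exprS; ring.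
Qed.

(** Read backwards, the factors are 1 + r p^-i; the i-th factor p^i of [tri_prod] turns this into
    p^i + r = r (1 + p^i / r), whose product is controlled in k. *)
Lemma prod_reverse_bound (r : C) k : r != 0 ->
  \prod_(0 <= i < k) (1 + r * (p / p ^+ k) * p ^+ i) * tri_prod k =
  r ^+ k * \prod_(0 <= i < k) (1 + r^-1 * p ^+ i).
Proof.
move=> r0; rewrite big_nat_rev /= add0n /tri_prod -big_split /=.
have -> : r ^+ k = \prod_(0 <= i < k) r by rewrite big_mkord prodr_const card_ord.
rewrite -big_split /= big_nat [RHS]big_nat; apply: eq_bigr => i /andP[_ ik].
have -> : p ^+ k = p * p ^+ (k - i.+1) * p ^+ i.
  by rewrite -exprS -exprD; congr (_ ^+ _); lia.
by field; rewrite r0 !expf_neq0 // p0.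
Qed.

(** At s = t q^k with k >= 0 the product in s is bounded, while the one in 1/s grows like |1 / (t
    x)|^k |q|^(-k(k-1)/2), which [tri_prod k] compensates. The constant depends on the annulus only,
    as both limits, in N and in the parameters, require. *)
Lemma wp_kernel_factor_bound R : 0 <= R -> exists2 M : C, 0 <= M &
  forall x t N k, in_annulus R x -> in_annulus R t ->
  `|qpoch_partial (q * (t * q ^+ k) / x) q N * qpoch_partial (q / ((t * q ^+ k) * x)) q N| *
    tri_prod k <= M * `|(t * x)^-1| ^+ k.
Proof.
move=> R0; have R20 : 0 <= R * R by rewrite mulr_ge0.
have [M1 M10 hM1] := qpoch_partial_bounded q1 R20.
have p01 : 0 <= p < 1 by rewrite normr_ge0.
have [B hB] := prod_1D_bounded p01 R20.
have B0 : 0 <= B by apply: le_trans (hB 0%N); rewrite big_geq.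
exists (M1 * B * B); first by rewrite !mulr_ge0 // ltW.
move=> x t N k /and3P[x0 x1 xi] /and3P[t0 t1 ti].
set r := `|(t * x)^-1|.
have tx0 : t * x != 0 by rewrite mulf_neq0.
have r0 : r != 0 by rewrite normr_eq0 invr_eq0.
have rge : 0 <= r by exact: normr_ge0.
have rR : r <= R * R by rewrite /r invfM normrM ler_pM.
have riR : r^-1 <= R * R by rewrite /r normfV invrK normrM ler_pM.
have le1 (a b : C) m : 0 <= a -> a <= b ->
    \prod_(0 <= i < m) (1 + a * p ^+ i) <= \prod_(0 <= i < m) (1 + b * p ^+ i).
  move=> a0 ab; apply: ler_prod => i _; rewrite addr_ge0 ?mulr_ge0 ?exprn_ge0 //=.
  by rewrite lerD2l ler_wpM2r // exprn_ge0.
have b1 : `|qpoch_partial (q * (t * q ^+ k) / x) q N| <= M1.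
  apply: hM1; have -> : q * (t * q ^+ k) / x = q ^+ k.+1 * (t * x^-1) by rewrite [q ^+ k.+1]exprS; ring.
  rewrite normrM -[X in _ <= X]mul1r ler_pM //; first by rewrite normrX exprn_ile1 // ltW.
  by rewrite normrM ler_pM.
have b2 : `|qpoch_partial (q / ((t * q ^+ k) * x)) q N| * tri_prod k <= B * B * r ^+ k.
  have argE : `|q / ((t * q ^+ k) * x)| = r * (p / p ^+ k).
    have -> : q / ((t * q ^+ k) * x) = (t * x)^-1 * (q / q ^+ k).
      by field; rewrite x0 t0 !expf_neq0.
    by rewrite (normrM _ (q / q ^+ k)) (normrM q) (normfV (q ^+ k)) (normrX k q).
  have arg0 : 0 <= r * (p / p ^+ k) by rewrite -argE.
  (* Further factors, all at least 1, are added so that the product can be split at k whatever the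
     size of N. *)
  apply: (@le_trans _ _ (\prod_(0 <= i < k + N) (1 + r * (p / p ^+ k) * p ^+ i) * tri_prod k)).
    apply: ler_wpM2r; first exact: tri_prod_ge0.
    apply: le_trans (qpoch_partial_norm q N (lexx _)) _; rewrite argE.
    rewrite [X in _ <= X](big_cat_nat (n := N)) ?leq_addl //= ler_peMr //.
      by apply: prodr_ge0 => i _; rewrite addr_ge0 // mulr_ge0 // exprn_ge0.
    apply: (big_ind (fun y => 1 <= y)) => // [y z|i _]; first exact: mulr_ege1.
    by rewrite lerDl mulr_ge0 // exprn_ge0.
  rewrite (big_cat_nat (n := k)) ?leq_addr //= mulrAC prod_reverse_bound //.
  have -> : \prod_(k <= i < k + N) (1 + r * (p / p ^+ k) * p ^+ i) =
      \prod_(0 <= i < N) (1 + r * p * p ^+ i).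
    rewrite -{1}[k]add0n big_addn addKn; apply: eq_bigr => i _.
    by rewrite exprD; field; rewrite expf_neq0.
  set A := \prod_(_ <= _ < k) _; set A' := \prod_(_ <= _ < N) _.
  have -> : r ^+ k * A * A' = A * A' * r ^+ k by ring.
  apply: ler_wpM2r; first by rewrite exprn_ge0 // normr_ge0.
  apply: ler_pM.
  - by apply: prodr_ge0 => i _; rewrite addr_ge0 // mulr_ge0 ?exprn_ge0 // invr_ge0.
  - by apply: prodr_ge0 => i _; rewrite addr_ge0 // !mulr_ge0 ?exprn_ge0.
  - by apply: le_trans (hB k); apply: le1 => //; rewrite invr_ge0.
  - apply: le_trans (hB N); apply: le1; first by rewrite mulr_ge0.
    by apply: le_trans rR; rewrite ler_piMr // ltW.
have -> : M1 * B * B * r ^+ k = M1 * (B * B * r ^+ k) by ring.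
rewrite normrM -[X in X <= _]mulrA; apply: ler_pM => //.
by apply: mulr_ge0; [exact: normr_ge0|exact: tri_prod_ge0].
Qed.

(** The six kernel factors consume |q|^(3k(k-1)) of the Gaussian |q|^(3k^2). Of the remaining
    |q|^(3k), one |q|^k absorbs the growth of 1/s - s and the other two enter the ratio; the powers
    of t cancel. *)
Lemma gaussian_term_bound_nat R : 0 <= R -> exists2 M : C, 0 <= M &
  forall xs t N (k : nat), size xs = 6 -> in_annulus R t -> (forall x, x \in xs -> in_annulus R x) ->
  `|gaussian_term u (wp_kernel_partial u xs N) t k| <=
    M * (p ^+ 2 / \prod_(x <- xs) `|x|) ^+ k.
Proof.
move=> R0; have [M M0 hM] := wp_kernel_factor_bound R0.
exists ((R + R) * M ^+ 6); first by rewrite mulr_ge0 ?exprn_ge0 ?addr_ge0.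
move=> xs t N k sz ht hx; have [/and3P[t0 t1 ti]] := ht.
rewrite /gaussian_term /wp_kernel_partial -exprnP.
set s := t * q ^+ k.
set P := \prod_(x <- xs) (qpoch_partial _ _ _ * _).
have hP : `|P| * tri_prod k ^+ 6 <= M ^+ 6 * (`|t| ^- 6 / \prod_(x <- xs) `|x|) ^+ k.
  have cst (c : C) : c ^+ 6 = \prod_(x <- xs) c.
    by rewrite big_const_seq count_predT sz /= !exprS expr0.
  rewrite /P normr_prod (cst M) (cst (tri_prod k)) -big_split /=.
  have -> : \prod_(x <- xs) M * (`|t| ^- 6 / \prod_(x <- xs) `|x|) ^+ k =
      \prod_(x <- xs) (M * `|(t * x)^-1| ^+ k).
    rewrite big_split /= prodrXl; congr (_ * _ ^+ k).
    under [RHS]eq_bigr do rewrite invfM normrM !normfV.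
    by rewrite big_split /= -cst exprVn prodfV.
  rewrite [X in X <= _]big_seq [X in _ <= X]big_seq; apply: ler_prod => x xx.
  rewrite mulr_ge0 ?normr_ge0 ?tri_prod_ge0 //=.
  by apply: hM => //; exact: hx.
have X0 : \prod_(x <- xs) `|x| != 0.
  by rewrite prodf_seq_neq0; apply/allP => x /hx /and3P[x0 _ _]; rewrite normr_eq0.
have hs : `|s^-1 - s| * p ^+ k <= R + R.
  have nq : p ^+ k <= 1 by rewrite exprn_ile1 // ltW.
  apply: (@le_trans _ _ ((`|s^-1| + `|s|) * p ^+ k)).
    by rewrite ler_wpM2r ?exprn_ge0 // ler_normB.
  rewrite mulrDl; apply: lerD.
    rewrite /s invfM normrM !normfV normrX -mulrA mulVf ?mulr1 ?expf_neq0 //.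
    by rewrite -normfV.
  rewrite /s normrM normrX -mulrA -[X in _ <= X]mulr1.
  by apply: ler_pM; rewrite ?mulr_ge0 ?mulr_ile1 ?exprn_ge0.
have -> : `|(s^-1 - s) * P * t ^ (6 * k%:Z) * (u ^+ 6) ^ (k%:Z ^+ 2)| =
    `|s^-1 - s| * p ^+ k * (`|P| * tri_prod k ^+ 6) * (`|t| ^+ 6 * p ^+ 2) ^+ k.
  have -> : t ^ (6 * k%:Z) = (t ^+ 6) ^+ k by rewrite exprnP exprnP exprz_exp.
  have -> : (u ^+ 6) ^ (k%:Z ^+ 2) = (q ^+ (k ^ 2)) ^+ 3.
    have -> : k%:Z ^+ 2 = (k ^ 2)%N by rewrite expr2 -PoszM mulnn.
    by rewrite -exprnP [RHS]exprAC -[q ^+ 3]exprM.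
  rewrite !(normrM _ (_ ^+ _)) (normrM _ P) (normrX k (t ^+ 6)) (normrX 6 t).
  rewrite (normrX 3) (normrX (k ^ 2) q) -tri_prod_sqr (exprMn k (`|t| ^+ 6)).
  by rewrite (exprAC _ 2); ring.
have -> : (R + R) * M ^+ 6 * (p ^+ 2 / \prod_(x <- xs) `|x|) ^+ k =
    (R + R) * (M ^+ 6 * (`|t| ^- 6 / \prod_(x <- xs) `|x|) ^+ k) * (`|t| ^+ 6 * p ^+ 2) ^+ k.
  have -> : p ^+ 2 / \prod_(x <- xs) `|x| =
      `|t| ^- 6 / \prod_(x <- xs) `|x| * (`|t| ^+ 6 * p ^+ 2).
    by field; rewrite X0 normr_eq0 t0.
  by rewrite (exprMn k (_ / _)); ring.
apply: ler_wpM2r; first by rewrite exprn_ge0 // mulr_ge0 ?exprn_ge0.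
by apply: ler_pM => //; rewrite mulr_ge0 ?exprn_ge0 ?tri_prod_ge0.
Qed.

End Domination.

(** * The normalized bilateral sum and its interpolation *)

Section PsiSum.
Variable C : sumCompleteFieldType.
Variable u : C.
Hypotheses (u0 : u != 0) (u1 : `|u| < 1).
Local Notation q := (u ^+ 2).
Local Notation p := `|q|.
Local Notation th := (fun x => qtheta x q).

Let q0 : q != 0. Proof. by rewrite expf_neq0. Qed.
Let q1 : `|q| < 1. Proof. exact: norm_sq_lt1. Qed.

Definition wp_kernel (xs : seq C) (s : C) : C :=
  (s^-1 - s) * \prod_(x <- xs) (qpoch_inf (q * s / x) q * qpoch_inf (q / (s * x)) q).

Definition psi_sum (xs : seq C) (t : C) : C := t * isum (gaussian_term u (wp_kernel xs) t).

(** The ratio of the geometric majorant, in both directions of summation. For the parameters of the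
    theorem it is |b^2 / a|, so the hypothesis on b makes it less than 1. *)
Definition psi_ratio (xs : seq C) : C := p ^+ 2 / \prod_(x <- xs) `|x|.

(** Antisymmetry exchanges k and - k at the price of t -> 1/t, under which an annulus is stable;
    bounds for k >= 0 thus cover all k. *)
Lemma gaussian_term_opp H t (k : int) : t != 0 -> (forall s, s != 0 -> H s^-1 = - H s) ->
  gaussian_term u H t (- k) = - gaussian_term u H t^-1 k.
Proof.
move=> t0 ha; rewrite /gaussian_term sqrrN -!mulNr -ha; last first.
  by rewrite mulf_neq0 ?invr_eq0 ?expfz_neq0.
congr (_ * _ * _); last by rewrite mulrN exprz_inv.
by rewrite invfM invrK invr_expz.
Qed.

Lemma gaussian_term_bound R : 0 <= R -> exists2 M : C, 0 <= M &
  forall xs t N (k : int), size xs = 6 -> in_annulus R t -> (forall x, x \in xs -> in_annulus R x) ->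
  `|gaussian_term u (wp_kernel_partial u xs N) t k| <= M * psi_ratio xs ^+ `|k|%N.
Proof.
move=> R0; have [M M0 hM] := gaussian_term_bound_nat u0 u1 R0.
exists M => // xs t N k sz ht hx; have [t0 _ _] := and3P ht.
case: (intP k) => [|n|n].
- exact: (hM xs t N 0%N).
- exact: (hM xs t N n.+1).
- rewrite gaussian_term_opp // => [|s _]; last exact: wp_kernel_antisym.
  by rewrite normrN abszN; apply: hM => //; exact: in_annulus_inv.
Qed.

Lemma wp_kernel_tends xs s : tends (fun N => wp_kernel_partial u xs N s) (wp_kernel xs s).
Proof.
apply: tendsM; first exact: tends_cst.
by apply: tends_prod => x; apply: tendsM; exact: qpoch_inf_cvg.
Qed.

Lemma gaussian_term_tends (H : nat -> C -> C) (H' : C -> C) t k :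
  (forall s, tends (fun N => H N s) (H' s)) ->
  tends (fun N => gaussian_term u (H N) t k) (gaussian_term u H' t k).
Proof.
by move=> h; apply: tendsM; [apply: tendsM => //|]; exact: tends_cst.
Qed.

Lemma gaussian_term_wp_kernel_bound R : 0 <= R -> exists2 M : C, 0 <= M &
  forall xs t (k : int), size xs = 6 -> in_annulus R t -> (forall x, x \in xs -> in_annulus R x) ->
  `|gaussian_term u (wp_kernel xs) t k| <= M * psi_ratio xs ^+ `|k|%N.
Proof.
move=> R0; have [M M0 hM] := gaussian_term_bound R0.
exists M => // xs t k sz ht hx.
apply: tends_norm_le (gaussian_term_tends t k (wp_kernel_tends xs)) => [|N]; last exact: hM.
by apply: le_trans (hM xs t 0%N k sz ht hx).
Qed.

Lemma psi_ratio_ge0 xs : 0 <= psi_ratio xs.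
Proof. by rewrite mulr_ge0 ?exprn_ge0 // invr_ge0 prodr_ge0. Qed.

Lemma absum_int_geometric_le (f : int -> C) (M r : C) : 0 <= M -> 0 <= r < 1 ->
  (forall k, `|f k| <= M * r ^+ `|k|%N) -> absum f.
Proof.
move=> M0 hr hf; apply: absum_le (absumZ M (absum_int_geometric hr)) => k.
have r0 : 0 <= r by case/andP: hr.
by apply: le_trans (hf k) _; rewrite [X in _ <= X]ger0_norm // mulr_ge0 // exprn_ge0.
Qed.

Section Fixed.
Variable xs : seq C.
Hypotheses (sz : size xs = 6) (xs0 : forall x, x \in xs -> x != 0) (ratio : psi_ratio xs < 1).

Lemma absum_psi t : t != 0 -> absum (gaussian_term u (wp_kernel xs) t).
Proof.
move=> t0; have [R R0 hR] : exists2 R : C, 0 <= R & forall z, z \in t :: xs -> in_annulus R z.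
  by apply: in_annulus_exists => z; rewrite inE => /orP[/eqP ->|/xs0].
have [M M0 hM] := gaussian_term_wp_kernel_bound R0.
apply: (absum_int_geometric_le M0 (r := psi_ratio xs)); first by rewrite psi_ratio_ge0.
move=> k; apply: hM => // [|x xx]; apply: hR; first by rewrite inE eqxx.
by rewrite inE xx orbT.
Qed.

Lemma psi_sum_tends t : t != 0 ->
  tends (fun N => t * isum (gaussian_term u (wp_kernel_partial u xs N) t)) (psi_sum xs t).
Proof.
move=> t0; have [R R0 hR] : exists2 R : C, 0 <= R & forall z, z \in t :: xs -> in_annulus R z.
  by apply: in_annulus_exists => z; rewrite inE => /orP[/eqP ->|/xs0].
have [M M0 hM] := gaussian_term_bound R0.
have ht : in_annulus R t by apply: hR; rewrite inE eqxx.
have hx x : x \in xs -> in_annulus R x by move=> xx; apply: hR; rewrite inE xx orbT.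
apply: tendsM; first exact: tends_cst.
have r01 : 0 <= psi_ratio xs < 1 by rewrite psi_ratio_ge0.
have ag := absumZ M (absum_int_geometric r01).
have [] // := tannery (f := fun N k => gaussian_term u (wp_kernel_partial u xs N) t k)
  (F := gaussian_term u (wp_kernel xs) t) ag.
  move=> N k; apply: le_trans (hM xs t N k sz ht hx) _.
  by rewrite [X in _ <= X]ger0_norm // mulr_ge0 // exprn_ge0 // psi_ratio_ge0.
by move=> k; apply: gaussian_term_tends => s; exact: wp_kernel_tends.
Qed.

(** The interpolation formula holds at every truncation, with coefficients independent of N, and
    only three sums have to converge. *)
Lemma psi_interpolation be t : be != 0 -> t != 0 ->
  th (be ^+ 2) * th (- be ^+ 2) * th (- 1) * psi_sum xs t =
  th (t ^+ 2) * (th (- (be * t)) * th (- (be / t)) * psi_sum xs be +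
                 th (be * t) * th (be / t) * psi_sum xs (- be)).
Proof.
move=> b0 t0; have nb0 : - be != 0 by rewrite oppr_eq0.
pose aN N t := t * isum (gaussian_term u (wp_kernel_partial u xs N) t).
have hN N : antisym6 u (aN N).
  apply: antisym6_laurent => //; first exact: laurent_kernel.
  by move=> s _; exact: wp_kernel_antisym.
have lhs := tendsM (tends_cst (th (be ^+ 2) * th (- be ^+ 2) * th (- 1))) (psi_sum_tends t0).
have rhs := tendsM (tends_cst (th (t ^+ 2))) (tendsD
  (tendsM (tends_cst (th (- (be * t)) * th (- (be / t)))) (psi_sum_tends b0))
  (tendsM (tends_cst (th (be * t) * th (be / t))) (psi_sum_tends nb0))).
apply: tends_unique lhs _.
have -> // : (fun N => th (be ^+ 2) * th (- be ^+ 2) * th (- 1) * aN N t) =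
  (fun N => th (t ^+ 2) * (th (- (be * t)) * th (- (be / t)) * aN N be +
                 th (be * t) * th (be / t) * aN N (- be))).
by apply: funext => N; exact: (antisym6_interpolation u0 u1 (hN N) b0 t0).
Qed.
End Fixed.

End PsiSum.

(** * The sum as a theta function of t *)

Section Evaluation.
Variable C : sumCompleteFieldType.
Variable u : C.
Hypotheses (u0 : u != 0) (u1 : `|u| < 1).
Local Notation q := (u ^+ 2).
Local Notation p := `|q|.
Local Notation th := (fun x => qtheta x q).
Local Notation pI := (fun x => qpoch_inf x q).

Let q0 : q != 0. Proof. by rewrite expf_neq0. Qed.
Let q1 : `|q| < 1. Proof. exact: norm_sq_lt1. Qed.

(** The parameters of an 8Psi8 of the theorem divided by t, with be = b/t, ga = c/t, de = d/t and
    t^2 = a. *)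
Definition whipple_params (be ga de : C) : seq C :=
  [:: be; - be; ga; de; q / (be ^+ 2 * ga); q / (be ^+ 2 * de)].

Definition qtri (k : nat) : C := \prod_(0 <= i < k) q ^+ i.

Lemma qtri_neq0 k : qtri k != 0.
Proof. by rewrite /qtri prodf_seq_neq0; apply/allP => i _; rewrite expf_neq0. Qed.

Lemma qtri_sqr k : qtri k ^+ 2 * q ^+ k = q ^+ (k ^ 2).
Proof.
elim: k => [|k ih]; first by rewrite /qtri big_geq // expr1n mulr1.
rewrite /qtri big_nat_recr //= -/(qtri k) exprMn.
have -> : (k.+1 ^ 2 = k ^ 2 + (k + k.+1))%N by rewrite -!mulnn; lia.
by rewrite !exprD -ih [q ^+ k.+1]exprS; ring.
Qed.

(** Each additional factor 1 - y q^-j is - y q^-j times a factor of (q/y; q)_k; the powers of q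
    collect to q^(k(k+1)/2), that is [qtri k * q ^+ k]. *)
Lemma qpoch_inf_down (y : C) k : y != 0 ->
  pI (y / q ^+ k) = (- y) ^+ k * qpoch_partial (q / y) q k * pI y / (qtri k * q ^+ k).
Proof.
move=> y0; have qk0 := expf_neq0 k q0.
rewrite (qpoch_inf_shift q1 _ k) divfK //.
suff <- : qpoch_partial (y / q ^+ k) q k * (qtri k * q ^+ k) =
    (- y) ^+ k * qpoch_partial (q / y) q k.
  by field; rewrite qk0 qtri_neq0.
have -> : q ^+ k = \prod_(0 <= i < k) q by rewrite big_mkord prodr_const card_ord.
have -> : (- y) ^+ k = \prod_(0 <= i < k) (- y) by rewrite big_mkord prodr_const card_ord.
rewrite /qpoch_partial big_nat_rev /= add0n /qtri -!big_split /=.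
rewrite big_nat [RHS]big_nat; apply: eq_bigr => i /andP[_ ik].
have -> : \prod_(0 <= j < k) q = q * q ^+ (k - i.+1) * q ^+ i.
  by rewrite big_mkord prodr_const card_ord -exprS -exprD; congr (_ ^+ _); lia.
by field; rewrite y0 !expf_neq0.
Qed.

Lemma theta_down (y : C) k : y != 0 -> pI (q / y / q ^+ k) * pI (y / q ^+ k) =
  qpoch_partial y q k * qpoch_partial (q / y) q k * th y * q ^+ k / (qtri k * q ^+ k) ^+ 2.
Proof.
move=> y0; set x := q ^+ k; rewrite /x !qpoch_inf_down ?mulf_neq0 ?invr_eq0 // -/x qthetaE.
have -> : q / (q / y) = y by field; rewrite u0 y0.
have -> : (- (q / y)) ^+ k = x / (- y) ^+ k.
  by rewrite /x -expr_div_n invrN mulrN.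
by field; rewrite qtri_neq0 !expf_neq0 ?oppr_eq0.
Qed.

Lemma qpoch_pair_down (y : C) k : y != 0 ->
  pI (y / q ^+ k) * pI (- (y / q ^+ k)) =
  (- y ^+ 2) ^+ k * qpoch_partial (q / y) q k * qpoch_partial (- (q / y)) q k *
  qpoch_inf (y ^+ 2) (q ^+ 2) / (qtri k * q ^+ k) ^+ 2.
Proof.
move=> y0; set x := q ^+ k; rewrite -mulNr /x !qpoch_inf_down ?oppr_eq0 // -/x -qpoch_inf_sqr //.
have -> : q / - y = - (q / y) by rewrite invrN mulrN.
have -> : (- y ^+ 2) ^+ k = (- y) ^+ k * (- - y) ^+ k.
  by rewrite -exprMn; congr (_ ^+ _); ring.
by field; rewrite qtri_neq0 !expf_neq0.
Qed.

Section Values.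
Variables be ga de : C.
Hypotheses (b0 : be != 0) (g0 : ga != 0) (d0 : de != 0) (b1 : `|be ^+ 2| < 1).

Let b20 : be ^+ 2 != 0. Proof. by rewrite expf_neq0. Qed.

Lemma wp_kernel_whipple s : s != 0 -> wp_kernel u (whipple_params be ga de) s =
  (s^-1 - s) * (pI (q * s / be) * pI (- (q * s / be)) * (pI (q / be / s) * pI (- (q / be / s))) *
  (pI (q * s / ga) * pI (be ^+ 2 * ga * s) * (pI (q * s / de) * pI (be ^+ 2 * de * s))) *
  (pI (q / ga / s) * pI (be ^+ 2 * ga / s) * (pI (q / de / s) * pI (be ^+ 2 * de / s)))).
Proof.
move=> s0; rewrite /wp_kernel !big_cons big_nil.
have e1 : q * s / - be = - (q * s / be) by rewrite invrN mulrN.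
have e2 x : q / (s * x) = q / x / s by rewrite invfM mulrA mulrAC.
have e3 : q / - be / s = - (q / be / s) by rewrite invrN mulrN mulNr.
have e4 x : x != 0 -> q * s / (q / (be ^+ 2 * x)) = be ^+ 2 * x * s.
  by move=> x0; field; rewrite u0 b0 x0.
have e5 x : x != 0 -> q / (q / (be ^+ 2 * x)) / s = be ^+ 2 * x / s.
  by move=> x0; field; rewrite u0 b0 x0 s0.
rewrite !e2 e1 e3 !e4 // !e5 //; ring.
Qed.

Definition whipple_const : C := qpoch_inf (q ^+ 2) (q ^+ 2) * qpoch_inf (q ^+ 2 / be ^+ 4) (q ^+ 2) *
  (th (be * ga) * th (be * de)).

(** At t = be the factor (q s / be; q)_oo of the kernel is (q^-k; q)_oo, which contains 1 - 1. *)
Lemma gaussian_term_neg k :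
  gaussian_term u (wp_kernel u (whipple_params be ga de)) be (Negz k) = 0.
Proof.
have z0 : be * q ^ (Negz k) != 0 by rewrite mulf_neq0 ?expfz_neq0.
rewrite /gaussian_term wp_kernel_whipple //.
have -> : q * (be * q ^ (Negz k)) / be = (q ^+ k)^-1.
  by rewrite NegzE -exprnN [q ^+ k.+1]exprS; field; rewrite b0 u0 expf_neq0.
rewrite (@qpoch_inf_eq0 _ q q1 (q ^+ k)^-1 k) ?mulVf ?subrr ?expf_neq0 //.
by rewrite !(mul0r, mulr0).
Qed.

(** The match with Whipple's sum is c = - be^2, a = be ga, d = - be de. The six products at negative
    powers of q leave [qtri k] to the power - 6, which the Gaussian cancels. *)
Lemma gaussian_term_pos (k : nat) :
  be * gaussian_term u (wp_kernel u (whipple_params be ga de)) be k =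
  whipple_const * (whipple_coef q (- be ^+ 2) (be * ga) (- (be * de)) k * (- be ^+ 2) ^+ k).
Proof.
set x := q ^+ k; have x0 : x != 0 by rewrite expf_neq0.
have s0 : be * x != 0 by rewrite mulf_neq0.
rewrite /gaussian_term -exprnP -/x wp_kernel_whipple //.
have e1 : q * (be * x) / be = q * x by field.
have e2 : q / be / (be * x) = q / be ^+ 2 / x by field; rewrite b0 x0.
have e3 (y : C) : y != 0 -> q / y / (be * x) = q / (be * y) / x.
  by move=> y0; field; rewrite x0 b0 y0.
have e4 (y : C) : be ^+ 2 * y / (be * x) = be * y / x by field; rewrite x0 b0.
rewrite e1 e2 !e3 // !e4.
have bg0 : be * ga != 0 by rewrite mulf_neq0.
have bd0 : be * de != 0 by rewrite mulf_neq0.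
have qb0 : q / be ^+ 2 != 0 by rewrite mulf_neq0 ?invr_eq0.
rewrite (qpoch_inf_sqr q1 (q * x)) /x (theta_down k bg0) (theta_down k bd0).
rewrite (qpoch_pair_down k qb0) -/x.
have -> : q / (q / be ^+ 2) = be ^+ 2 by field; rewrite u0 b0.
have -> : (q / be ^+ 2) ^+ 2 = q ^+ 2 / be ^+ 4 by field.
have f1 : (- (q ^+ 2 / be ^+ 4)) ^+ k = (- be ^+ 2) ^+ k * x ^+ 2 / (be ^+ k) ^+ 6.
  rewrite /x !(exprAC _ k) -exprMn -expr_div_n; congr (_ ^+ _); field; exact: b0.
have f2 : be ^ (6 * k%:Z) = (be ^+ k) ^+ 6 by rewrite exprAC exprnP exprnP exprz_exp.
have f3 : (u ^+ 6) ^ (k%:Z ^+ 2) = (qtri k ^+ 2 * x) ^+ 3.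
  rewrite /x qtri_sqr; have -> : k%:Z ^+ 2 = (k ^ 2)%N by rewrite expr2 -PoszM mulnn.
  by rewrite -exprnP [RHS]exprAC -[q ^+ 3]exprM.
have P20 : qpoch_inf (q ^+ 2) (q ^+ 2) != 0.
  by apply: qpoch_inf_neq0_small; exact: norm_sq_lt1.
have f4 : qpoch_inf ((q * x) ^+ 2) (q ^+ 2) =
    qpoch_inf (q ^+ 2) (q ^+ 2) / qpoch_partial (q ^+ 2) (q ^+ 2) k.
  have h := qpoch_inf_shift (norm_sq_lt1 q1) (q ^+ 2) k.
  have E : (q * x) ^+ 2 = q ^+ 2 * (q ^+ 2) ^+ k by rewrite exprMn /x [in RHS]exprAC.
  rewrite E h [RHS]mulrAC divff ?mul1r //.
  by apply: contraNneq P20 => z; rewrite h z mul0r.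
rewrite f1 f2 f3 f4 /whipple_coef /whipple_tail /whipple_const -/x !opprK.
have g1 : - (- be ^+ 2 * q * x / (be * ga)) = q * (be * x) / ga by field; rewrite b0 g0.
have g2 : - (be * ga * - be ^+ 2 * x) = be ^+ 2 * ga * (be * x) by ring.
have g3 : - be ^+ 2 * q * x / - (be * de) = q * (be * x) / de.
  by rewrite invrN; field; rewrite b0 d0.
have g4 : - be ^+ 2 * - (be * de) * x = be ^+ 2 * de * (be * x) by ring.
have g5 : - (q / - (be * de)) = q / (be * de) by rewrite invrN mulrN opprK.
rewrite g1 g2 g3 g4 g5.
move: (pI (q * (be * x) / ga)) (pI (be ^+ 2 * ga * (be * x))) (pI (q * (be * x) / de))
  (pI (be ^+ 2 * de * (be * x))) (th (be * ga)) (th (be * de)) => A1 A2 A3 A4 A5 A6.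
move: (qpoch_partial (be * ga) q k) (qpoch_partial (q / (be * ga)) q k)
  (qpoch_partial (be * de) q k) (qpoch_partial (q / (be * de)) q k)
  (qpoch_partial (be ^+ 2) q k) (qpoch_partial (- be ^+ 2) q k) => B1 B2 B3 B4 B5 B6.
move: (qpoch_inf (q ^+ 2) (q ^+ 2)) (qpoch_inf (q ^+ 2 / be ^+ 4) (q ^+ 2))
  ((qpoch_partial (q ^+ 2) (q ^+ 2) k)^-1) ((- be ^+ 2) ^+ k) => D1 D2 D3 D4.
have bk0 := expf_neq0 k b0; have tk0 := qtri_neq0 k.
move: (be ^+ k) (qtri k) bk0 tk0 => bk tk bk0 tk0.
by field; rewrite b0 x0 bk0 tk0.
Qed.

Lemma psi_sum_at_base : psi_sum u (whipple_params be ga de) be =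
  whipple_const * whipple_prod q (- be ^+ 2) (be * ga) (- (be * de)).
Proof.
have c1 : `|- be ^+ 2| < 1 by rewrite normrN.
have a0 : be * ga != 0 by rewrite mulf_neq0.
have de0 : - (be * de) != 0 by rewrite oppr_eq0 mulf_neq0.
rewrite -(whipple_summation q0 q1 a0 de0 c1) /whipple_sum /psi_sum.
have aw := absum_whipple q1 (- (be * de)) (be * ga) c1.
have E (k : nat) := gaussian_term_pos k.
have Ep (k : nat) : gaussian_term u (wp_kernel u (whipple_params be ga de)) be k =
  be^-1 * whipple_const * (whipple_coef q (- be ^+ 2) (be * ga) (- (be * de)) k * (- be ^+ 2) ^+ k).
  by rewrite -mulrA -E mulKf.
have ap : absum (fun k : nat => gaussian_term u (wp_kernel u (whipple_params be ga de)) be k).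
  by rewrite (funext Ep); exact: absumZ.
have an : absum (fun k : nat => gaussian_term u (wp_kernel u (whipple_params be ga de)) be (Negz k)).
  by rewrite (funext gaussian_term_neg); exact: absum0.
have [_ ->] := isum_int ap an.
rewrite (eq_isum gaussian_term_neg) isum0 addr0 (eq_isum Ep) isumZ //.
by rewrite -mulrA mulVKf.
Qed.

End Values.

End Evaluation.

(** * Closed form of the normalized sum *)

Section PsiFormula.
Variable C : sumCompleteFieldType.
Variable u : C.
Hypotheses (u0 : u != 0) (u1 : `|u| < 1).
Local Notation q := (u ^+ 2).
Local Notation p := `|q|.
Local Notation th x := (qtheta x q).
Local Notation pI x := (qpoch_inf x q).

Let q0 : q != 0. Proof. by rewrite expf_neq0. Qed.
Let q1 : `|q| < 1. Proof. exact: norm_sq_lt1. Qed.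
Let p_gt0 : 0 < p. Proof. by rewrite normr_gt0. Qed.

(** The zeros of [th] are the powers of q; testing norms only gives a condition that can be secured
    by changing the modulus of x. *)
Lemma qtheta_neq0 (x : C) : x != 0 -> `|x| < 1 -> (forall n, `|x| != p ^+ n.+1) -> th x != 0.
Proof.
move=> x0 x1 hx; rewrite qthetaE mulf_neq0 //; first exact: qpoch_inf_neq0_small.
apply: qpoch_inf_neq0 => // n; rewrite subr_eq0; apply: contra_neqN (hx n) => /eqP h.
have -> : x = q ^+ n.+1.
  by apply: (mulIf (invr_neq0 x0)); rewrite divff // h [q ^+ n.+1]exprS; ring.
by rewrite normrX.
Qed.

Definition quad_prod (be ga de : C) : C :=
  qpoch_inf (be ^+ 4 * ga * de) (q ^+ 2) * qpoch_inf (q * be ^+ 2 * ga / de) (q ^+ 2) *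
  qpoch_inf (q * be ^+ 2 * de / ga) (q ^+ 2) * qpoch_inf (q ^+ 2 / (ga * de)) (q ^+ 2).

Definition psi_closed (be ga de t : C) : C :=
  qpoch_inf (q ^+ 2) (q ^+ 2) * pI (be ^+ 2) * quad_prod be ga de * th (t ^+ 2) *
  (th (be * ga) * th (be * de) * th (- (be * t)) * th (- (be / t)) +
   th (- (be * ga)) * th (- (be * de)) * th (be * t) * th (be / t)).

Lemma psi_sum_base (be ga de : C) : be != 0 -> ga != 0 -> de != 0 -> `|be ^+ 2| < 1 ->
  psi_sum u (whipple_params u be ga de) be =
  qpoch_inf (q ^+ 2) (q ^+ 2) * qpoch_inf (q ^+ 2 / be ^+ 4) (q ^+ 2) *
  pI (be ^+ 2) ^+ 2 * quad_prod be ga de * (th (be * ga) * th (be * de)).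
Proof.
move=> b0 g0 d0 b1; rewrite psi_sum_at_base // /whipple_const /whipple_prod opprK.
have -> : be * ga * - be ^+ 2 * - (be * de) = be ^+ 4 * ga * de by ring.
have -> : be * ga * - be ^+ 2 * q / - (be * de) = q * be ^+ 2 * ga / de.
  by rewrite invrN; field; rewrite b0 d0.
have -> : - be ^+ 2 * - (be * de) * q / (be * ga) = q * be ^+ 2 * de / ga.
  by field; rewrite b0 g0.
have -> : - be ^+ 2 * q ^+ 2 / (be * ga * - (be * de)) = q ^+ 2 / (ga * de).
  by rewrite mulrN invrN; field; rewrite b0 g0 d0.
rewrite /quad_prod; ring.
Qed.

Lemma whipple_paramsN (be ga de s : C) :
  wp_kernel u (whipple_params u (- be) ga de) s = wp_kernel u (whipple_params u be ga de) s.
Proof. by rewrite /wp_kernel /whipple_params opprK sqrrN !big_cons mulrCA [in RHS]mulrCA; ring. Qed.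

(** The kernel is invariant under be -> - be, which exchanges its first two parameters and fixes the
    others; the value at - be is therefore that at be with the sign changed. *)
Lemma psi_sum_baseN (be ga de : C) : be != 0 -> ga != 0 -> de != 0 -> `|be ^+ 2| < 1 ->
  psi_sum u (whipple_params u be ga de) (- be) =
  qpoch_inf (q ^+ 2) (q ^+ 2) * qpoch_inf (q ^+ 2 / be ^+ 4) (q ^+ 2) *
  pI (be ^+ 2) ^+ 2 * quad_prod be ga de * (th (- (be * ga)) * th (- (be * de))).
Proof.
move=> b0 g0 d0 b1; rewrite /psi_sum.
have E : wp_kernel u (whipple_params u be ga de) = wp_kernel u (whipple_params u (- be) ga de).
  by apply: funext => s; rewrite whipple_paramsN.
rewrite E -/(psi_sum _ _ _) psi_sum_base ?oppr_eq0 ?sqrrN //.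
by rewrite /quad_prod !mulNr sqrrN !(exprM (- be) 2 2, exprM be 2 2) sqrrN.
Qed.

Lemma whipple_params_neq0 (be ga de : C) : be != 0 -> ga != 0 -> de != 0 ->
  forall x, x \in whipple_params u be ga de -> x != 0.
Proof.
move=> b0 g0 d0 x; rewrite !inE => /or4P[|||/or3P[]] /eqP -> //.
- by rewrite oppr_eq0.
- by rewrite !mulf_neq0 // invr_eq0 !mulf_neq0 // expf_neq0.
- by rewrite !mulf_neq0 // invr_eq0 !mulf_neq0 // expf_neq0.
Qed.

Lemma psi_ratio_whipple (be ga de : C) : be != 0 -> ga != 0 -> de != 0 ->
  psi_ratio u (whipple_params u be ga de) = `|be ^+ 2|.
Proof.
move=> b0 g0 d0; rewrite /psi_ratio !big_cons big_nil !normrM !normfV !normrM normrN.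
by field; rewrite !normr_eq0 u0 b0 g0 d0.
Qed.

(** Genericity makes th(be^2) th(- be^2) nonzero, so that the factors (be^2; q)_oo and (q^2 / be^4;
    q^2)_oo can be cancelled. The remaining identity no longer contains the second, which is the one
    able to vanish when |be^2| < 1. *)
Lemma psi_formula_generic (be ga de t : C) : be != 0 -> ga != 0 -> de != 0 -> t != 0 ->
  `|be ^+ 2| < 1 -> (forall n, `|be ^+ 2| != p ^+ n.+1) ->
  pI (- be ^+ 2) * th (- 1) * psi_sum u (whipple_params u be ga de) t = psi_closed be ga de t.
Proof.
move=> b0 g0 d0 t0 b1 hb; have b20 : be ^+ 2 != 0 by rewrite expf_neq0.
have n1 : th (be ^+ 2) != 0 by apply: qtheta_neq0.
have n2 : th (- be ^+ 2) != 0.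
  by apply: qtheta_neq0; rewrite ?oppr_eq0 ?normrN // => n; rewrite normrN.
have ratio : psi_ratio u (whipple_params u be ga de) < 1 by rewrite psi_ratio_whipple.
have h := psi_interpolation u0 u1 (erefl : size (whipple_params u be ga de) = 6)
  (whipple_params_neq0 b0 g0 d0) ratio b0 t0.
rewrite psi_sum_base // psi_sum_baseN // in h.
have E : th (be ^+ 2) * th (- be ^+ 2) =
    pI (be ^+ 2) * pI (- be ^+ 2) * qpoch_inf (q ^+ 2 / be ^+ 4) (q ^+ 2).
  rewrite !qthetaE; have -> : q / - be ^+ 2 = - (q / be ^+ 2) by rewrite invrN mulrN.
  have -> : q ^+ 2 / be ^+ 4 = (q / be ^+ 2) ^+ 2 by field.
  by rewrite -(qpoch_inf_sqr q1 (q / be ^+ 2)); ring.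
have := mulf_neq0 n1 n2; rewrite E !mulf_eq0 !negb_or => /andP[/andP[m1 m2] m3].
rewrite E in h.
apply: (mulfI (mulf_neq0 m1 m3)); rewrite /psi_closed.
transitivity (pI (be ^+ 2) * pI (- be ^+ 2) * qpoch_inf (q ^+ 2 / be ^+ 4) (q ^+ 2) *
  th (-1) * psi_sum u (whipple_params u be ga de) t); first by ring.
rewrite h; ring.
Qed.

Lemma tendsX (x : nat -> C) (l : C) n : tends x l -> tends (fun m => x m ^+ n) (l ^+ n).
Proof.
move=> xl; elim: n => [|n ih]; first by under eq_fun do rewrite expr0; exact: tends_cst.
by under eq_fun do rewrite exprS; rewrite exprS; exact: tendsM.
Qed.

Lemma tends_qtheta (x : nat -> C) (l : C) : l != 0 -> tends x l ->
  tends (fun m => th (x m)) (th l).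
Proof.
move=> l0 xl; under eq_fun do rewrite qthetaE; rewrite qthetaE.
apply: tendsM; apply: tends_qpoch_inf => //.
by apply: tendsM; [exact: tends_cst|exact: tendsV].
Qed.

Lemma tends_psi_closed (b : nat -> C) (be ga de t : C) :
  be != 0 -> ga != 0 -> de != 0 -> t != 0 -> tends b be ->
  tends (fun m => psi_closed (b m) ga de t) (psi_closed be ga de t).
Proof.
move=> b0 g0 d0 t0 hb.
have q21 := norm_sq_lt1 q1.
have cst := tends_cst.
have hb2 := tendsX 2 hb; have hb4 := tendsX 4 hb.
have lin c : tends (fun m => b m * c) (be * c) by exact: tendsM.
have linN c : tends (fun m => - (b m * c)) (- (be * c)) by exact: tendsN.
have nz c : c != 0 -> be * c != 0 by move=> c0; rewrite mulf_neq0.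
have nzN c : c != 0 -> - (be * c) != 0 by move=> c0; rewrite oppr_eq0 nz.
have ti0 : t^-1 != 0 by rewrite invr_eq0.
rewrite /psi_closed; apply: tendsM; last first.
  by apply: tendsD; do 3?[apply: tendsM]; apply: tends_qtheta; rewrite ?nz ?nzN.
apply: tendsM => //; rewrite /quad_prod.
apply: tendsM; first by apply: tendsM => //; exact: tends_qpoch_inf.
do 3?[apply: tendsM]; apply: tends_qpoch_inf => //.
- by do 2?[apply: tendsM => //].
- by do 3?[apply: tendsM => //].
- by do 3?[apply: tendsM => //].
Qed.

Lemma tends_wp_kernel (b : nat -> C) (be ga de s : C) :
  be != 0 -> ga != 0 -> de != 0 -> s != 0 -> tends b be ->
  tends (fun m => wp_kernel u (whipple_params u (b m) ga de) s)
        (wp_kernel u (whipple_params u be ga de) s).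
Proof.
move=> b0 g0 d0 s0 hb.
have fac (x : nat -> C) l : l != 0 -> tends x l ->
    tends (fun m => pI (q * s / x m) * pI (q / (s * x m))) (pI (q * s / l) * pI (q / (s * l))).
  move=> l0 xl; apply: tendsM; apply: tends_qpoch_inf => //.
    by apply: tendsM; [exact: tends_cst|exact: tendsV].
  apply: tendsM; [exact: tends_cst|apply: tendsV; first by rewrite mulf_neq0].
  by apply: tendsM => //; exact: tends_cst.
have nz := whipple_params_neq0 b0 g0 d0.
have inv c : c != 0 -> tends (fun m => q / (b m ^+ 2 * c)) (q / (be ^+ 2 * c)).
  move=> c0; apply: tendsM; [exact: tends_cst|apply: tendsV].
    by rewrite mulf_neq0 // expf_neq0.
  by apply: tendsM; [exact: tendsX|exact: tends_cst].
rewrite /wp_kernel; apply: tendsM; first exact: tends_cst.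
under eq_fun do rewrite !big_cons big_nil; rewrite !big_cons big_nil.
do 6?[apply: tendsM; [apply: fac|]]; try exact: tends_cst; try (apply: nz; rewrite !inE eqxx ?orbT //).
- exact: hb.
- exact: tendsN.
- exact: inv.
- exact: inv.
Qed.

(* The interpolation nodes degenerate when [be ^+ 4] is a power of [q ^+ 2]; such
   [be] are approached radially from the inside, along values avoiding them. *)
Section Approximation.
Variables (be t ga de : C).
Hypotheses (b0 : be != 0) (t0 : t != 0) (g0 : ga != 0) (d0 : de != 0).

(** The constant (1 - p) / 2 gives r m >= (1 + p) / 2, whose square exceeds p because ((1 + p) /
    2)^2 - p = ((1 - p) / 2)^2. *)
Let r m := 1 - (1 - p) / 2 * p ^+ m.
Let b m := be * r m.

Let p1 : 0 < 1 - p. Proof. by rewrite subr_gt0. Qed.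

Let e0 m : 0 < (1 - p) / 2 * p ^+ m.
Proof. by rewrite mulr_gt0 ?exprn_gt0 // divr_gt0. Qed.

Let r_lt1 m : r m < 1.
Proof. by rewrite /r ltrBlDr ltrDl. Qed.

Let r_ge m : (1 + p) / 2 <= r m.
Proof.
have -> : (1 + p) / 2 = 1 - (1 - p) / 2 by field.
have h : 0 <= (1 - p) / 2 by apply: ltW; exact: (divr_gt0 p1 (ltr0Sn C 1)).
by rewrite /r lerB // ler_piMr // exprn_ile1 // ltW.
Qed.

Let r_ge_half m : 2^-1 <= r m.
Proof. by apply: le_trans (r_ge m); rewrite -[X in X <= _]mul1r ler_wpM2r ?invr_ge0 // lerDl. Qed.

Let r_gt0 m : 0 < r m.
Proof. by apply: lt_le_trans (r_ge_half m); rewrite invr_gt0. Qed.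

Let r_sqr_gt m : p < r m ^+ 2.
Proof.
apply: (@lt_le_trans _ _ (((1 + p) / 2) ^+ 2)); last first.
  apply: lerXn2r; last exact: r_ge.
    by rewrite nnegrE; apply: ltW; rewrite divr_gt0 // addr_gt0.
  by rewrite nnegrE; exact: ltW.
rewrite -subr_gt0; have -> : ((1 + p) / 2) ^+ 2 - p = ((1 - p) / 2) ^+ 2 by field.
by rewrite exprn_gt0 // divr_gt0.
Qed.

Lemma approx_tends : tends b be.
Proof.
rewrite -[X in tends _ X]mulr1 /b /r; apply: tendsM; first exact: tends_cst.
rewrite -[X in tends _ X]subr0 -(mulr0 ((1 - p) / 2)).
apply: tendsD; first exact: tends_cst.
apply: tendsN; apply: tendsM; first exact: tends_cst.
by apply: cvg_expr0; rewrite normr_id.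
Qed.

Lemma approx_neq0 m : b m != 0.
Proof. by rewrite mulf_neq0 // gt_eqF. Qed.

Lemma approx_sqr m : `|b m ^+ 2| = `|be ^+ 2| * r m ^+ 2.
Proof. by rewrite /b exprMn normrM [`|r m ^+ 2|]ger0_norm // exprn_ge0 // ltW. Qed.

Lemma approx_sqr_le m : `|b m ^+ 2| <= `|be ^+ 2|.
Proof. by rewrite approx_sqr ler_piMr // exprn_ile1 // ltW. Qed.

(** As p < r^2 < 1, the norm p^N r^2 lies strictly between two consecutive powers of p. *)
Lemma approx_avoids N m n : `|be ^+ 2| = p ^+ N -> `|b m ^+ 2| != p ^+ n.
Proof.
move=> bN; rewrite approx_sqr bN; apply/eqP => h.
have pN : 0 < p ^+ N by rewrite exprn_gt0.
have l1 : p ^+ n < p ^+ N by rewrite -h gtr_pMr // exprn_ilt1 // ltW.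
have l2 : p ^+ N.+1 < p ^+ n by rewrite -h exprSr ltr_pM2l.
rewrite ltr_iXn2l // in l1; rewrite ltr_iXn2l // in l2.
by move: l1 l2; rewrite ltnS ltnNge => /negP.
Qed.

Lemma tends_psi_sum : `|be ^+ 2| < 1 ->
  tends (fun m => psi_sum u (whipple_params u (b m) ga de) t)
        (psi_sum u (whipple_params u be ga de) t).
Proof.
move=> b1; have nz := whipple_params_neq0 b0 g0 d0.
have [R R0 hR] : exists2 R : C, 0 <= R &
    forall z, z \in t :: whipple_params u be ga de -> in_annulus R z.
  by apply: in_annulus_exists => z; rewrite inE => /orP[/eqP ->|/nz].
(* The parameters are scaled by r m or by (r m)^-2; since 1/2 <= r m < 1, these factors and their
   inverses are at most 4, and one annulus serves all m. *)
have R4 : R <= R * 4 by rewrite ler_peMr // ler1n.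
have R40 : 0 <= R * 4 by rewrite mulr_ge0.
have [M M0 hM] := gaussian_term_wp_kernel_bound u0 u1 R40.
have ht : in_annulus (R * 4) t by apply: in_annulus_le R4 _; apply: hR; rewrite inE eqxx.
have hx z : z \in whipple_params u be ga de -> in_annulus R z.
  by move=> h; apply: hR; rewrite inE h orbT.
have ri m : (r m)^-1 <= 2 by rewrite invf_ple ?posrE ?r_gt0.
have scale m (z y : C) : in_annulus R z -> `|y| <= 4 -> `|y^-1| <= 4 -> y != 0 ->
    in_annulus (R * 4) (z * y).
  move=> /and3P[z0 z1 z2] y1 y2 y0; apply/and3P; split; first by rewrite mulf_neq0.
    by rewrite normrM ler_pM.
  by rewrite invfM normrM ler_pM.
have rge0 m : 0 <= r m by exact: ltW.
have rige0 m : 0 <= (r m)^-1 by rewrite invr_ge0.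
have r1 m : `|r m| <= 4.
  by rewrite ger0_norm // (le_trans (ltW (r_lt1 m))) // ler1n.
have r20 m : `|(r m ^+ 2)^-1| <= 4.
  rewrite -exprVn normrX ger0_norm //.
  have -> : 4 = 2 ^+ 2 :> C by rewrite -natrX.
  by apply: lerXn2r; rewrite ?nnegrE.
have r21 m : `|r m ^+ 2| <= 4.
  by rewrite normrX ger0_norm // (le_trans _ (ler1n _ 4)) // exprn_ile1 // ltW.
have r2 m : `|(r m)^-1| <= 4.
  by rewrite ger0_norm // (le_trans (ri m)) // ler_nat.
have rn m : r m != 0 by rewrite gt_eqF.
have hbm m z : z \in whipple_params u (b m) ga de -> in_annulus (R * 4) z.
  rewrite !inE => /or4P[|||/or3P[]] /eqP ->.
  - by apply: scale => //; apply: hx; rewrite !inE eqxx.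
  - by rewrite -mulNr; apply: scale => //; apply: hx; rewrite !inE eqxx ?orbT.
  - by apply: in_annulus_le R4 _; apply: hx; rewrite !inE eqxx ?orbT.
  - by apply: in_annulus_le R4 _; apply: hx; rewrite !inE eqxx ?orbT.
  - have -> : q / (b m ^+ 2 * ga) = q / (be ^+ 2 * ga) * (r m ^+ 2)^-1.
      by rewrite /b; field; rewrite rn b0 g0.
    by apply: scale; rewrite ?invrK ?invr_eq0 ?expf_neq0 //; apply: hx; rewrite !inE eqxx ?orbT.
  - have -> : q / (b m ^+ 2 * de) = q / (be ^+ 2 * de) * (r m ^+ 2)^-1.
      by rewrite /b; field; rewrite rn b0 d0.
    by apply: scale; rewrite ?invrK ?invr_eq0 ?expf_neq0 //; apply: hx; rewrite !inE eqxx ?orbT.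
have ratio01 : 0 <= `|be ^+ 2| < 1 by rewrite normr_ge0.
have ag := absumZ M (absum_int_geometric ratio01).
apply: tendsM; first exact: tends_cst.
have [] // := tannery (f := fun m k => gaussian_term u (wp_kernel u (whipple_params u (b m) ga de)) t k)
  (F := gaussian_term u (wp_kernel u (whipple_params u be ga de)) t) ag.
  move=> m k; apply: le_trans (hM (whipple_params u (b m) ga de) t k erefl ht (hbm m)) _.
  rewrite psi_ratio_whipple ?approx_neq0 // [X in _ <= X]ger0_norm ?mulr_ge0 ?exprn_ge0 //.
  by rewrite ler_wpM2l // lerXn2r ?nnegrE // approx_sqr_le.
move=> k; apply: tendsM; last exact: tends_cst.
apply: tendsM; last exact: tends_cst.
by apply: tends_wp_kernel => //; [rewrite mulf_neq0 ?expfz_neq0|exact: approx_tends].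
Qed.

End Approximation.

Lemma psi_formula (be ga de t : C) : be != 0 -> ga != 0 -> de != 0 -> t != 0 ->
  `|be ^+ 2| < 1 ->
  pI (- be ^+ 2) * th (- 1) * psi_sum u (whipple_params u be ga de) t = psi_closed be ga de t.
Proof.
move=> b0 g0 d0 t0 b1.
case: (pselect (exists N, `|be ^+ 2| = p ^+ N.+1)) => [[N bN]|hN]; last first.
  by apply: psi_formula_generic => // n; apply/eqP => h; apply: hN; exists n.
have hb := approx_tends be.
have lhs := tendsM (tendsM (tends_qpoch_inf q1 (tendsN (tendsX 2 hb))) (tends_cst (th (- 1))))
  (tends_psi_sum b0 t0 g0 d0 b1).
apply: tends_unique lhs _.
have := tends_psi_closed b0 g0 d0 t0 hb; congr (tends _ _); apply: funext => m.
rewrite psi_formula_generic ?approx_neq0 //.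
  exact: le_lt_trans (approx_sqr_le be m) b1.
by move=> n; exact: (approx_avoids m _ bN).
Qed.

End PsiFormula.

(** * From the 8Psi8 series to the normalized sum *)

Section Psi88Evaluation.
Variable C : sumCompleteFieldType.
Variable u : C.
Hypotheses (u0 : u != 0) (u1 : `|u| < 1).
Local Notation q := (u ^+ 2).
Local Notation p := `|q|.
Local Notation th x := (qtheta x q).
Local Notation pI x := (qpoch_inf x q).

Let q0 : q != 0. Proof. by rewrite expf_neq0. Qed.
Let q1 : `|q| < 1. Proof. exact: norm_sq_lt1. Qed.

Lemma qtri_exprz n : qtri u n = u ^ (n%:Z ^+ 2 - n%:Z).
Proof.
elim: n => [|n ih]; first by rewrite /qtri big_geq.
rewrite /qtri big_nat_recr //= -/(qtri u n) ih -[q ^+ n]exprM [u ^+ (2 * n)]exprnP -expfzDr //.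
by congr (_ ^ _); rewrite !expr2; lia.
Qed.

Lemma qpoch_partial_flip (y : C) n : y != 0 ->
  qpoch_partial (q / y) q n =
  (- y^-1) ^+ n * (qtri u n * q ^+ n) * \prod_(0 <= i < n) (1 - y * q ^- i.+1).
Proof.
move=> y0.
have -> : q ^+ n = \prod_(0 <= i < n) q by rewrite big_mkord prodr_const card_ord.
have -> : (- y^-1) ^+ n = \prod_(0 <= i < n) (- y^-1) by rewrite big_mkord prodr_const card_ord.
rewrite /qpoch_partial /qtri -!big_split /=; apply: eq_bigr => i _.
by rewrite [q ^+ i.+1]exprS; field; rewrite y0 u0 expf_neq0.
Qed.

(** For k > 0 the factors of (x; q)_k are those of (q^(1-k) / x; q)_k up to - x q^i; for k < 0 the
    inverse product cancels the first factors of (q/x; q)_oo, and this is where the numerator must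
    have no pole. *)
Lemma qpoch_num (x : C) (k : int) : x != 0 -> (forall n : nat, 1 - x * q ^- n.+1 != 0) ->
  qpoch x q k * pI (q / x) = (- x) ^ k * u ^ (k ^+ 2 - k) * pI (q / (x * q ^ k)).
Proof.
move=> x0 hx; case: (intP k) => [|n|n].
- have -> : 0 ^+ 2 - 0 = 0 :> int by [].
  by rewrite /qpoch /= big_geq // ?expr0z ?mulr1 ?mul1r.
- rewrite -!exprnP -qtri_exprz.
  have -> : q / (x * q ^+ n.+1) = (q / x) / q ^+ n.+1 by rewrite invfM mulrA.
  rewrite qpoch_inf_down ?mulf_neq0 ?invr_eq0 //.
  have -> : q / (q / x) = x by field; rewrite u0 x0.
  have -> : - (q / x) = q * (- x)^-1 by rewrite invrN mulrN.
  rewrite exprMn exprVn /qpoch -/(qpoch_partial x q n.+1).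
  by field; rewrite qtri_neq0 // !expf_neq0 // oppr_eq0.
- have -> : q / (x * q ^ (- n.+1%:Z)) = q / x * q ^+ n.+1.
    by rewrite -exprnN invfM invrK mulrA.
  rewrite (qpoch_inf_shift q1 (q / x) n.+1) qpoch_partial_flip // -NegzE /qpoch.
  have P0 : \prod_(0 <= i < n.+1) (1 - x * q ^- i.+1) != 0.
    by rewrite prodf_seq_neq0; apply/allP => i _ /=; exact: hx.
  have -> : u ^ (Negz n ^+ 2 - Negz n) = qtri u n.+1 * q ^+ n.+1.
    rewrite qtri_exprz -[q ^+ n.+1]exprM [u ^+ (2 * n.+1)]exprnP -expfzDr //; congr (_ ^ _).
    by rewrite NegzE sqrrN; rewrite !expr2; lia.
  have -> : (- x) ^ (Negz n) = (- x^-1) ^+ n.+1.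
    by rewrite NegzE -exprnN -exprVn invrN.
  by field.
Qed.

Lemma qpoch_den (y : C) (k : int) : (forall n : nat, 1 - y * q ^+ n != 0) ->
  pI y / qpoch y q k = pI (y * q ^ k).
Proof.
move=> hy; case: k => n.
  rewrite (qpoch_inf_shift q1 y n) /qpoch -/(qpoch_partial y q n) -exprnP mulrAC divff ?mul1r //.
  by rewrite prodf_seq_neq0; apply/allP => i _ /=; exact: hy.
(* For k < 0 the two inversions cancel even if the product is 0; here the convention [0^-1 = 0]
   gives the intended zero term. *)
rewrite /qpoch invrK (qpoch_inf_shift q1 (y * q ^ Negz n) n.+1).
have yE : y * q ^ Negz n * q ^+ n.+1 = y.
  by rewrite NegzE -exprnN divfK // expf_neq0.
rewrite yE mulrC; congr (_ * _).
rewrite /qpoch_partial [RHS]big_nat_rev /= add0n big_nat [RHS]big_nat.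
apply: eq_bigr => i /andP[_ ik]; congr (1 - _); rewrite -mulrA; congr (_ * _).
rewrite NegzE -exprnN subSS.
have -> : n.+1 = (n - i + i.+1)%N by lia.
by rewrite exprD invfM; field; rewrite !expf_neq0.
Qed.

(* The factor which clears the denominators of all the terms at once. *)
Definition psi88_norm (a : C) (s : seq C) : C :=
  (1 - a) * \prod_(x <- s) (pI (q * a / x) * pI (q / x)).

Lemma psi88_norm_neq0 a (s : 6.-tuple C) : Psi88_defined a s q ->
  (forall x, x \in (s : seq C) -> x != 0) -> psi88_norm a s != 0.
Proof.
move=> [a1 hs] s0; rewrite mulf_neq0 // prodf_seq_neq0; apply/allP => x xs /=.
have h n := hs x xs n; rewrite mulf_neq0 //.
  by apply: qpoch_inf_neq0 => // n; case: (h n).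
apply: qpoch_inf_neq0 => // n; have [_ hn] := h n; have x0 := s0 x xs.
apply: contraNneq hn => e; rewrite subr_eq0; apply/eqP.
have {}e : q / x * q ^+ n = 1 by apply/esym/eqP; rewrite -subr_eq0 e.
apply: (mulIf (expf_neq0 n.+1 q0)); rewrite divfK ?expf_neq0 // mul1r.
by apply: (mulIf (invr_neq0 x0)); rewrite divff // -e [q ^+ n.+1]exprS; ring.
Qed.

(** The hypothesis on z makes everything fit. The six numerators contribute the k-th power of the
    product of the parameters, the six signs cancelling, and q^(3k^2 - 3k); with z^k this gives
    t^(6k) q^(3k^2 - k). The missing t q^k = s comes from 1 - s^2 = s (1/s - s). *)
Lemma psi88_term_gaussian (t z : C) (s : 6.-tuple C) (k : int) : t != 0 ->
  (forall x, x \in (s : seq C) -> x != 0) -> Psi88_defined (t ^+ 2) s q ->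
  z * \prod_(x <- s) x = q ^+ 2 * t ^+ 6 ->
  Psi88_term (t ^+ 2) s q z k * psi88_norm (t ^+ 2) s =
  t * gaussian_term u (wp_kernel u [seq x / t | x <- s]) t k.
Proof.
move=> t0 s0 [a1 hs] hz; rewrite /Psi88_term /psi88_norm.
set P := \prod_(x <- s) _; set P' := \prod_(x <- s) _.
have PE : P * P' = \prod_(x <- s) ((- x) ^ k) * u ^ (6 * (k ^+ 2 - k)) *
    \prod_(x <- s) (pI (q * (t * q ^ k) / (x / t)) * pI (q / (t * q ^ k * (x / t)))).
  have -> : u ^ (6 * (k ^+ 2 - k)) = \prod_(x <- s) (u ^ (k ^+ 2 - k)).
    rewrite big_const_seq count_predT size_tuple /=.
    have -> : 6 * (k ^+ 2 - k) = (k ^+ 2 - k) * 6%:Z by rewrite mulrC.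
    by rewrite -exprz_exp -exprnP !exprS expr0.
  rewrite /P /P' -!big_split /= big_seq [RHS]big_seq; apply: eq_bigr => x xs.
  have x0 := s0 x xs.
  have h1 n : 1 - q * t ^+ 2 / x * q ^+ n != 0 by case: (hs x xs n).
  have h2 n : 1 - x * q ^- n.+1 != 0 by case: (hs x xs n).
  have -> : q * (t * q ^ k) / (x / t) = q * t ^+ 2 / x * q ^ k by field; rewrite x0 t0.
  have -> : q / (t * q ^ k * (x / t)) = q / (x * q ^ k).
    by congr (_ / _); field.
  rewrite -(qpoch_den k h1).
  transitivity (qpoch x q k * pI (q / x) *
    (pI (q * t ^+ 2 / x) / qpoch (q * t ^+ 2 / x) q k)); first by ring.
  by rewrite (qpoch_num k x0 h2); ring.
have X0 : \prod_(x <- s) x != 0.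
  by rewrite prodf_seq_neq0; apply/allP => x xs /=; exact: s0.
have hzk : \prod_(x <- s) ((- x) ^ k) * z ^ k = (q ^ k) ^+ 2 * t ^ (6 * k).
  have -> : \prod_(x <- s) ((- x) ^ k) = (\prod_(x <- s) x) ^ k.
    have -> : \prod_(x <- s) x = \prod_(x <- s) (- x).
      under [RHS]eq_bigr do rewrite -mulN1r.
      by rewrite big_split /= big_const_seq count_predT size_tuple /=; ring.
    by elim: (tval s) => [|x l ih]; rewrite ?big_nil ?exp1rz // !big_cons expfzMl ih.
  rewrite -expfzMl mulrC hz expfzMl; congr (_ * _).
    by rewrite !exprnP !exprz_exp; congr (_ ^ _); ring.
  by rewrite exprnP exprz_exp.
rewrite /gaussian_term /wp_kernel big_map.
set K := \prod_(x <- s) (pI (q * (t * q ^ k) / _) * _) in PE *.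
have qk0 : q ^ k != 0 by rewrite expfz_neq0.
transitivity ((1 - t ^+ 2 * q ^ (2 * k)) * (P * P') * z ^ k).
  by field.
rewrite PE.
transitivity ((1 - t ^+ 2 * q ^ (2 * k)) * (\prod_(x <- s) ((- x) ^ k) * z ^ k) *
  u ^ (6 * (k ^+ 2 - k)) * K); first by ring.
rewrite hzk.
have -> : q ^ (2 * k) = q ^ k * q ^ k by rewrite -expfzDr //; congr (_ ^ _); ring.
have -> : u ^ (6 * (k ^+ 2 - k)) = (u ^+ 6) ^ (k ^+ 2) * ((q ^ k) ^+ 3)^-1.
  have -> : ((q ^ k) ^+ 3)^-1 = u ^ (- (6 * k)).
    by rewrite exprnP exprnP !exprz_exp invr_expz; congr (_ ^ _); ring.
  by rewrite [u ^+ 6]exprnP exprz_exp -expfzDr //; congr (_ ^ _); ring.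
by field; rewrite t0 qk0.
Qed.

Lemma psi88_eval (t z : C) (s : 6.-tuple C) : t != 0 ->
  (forall x, x \in (s : seq C) -> x != 0) -> Psi88_defined (t ^+ 2) s q ->
  z * \prod_(x <- s) x = q ^+ 2 * t ^+ 6 -> psi_ratio u [seq x / t | x <- s] < 1 ->
  Psi88_cvg (t ^+ 2) s q z /\
  Psi88 (t ^+ 2) s q z * psi88_norm (t ^+ 2) s = psi_sum u [seq x / t | x <- s] t.
Proof.
move=> t0 s0 hd hz hr; have n0 := psi88_norm_neq0 hd s0.
have ag : absum (gaussian_term u (wp_kernel u [seq x / t | x <- s]) t).
  apply: absum_psi => //; first by rewrite size_map size_tuple.
  by move=> y /mapP[x xs ->]; rewrite mulf_neq0 ?invr_eq0 // s0.
have E k : Psi88_term (t ^+ 2) s q z k =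
    t / psi88_norm (t ^+ 2) s * gaussian_term u (wp_kernel u [seq x / t | x <- s]) t k.
  by rewrite mulrAC -(psi88_term_gaussian k t0 s0 hd hz) mulfK.
have aT : absum (Psi88_term (t ^+ 2) s q z) by rewrite (funext E); exact: absumZ.
have [hc hs] := absum_bilateral aT; split=> //.
rewrite /Psi88 hs (eq_isum E) isumZ // /psi_sum.
by rewrite mulrAC divfK.
Qed.

End Psi88Evaluation.

(** * The three-term relation *)

(** All infinite products are atoms: a leading [n] marks a negated argument, [v] a division, [om]
    and [op] are 1 - a and 1 + a, [r] is b/a, and [W], [V] are the products at b^2 / a and - b^2 /
    a. [S1], [S2] are the two series, [e1], [e2] their closed forms with theta combinations [X],
    [X'], and the last hypothesis is the theta identity relating these. *)
Lemma three_term_algebra (F : fieldType)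
  (om op r qa nqa qva nqva ba nba qab nqab bca nbca qabc nqabc qvd nqvd qac nqac qad
   bbc nbbc bbc2 bbd bbd2 nbbd2 qvb nqvb qvc nb c_ W V bda qabd e5 P2 QP th1 X X' S1 S2 : F) :
  om != 0 -> op != 0 -> r != 0 -> W != 0 -> th1 != 0 -> nqvb != 0 -> qvc != 0 -> bbc2 != 0 ->
  nqac != 0 -> nqvd != 0 -> nbbc != 0 -> nbbd2 != 0 ->
  nqa * (nqva * (qvd * (nba * (nqab * (qac * (bca * (V * (V * (qabc * (bbc * (bbd2 * 1))))))))))) != 0 ->
  qvb * (qvd * (V * (qab * (nqab * (qac * (qad * (bca * (bbc * (bbd * (bbd2 * (qabc * 1))))))))))) *
    (r^-1 * (nba * nqab)) != 0 ->
  V * th1 * (S1 * (om * (qab * qvb * (nqab * nqvb * (qac * qvc * (qad * qvd *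
    (bbc * bbc2 * (bbd * bbd2 * 1)))))))) = P2 * W * QP * (om * qa * qva) * X ->
  W * th1 * (S2 * (op * (nqab * qvb * (qab * nqvb * (nqac * qvc * (qad * nqvd *
    (nbbc * bbc2 * (bbd * nbbd2 * 1)))))))) = P2 * V * QP * (op * nqa * nqva) * X' ->
  X * (nba * nqab) * (bca * qabc) - X' * (ba * qab) * (nbca * nqabc) =
    (bda * qabd) * (nb * nqvb) * (r * th1 ^+ 2 * (bbc2 * e5 * (c_ * qvc))) ->
  S1 = qa * (qva * (ba * (nqvd * (W * (W * (qab * (nqac * (nbca * (nbbc * (nqabc * (nbbd2 * 1))))))))))) /
       (nqa * (nqva * (qvd * (nba * (nqab * (qac * (bca * (V * (V * (qabc * (bbc * (bbd2 * 1)))))))))))) * S2 +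
       qa * (nb * (c_ * (qva * (W * (bda * (qabd * (e5 * 1))))))) * (P2 * QP) * th1 /
       (qvb * (qvd * (V * (qab * (nqab * (qac * (qad * (bca * (bbc * (bbd * (bbd2 * (qabc * 1))))))))))) *
        (r^-1 * (nba * nqab))).
Proof.
move=> om0 op0 r0 W0 t0 nqvb0 qvc0 bbc20 nqac0 nqvd0 nbbc0 nbbd20.
rewrite !mulf_eq0 !negb_or !oner_neq0 ?invr_eq0 ?r0 /=.
move=> h1 h2 e1 e2 key.
have [nqa0 nqva0 qvd0 nba0 nqab0] : [/\ nqa != 0, nqva != 0, qvd != 0, nba != 0 & nqab != 0].
  by case/and5P: h1 => -> -> -> -> /andP[->].
have [qac0 bca0 V0 qabc0 bbc0] : [/\ qac != 0, bca != 0, V != 0, qabc != 0 & bbc != 0].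
  by case/and5P: h1 => _ _ _ _ /and5P[_ -> -> -> /and4P[_ -> ->]].
have [bbd20 qvb0 qab0 qad0 bbd0] : [/\ bbd2 != 0, qvb != 0, qab != 0, qad != 0 & bbd != 0].
  case/andP: h2 => /and5P[-> _ _ -> /and5P[_ _ -> _ /and4P[_ -> -> _]]] _.
  by [].
(* Once the theta identity is solved for [X], and the closed forms for [S1] and [S2], the conclusion
   is an identity of rational functions in independent atoms. *)
have XE : X = (X' * (ba * qab) * (nbca * nqabc) +
    (bda * qabd) * (nb * nqvb) * (r * th1 ^+ 2 * (bbc2 * e5 * (c_ * qvc)))) /
    (nba * nqab * (bca * qabc)).
  by rewrite -key; field; rewrite nba0 nqab0 bca0 qabc0.
have -> : S1 = P2 * W * QP * (qa * qva) * X /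
    (V * th1 * (qab * qvb * (nqab * nqvb * (qac * qvc * (qad * qvd * (bbc * bbc2 * (bbd * bbd2))))))).
  have n0 : V * th1 * (om * (qab * qvb * (nqab * nqvb * (qac * qvc * (qad * qvd *
    (bbc * bbc2 * (bbd * bbd2 * 1))))))) != 0 by rewrite !mulf_neq0 // oner_neq0.
  apply: (mulIf n0); transitivity (P2 * W * QP * (om * qa * qva) * X); first by rewrite -e1; ring.
  by field; rewrite V0 t0 qab0 qvb0 nqab0 nqvb0 qac0 qvc0 qad0 qvd0 bbc0 bbc20 bbd0 bbd20.
have -> : S2 = P2 * V * QP * (nqa * nqva) * X' /
    (W * th1 * (nqab * qvb * (qab * nqvb * (nqac * qvc * (qad * nqvd * (nbbc * bbc2 * (bbd * nbbd2))))))).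
  have n0 : W * th1 * (op * (nqab * qvb * (qab * nqvb * (nqac * qvc * (qad * nqvd *
    (nbbc * bbc2 * (bbd * nbbd2 * 1))))))) != 0 by rewrite !mulf_neq0 // oner_neq0.
  apply: (mulIf n0); transitivity (P2 * V * QP * (op * nqa * nqva) * X'); first by rewrite -e2; ring.
  by field; rewrite W0 t0 qab0 qvb0 nqab0 nqvb0 nqac0 qvc0 qad0 nqvd0 nbbc0 bbc20 bbd0 nbbd20.
rewrite XE; field.
by rewrite nqa0 nqva0 qvd0 nba0 nqab0 qac0 bca0 V0 qabc0 bbc0 bbd20 qvb0 qab0 qad0 bbd0
  t0 nqvb0 qvc0 bbc20 nqac0 nqvd0 nbbc0 nbbd20 W0 r0.
Qed.

Section MainFormula.
Variable C : sumCompleteFieldType.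
Variable u : C.
Hypotheses (u0 : u != 0) (u1 : `|u| < 1).
Local Notation q := (u ^+ 2).
Local Notation th x := (qtheta x q).
Local Notation pI x := (qpoch_inf x q).

Let q0 : q != 0. Proof. by rewrite expf_neq0. Qed.
Let q1 : `|q| < 1. Proof. exact: norm_sq_lt1. Qed.

Definition psi88_quad (a b c d : C) : C :=
  qpochs_inf [:: q ^+ 2 * a / (c * d); b ^+ 4 * c * d / a ^+ 3;
          q * b ^+ 2 * c / (a * d); q * b ^+ 2 * d / (a * c)] (q ^+ 2).

Definition psi88_bracket (a b c d : C) : C :=
  th (b * c / a) * th (b * d / a) * th (- b) * th (- (b / a)) +
  th (- (b * c / a)) * th (- (b * d / a)) * th b * th (b / a).

(** [psi_formula] at be = b/t, ga = c/t, de = d/t. Only t^2 survives in the result, so the choice of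
    the square root is immaterial. *)
Lemma psi88_formula (t a b c d : C) : t ^+ 2 = a -> a != 0 -> b != 0 -> c != 0 -> d != 0 ->
  `|b ^+ 2| < `|a| ->
  let s := [tuple b; - b; c; d; q * a ^+ 2 / (b ^+ 2 * c); q * a ^+ 2 / (b ^+ 2 * d)] in
  Psi88_defined a s q ->
  Psi88_cvg a s q (- (b ^+ 2 / a)) /\
  pI (- (b ^+ 2 / a)) * th (- 1) * (Psi88 a s q (- (b ^+ 2 / a)) * psi88_norm u a s) =
  qpoch_inf (q ^+ 2) (q ^+ 2) * pI (b ^+ 2 / a) * psi88_quad a b c d *
    ((1 - a) * pI (q * a) * pI (q / a)) * psi88_bracket a b c d.
Proof.
move=> ta a0 b0 c0 d0 hab s hs.
have t0 : t != 0 by apply: contraNneq a0 => t0; rewrite -ta t0 expr0n.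
have g0 x : x != 0 -> x / t != 0 by move=> x0; rewrite mulf_neq0 ?invr_eq0.
have xsE : [seq x / t | x <- s] = whipple_params u (b / t) (c / t) (d / t).
  rewrite /= /whipple_params mulNr; congr [:: _, _, _, _, _ & _].
    by rewrite -ta; field; rewrite t0 b0 c0.
  by congr [:: _]; rewrite -ta; field; rewrite t0 b0 d0.
have s0 x : x \in (s : seq C) -> x != 0.
  move=> xs; have : x / t \in [seq x / t | x <- s] by apply/mapP; exists x.
  rewrite xsE => /(whipple_params_neq0 u0 (g0 _ b0) (g0 _ c0) (g0 _ d0)).
  by rewrite mulf_eq0 negb_or => /andP[].
have b1 : `|(b / t) ^+ 2| < 1.
  by rewrite expr_div_n ta normrM normfV ltr_pdivrMr ?normr_gt0 // mul1r.
have hr : psi_ratio u [seq x / t | x <- s] < 1 by rewrite xsE psi_ratio_whipple ?g0.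
have hz : - (b ^+ 2 / a) * \prod_(x <- s) x = q ^+ 2 * t ^+ 6.
  rewrite !big_cons big_nil -ta; field; by rewrite t0 b0 c0 d0.
have hs' : Psi88_defined (t ^+ 2) s q by rewrite ta.
have [] := psi88_eval u0 u1 t0 s0 hs' hz hr; rewrite ta => hc hp; split=> //.
have := psi_formula u0 u1 (g0 _ b0) (g0 _ c0) (g0 _ d0) t0 b1; rewrite -xsE -hp.
have bt2 : (b / t) ^+ 2 = b ^+ 2 / a by rewrite expr_div_n ta.
rewrite {1}bt2.
move=> ->; rewrite /psi88_quad /psi88_bracket /psi_closed /quad_prod ta.
have -> : b / t * (c / t) = b * c / a by rewrite -ta; field.
have -> : b / t * (d / t) = b * d / a by rewrite -ta; field.
have -> : b / t * t = b by field.
have -> : b / t / t = b / a by rewrite -ta; field.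
have -> : (b / t) ^+ 4 * (c / t) * (d / t) = b ^+ 4 * c * d / a ^+ 3 by rewrite -ta; field.
have -> : q * (b / t) ^+ 2 * (c / t) / (d / t) = q * b ^+ 2 * c / (a * d).
  by rewrite -ta; field; rewrite d0 t0.
have -> : q * (b / t) ^+ 2 * (d / t) / (c / t) = q * b ^+ 2 * d / (a * c).
  by rewrite -ta; field; rewrite c0 t0.
have -> : q ^+ 2 / (c / t * (d / t)) = q ^+ 2 * a / (c * d).
  by rewrite -ta; field; rewrite c0 d0 t0.
have -> : th a = (1 - a) * pI (q * a) * pI (q / a).
  by rewrite qthetaE (qpoch_inf_rec q1 a) [a * q]mulrC.
by rewrite bt2 /qpochs_inf !big_cons big_nil; ring.
Qed.

Lemma theta_N1_neq0 : th (- 1) != 0.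
Proof.
rewrite qthetaE mulf_neq0 //; apply: qpoch_inf_neq0 => // n.
  rewrite mulN1r opprK; case: n => [|n]; first by rewrite expr0 -mulr2n pnatr_eq0.
  rewrite addrC addr_eq0; apply: contraTneq (q1) => h; suff : `|q ^+ n.+1| < 1.
    by rewrite h normrN normr1 ltxx.
  by rewrite normrX exprn_ilt1.
rewrite invrN invr1 mulrN1 mulNr opprK -exprS addrC addr_eq0.
have : `|q ^+ n.+1| < 1 by rewrite normrX exprn_ilt1.
by apply: contraTneq => ->; rewrite normrN normr1 ltxx.
Qed.

End MainFormula.

Section ThreeTerm.
Variable C : sumCompleteFieldType.
Variable u : C.
Hypotheses (u0 : u != 0) (u1 : `|u| < 1).
Local Notation q := (u ^+ 2).
Local Notation th x := (qtheta x q).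
Local Notation pI x := (qpoch_inf x q).

Let q0 : q != 0. Proof. by rewrite expf_neq0. Qed.
Let q1 : `|q| < 1. Proof. exact: norm_sq_lt1. Qed.

Lemma psi88_norm1 (a b c d : C) : a != 0 -> b != 0 -> c != 0 -> d != 0 ->
  psi88_norm u a [tuple b; - b; c; d; q * a ^+ 2 / (b ^+ 2 * c); q * a ^+ 2 / (b ^+ 2 * d)] =
  (1 - a) * (pI (q * a / b) * pI (q / b) * (pI (- (q * a / b)) * pI (- (q / b)) *
    (pI (q * a / c) * pI (q / c) * (pI (q * a / d) * pI (q / d) *
    (pI (b ^+ 2 * c / a) * pI (b ^+ 2 * c / a ^+ 2) *
     (pI (b ^+ 2 * d / a) * pI (b ^+ 2 * d / a ^+ 2) * 1)))))).
Proof.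
move=> a0 b0 c0 d0; rewrite /psi88_norm /= !big_cons big_nil invrN !mulrN.
have E1 x : x != 0 -> q * a / (q * a ^+ 2 / (b ^+ 2 * x)) = b ^+ 2 * x / a.
  by move=> x0; field; rewrite a0 b0 x0 u0.
have E2 x : x != 0 -> q / (q * a ^+ 2 / (b ^+ 2 * x)) = b ^+ 2 * x / a ^+ 2.
  by move=> x0; field; rewrite a0 b0 x0 u0.
by rewrite !E1 // !E2.
Qed.

Lemma psi88_params_neq0 (a b c d : C) : a != 0 -> b != 0 -> c != 0 -> d != 0 ->
  forall x, x \in [tuple b; - b; c; d; q * a ^+ 2 / (b ^+ 2 * c); q * a ^+ 2 / (b ^+ 2 * d)] ->
  x != 0.
Proof.
move=> a0 b0 c0 d0 x; rewrite !inE => /or4P[|||/or3P[]] /eqP -> //.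
- by rewrite oppr_eq0.
- by rewrite !mulf_neq0 ?invr_eq0 ?mulf_neq0 // expf_neq0.
- by rewrite !mulf_neq0 ?invr_eq0 ?mulf_neq0 // expf_neq0.
Qed.

Lemma psi88_three_term (t j a b c d : C) : t ^+ 2 = a -> j ^+ 2 = - 1 ->
  a != 0 -> b != 0 -> c != 0 -> d != 0 -> `|b ^+ 2| < `|a| ->
  let s1 := [tuple b; - b; c; d;
                   q * a ^+ 2 / (b ^+ 2 * c); q * a ^+ 2 / (b ^+ 2 * d)] in
  let s2 := [tuple b; - b; c; - d;
                   q * a ^+ 2 / (b ^+ 2 * c); - (q * a ^+ 2 / (b ^+ 2 * d))] in
  let N1 := qpochs_inf
    [:: q * a; q / a; b / a; - (q / d); b ^+ 2 / a; b ^+ 2 / a; q * a / b;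
        - (q * a / c); - (b * c / a); - (b ^+ 2 * c / a); - (q * a / (b * c));
        - (b ^+ 2 * d / a ^+ 2)] q in
  let D1 := qpochs_inf
    [:: - (q * a); - (q / a); q / d; - (b / a); - (q * a / b); q * a / c;
        b * c / a; - (b ^+ 2 / a); - (b ^+ 2 / a); q * a / (b * c);
        b ^+ 2 * c / a; b ^+ 2 * d / a ^+ 2] q in
  let N2 :=
    qpochs_inf
      [:: q * a; - b; c; q / a; b ^+ 2 / a; b * d / a; q * a / (b * d);
          q * a ^+ 2 / (b ^+ 2 * c)] q *
    qpochs_inf
      [:: q ^+ 2; q ^+ 2 * a / (c * d); b ^+ 4 * c * d / a ^+ 3;
          q * b ^+ 2 * c / (a * d); q * b ^+ 2 * d / (a * c)] (q ^+ 2) *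
    qtheta (- 1) q in
  let D2 :=
    qpochs_inf
      [:: q / b; q / d; - (b ^+ 2 / a); q * a / b; - (q * a / b); q * a / c;
          q * a / d; b * c / a; b ^+ 2 * c / a; b ^+ 2 * d / a;
          b ^+ 2 * d / a ^+ 2; q * a / (b * c)] q *
    qtheta (- (a / b)) q in
  Psi88_defined a s1 q -> Psi88_defined (- a) s2 q -> D1 != 0 -> D2 != 0 ->
  [/\ Psi88_cvg a s1 q (- (b ^+ 2 / a)),
      Psi88_cvg (- a) s2 q (b ^+ 2 / a) &
      Psi88 a s1 q (- (b ^+ 2 / a)) =
        N1 / D1 * Psi88 (- a) s2 q (b ^+ 2 / a) + N2 / D2].
Proof.
move=> ta jj a0 b0 c0 d0 hab s1 s2 N1 D1 N2 D2 hs1 hs2 D10 D20.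
have [hc1 h1] := psi88_formula u0 u1 ta a0 b0 c0 d0 hab hs1.
have na0 : - a != 0 by rewrite oppr_eq0.
have nd0 : - d != 0 by rewrite oppr_eq0.
(* The second series is the first with (t, d) replaced by (j t, - d), so the same closed formula
   applies to it. *)
have jta : (j * t) ^+ 2 = - a by rewrite exprMn jj ta mulN1r.
have hab' : `|b ^+ 2| < `|- a| by rewrite normrN.
have s2E : s2 = [tuple b; - b; c; - d; q * (- a) ^+ 2 / (b ^+ 2 * c);
    q * (- a) ^+ 2 / (b ^+ 2 * - d)].
  by apply: val_inj; rewrite /= sqrrN mulrN invrN mulrN.
have hs2' := hs2; rewrite s2E in hs2'.
have [hc2 h2] := psi88_formula u0 u1 jta na0 b0 c0 nd0 hab' hs2'.
have zE : - (b ^+ 2 / - a) = b ^+ 2 / a by rewrite invrN mulrN opprK.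
rewrite -s2E zE in hc2; split=> //.
have K10 := psi88_norm_neq0 u0 u1 hs1.
have K20 := psi88_norm_neq0 u0 u1 hs2'.
have n1 := psi88_norm1 a0 b0 c0 d0.
have n2 := psi88_norm1 na0 b0 c0 nd0.
move: (K10 (psi88_params_neq0 a0 b0 c0 d0)) h1 => {}K10 h1.
move: (K20 (psi88_params_neq0 na0 b0 c0 nd0)) h2 => {}K20 h2.
rewrite n1 -/s1 in K10 h1; rewrite n2 -s2E in K20 h2.
rewrite zE in h2 *.
move: D10 D20 h1 h2 K10 K20; rewrite {}/D1 {}/D2 {}/N1 {}/N2 {hs1 hs2 hs2' hc1 hc2 n1 n2}.
set S1 := Psi88 a s1 _ _; set S2 := Psi88 (- a) s2 _ _.
have -> : psi88_quad u (- a) b c (- d) = psi88_quad u a b c d.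
  rewrite /psi88_quad (_ : (- a) ^+ 3 = - a ^+ 3); last by ring.
  by rewrite !(mulrN, mulNr, invrN, opprK).
(* Inversion turns the theta function at - a/b into the one at - b/a that occurs in the brackets;
   its factor is the [r^-1] of the algebraic lemma. *)
have -> : th (- (a / b)) = (b / a)^-1 * (pI (- (b / a)) * pI (- (q * a / b))).
  have -> : - (a / b) = (- (b / a))^-1 by rewrite invrN invf_div.
  rewrite qtheta_inv // ?oppr_eq0 ?mulf_neq0 ?invr_eq0 // qthetaE invrN opprK.
  by congr (_ * (_ * pI _)); field; rewrite a0 b0.
rewrite !(mulrN, mulNr, invrN, opprK, sqrrN).
rewrite /psi88_quad /qpochs_inf !big_cons !big_nil => D10 D20 h1 h2 K10 K20.
have r0 : b / a != 0 by rewrite mulf_neq0 ?invr_eq0.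
have W0 : pI (b ^+ 2 / a) != 0.
  by apply: qpoch_inf_neq0_small => //; rewrite normrM normfV ltr_pdivrMr ?normr_gt0 // mul1r.
have T0 := theta_N1_neq0 u1.
(* These factors occur in the normalizations of the two series but not among the denominators of the
   relation; that they are nonzero follows from the series being defined. *)
have {}K10 : [&& 1 - a != 0, pI (- (q / b)) != 0, pI (q / c) != 0 & pI (b ^+ 2 * c / a ^+ 2) != 0].
  by apply: contraNT K10; rewrite !negb_and !negbK !mulf_eq0 => /or4P[] ->; rewrite ?orbT.
have {}K20 : [&& 1 + a != 0, pI (- (q * a / c)) != 0, pI (- (q / d)) != 0,
    pI (- (b ^+ 2 * c / a)) != 0 & pI (- (b ^+ 2 * d / a ^+ 2)) != 0].
  by apply: contraNT K20; rewrite !negb_and !negbK !mulf_eq0 => /or4P[| | |/orP[]] ->; rewrite ?orbT.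
case/and4P: K10 => om0 K11 K12 K13; case/and5P: K20 => op0 K21 K22 K23 K24.
apply: (three_term_algebra om0 op0 r0 W0 T0 K11 K12 K13 K21 K22 K23 K24 D10 D20 h1 h2).
have z0 : b * c / a != 0 by rewrite !mulf_neq0 ?invr_eq0.
(* With x = b c / a and y = b / a, this accounts for the halves of the two brackets containing th(b
   d / a) th(- b); the halves containing th(- b d / a) th(b) cancel. The products x y and x / y are
   b^2 c / a^2 and c. *)
have := theta_square_identity u0 u1 z0 r0.
have -> : b * c / a * (b / a) = b ^+ 2 * c / a ^+ 2 by field.
have -> : b * c / a / (b / a) = c by field; rewrite a0 b0.
rewrite [th (b ^+ 2 * c / a ^+ 2)]qthetaE [th c]qthetaE.
have -> : q / (b ^+ 2 * c / a ^+ 2) = q * a ^+ 2 / (b ^+ 2 * c) by field; rewrite a0 b0 c0.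
move=> <-; rewrite /psi88_bracket !(mulrN, mulNr, invrN, opprK).
have -> : pI (- (b / a)) * pI (- (q * a / b)) = th (- (b / a)).
  by rewrite qthetaE invrN mulrN invf_div mulrA.
have -> : pI (b / a) * pI (q * a / b) = th (b / a) by rewrite qthetaE invf_div mulrA.
have -> : pI (b * c / a) * pI (q * a / (b * c)) = th (b * c / a) by rewrite qthetaE invf_div mulrA.
have -> : pI (- (b * c / a)) * pI (- (q * a / (b * c))) = th (- (b * c / a)).
  by rewrite qthetaE invrN mulrN invf_div mulrA.
have -> : pI (b * d / a) * pI (q * a / (b * d)) = th (b * d / a) by rewrite qthetaE invf_div mulrA.
have -> : pI (- b) * pI (- (q / b)) = th (- b) by rewrite qthetaE invrN mulrN.
ring.
Qed.

End ThreeTerm.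

Theorem corollary3p19 (R : realType) (q a b c d : R[i])
  (hq : 0 < `|q| < 1)
  (ha : a != 0) (hb : b != 0) (hc : c != 0) (hd : d != 0)
  (hab : `|b ^+ 2| < `|a|) :
  let s1 := [tuple b; - b; c; d;
                   q * a ^+ 2 / (b ^+ 2 * c); q * a ^+ 2 / (b ^+ 2 * d)] in
  let s2 := [tuple b; - b; c; - d;
                   q * a ^+ 2 / (b ^+ 2 * c); - (q * a ^+ 2 / (b ^+ 2 * d))] in
  let N1 := qpochs_inf
    [:: q * a; q / a; b / a; - (q / d); b ^+ 2 / a; b ^+ 2 / a; q * a / b;
        - (q * a / c); - (b * c / a); - (b ^+ 2 * c / a); - (q * a / (b * c));
        - (b ^+ 2 * d / a ^+ 2)] q in
  let D1 := qpochs_inf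
    [:: - (q * a); - (q / a); q / d; - (b / a); - (q * a / b); q * a / c;
        b * c / a; - (b ^+ 2 / a); - (b ^+ 2 / a); q * a / (b * c);
        b ^+ 2 * c / a; b ^+ 2 * d / a ^+ 2] q in
  let N2 :=
    qpochs_inf
      [:: q * a; - b; c; q / a; b ^+ 2 / a; b * d / a; q * a / (b * d);
          q * a ^+ 2 / (b ^+ 2 * c)] q *
    qpochs_inf
      [:: q ^+ 2; q ^+ 2 * a / (c * d); b ^+ 4 * c * d / a ^+ 3;
          q * b ^+ 2 * c / (a * d); q * b ^+ 2 * d / (a * c)] (q ^+ 2) *
    qtheta (- 1) q in
  let D2 :=
    qpochs_inf
      [:: q / b; q / d; - (b ^+ 2 / a); q * a / b; - (q * a / b); q * a / c;
          q * a / d; b * c / a; b ^+ 2 * c / a; b ^+ 2 * d / a;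
          b ^+ 2 * d / a ^+ 2; q * a / (b * c)] q *
    qtheta (- (a / b)) q in
  Psi88_defined a s1 q -> Psi88_defined (- a) s2 q -> D1 != 0 -> D2 != 0 ->
  [/\ Psi88_cvg a s1 q (- (b ^+ 2 / a)),
      Psi88_cvg (- a) s2 q (b ^+ 2 / a) &
      Psi88 a s1 q (- (b ^+ 2 / a)) =
        N1 / D1 * Psi88 (- a) s2 q (b ^+ 2 / a) + N2 / D2].
Proof.
case/andP: hq => q0 q1 s1 s2 N1 D1 N2 D2 hs1 hs2 hD1 hD2.
have uq : sqrtc q ^+ 2 = q by exact: sqr_sqrtc.
have u0 : sqrtc q != 0.
  by apply: contraTneq q0 => u0; rewrite -uq u0 expr0n normr0 ltxx.
have u1 : `|sqrtc q| < 1.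
  by rewrite -(@ltr_pXn2r _ 2) ?nnegrE // expr1n -normrX uq.
have := @psi88_three_term R[i] _ u0 u1 (sqrtc a) 'i%C a b c d (sqr_sqrtc a) (sqr_i R) ha hb hc hd hab.
by rewrite uq => /(_ hs1 hs2 hD1 hD2).
Qed.
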